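(* Let $\Omega$ be a smooth bounded pseudoconvex domain in $\mathbb{C}^n$ and let $U\subset\Omega$ be a non-empty open subset. Assume that there exists a closed noncompact subgroup $G$ of the topological group $\mathrm{Aut}(\Omega)$ of biholomorphic automorphisms of $\Omega$ such that $f(U)\subset U$ for all $f\in G$. Then the operator $T_U$ on $A^2(\Omega)$ is non-compact.
   Context: ''Smooth'' means that the boundary of $\Omega$ is $C^\infty$-smooth. $\mathrm{Aut}(\Omega)$ carries the compact-open topology. For an open set $W\subset\mathbb{C}^n$, $A^2(W)$ is the Bergman space: the Hilbert space of holomorphic functions on $W$ square integrable with respect to Lebesgue measure. $R_U:A^2(\Omega)\to A^2(U)$ is the restriction operator $R_Uf=f|_U$ and $T_U=R_U^*R_U:A^2(\Omega)\to A^2(\Omega)$, where $R_U^*$ is the Hilbert space adjoint. Equivalently, $T_Uf=P(\chi_Uf)$ with $P:L^2(\Omega)\to A^2(\Omega)$ the Bergman (orthogonal) projection and $\chi_U$ the characteristic function of $U$. *)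

(* Defs.v *)
(* C^n is 'rV[R[i]]_n, with R an arbitrary realType. *)
From HB Require Import structures.
From mathcomp Require Import all_boot all_order all_algebra.
From mathcomp Require Import all_classical all_reals all_analysis.
From mathcomp Require Import complex lra.

Set Implicit Arguments.
Unset Strict Implicit.
Unset Printing Implicit Defensive.

Import Order.TTheory GRing.Theory Num.Theory.
Import numFieldNormedType.Exports.

Local Open Scope classical_set_scope.
Local Open Scope ring_scope.

(* R[i] with the topology of its norm, as a normed module over itself. *)
HB.instance Definition _ (R : realType) := NormedModule.copy R[i] R[i]^o.

Lemma sigma_finite_product d1 d2 (T1 : measurableType d1)
    (T2 : measurableType d2) (R : realType)
    (m1 : {sigma_finite_measure set T1 -> \bar R})
    (m2 : {sigma_finite_measure set T2 -> \bar R}) :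
  sigma_finite setT (m1 \x m2)%E.
Proof.
have /sigma_finiteP[F [TF ndF Foo]] := sigma_finiteT m1.
have /sigma_finiteP[G [TG ndG Goo]] := sigma_finiteT m2.
exists (fun n => F n `*` G n).
  rewrite -setXTT TF TG predeqE => -[x y]; split.
    move=> [/= [n _ Fnx] [k _ Gky]]; exists (maxn n k) => //; split.
    - by move: x Fnx; exact/subsetPset/ndF/leq_maxl.
    - by move: y Gky; exact/subsetPset/ndG/leq_maxr.
  by move=> [n _ []/= ? ?]; split; exists n.
move=> k; have [? ?] := Foo k; have [? ?] := Goo k.
split; first exact: measurableX.
by rewrite product_measure1E// lte_mul_pinfty// ge0_fin_numE.
Qed.

Section tuple_measure.
Context d (T : measurableType d) (R : realType).
Local Open Scope ereal_scope.

Definition tcons n (p : (T * n.-tuple T)%type) : n.+1.-tuple T :=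
  [the n.+1.-tuple T of p.1 :: p.2].

Definition tuncons n (t : n.+1.-tuple T) : (T * n.-tuple T)%type :=
  (thead t, [tuple of behead t]).

Lemma tunconsK n : cancel (@tuncons n) (@tcons n).
Proof. by move=> t; rewrite /tcons /= [RHS]tuple_eta; exact/val_inj. Qed.

Lemma measurable_tcons n : measurable_fun [set: (T * n.-tuple T)%type] (@tcons n).
Proof. exact: measurable_cons. Qed.

Lemma measurable_tuncons n : measurable_fun [set: n.+1.-tuple T] (@tuncons n).
Proof.
apply/measurable_fun_pairP; split; first exact: measurable_tnth.
exact: measurable_behead.
Qed.

Section step.
Variables (n : nat) (m1 : {sigma_finite_measure set T -> \bar R}).
Variable m2 : {sigma_finite_measure set (n.-tuple T) -> \bar R}.

(* The image of m1 \x m2 under T * T^n = T^(n+1). *)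
Definition tcons_measure (A : set (n.+1.-tuple T)) : \bar R :=
  pushforward (m1 \x m2) (@tcons n) A.

Let tcons_measure0 : tcons_measure set0 = 0.
Proof. by rewrite /tcons_measure /pushforward preimage_set0 measure0. Qed.

Let tcons_measure_ge0 A : 0 <= tcons_measure A.
Proof. by rewrite /tcons_measure /pushforward; exact: measure_ge0. Qed.

Let tcons_measure_sigma_additive : semi_sigma_additive tcons_measure.
Proof.
have mpre (A : set (n.+1.-tuple T)) : measurable A ->
    measurable (@tcons n @^-1` A).
  by move=> mA; rewrite -[X in measurable X]setTI; exact: measurable_tcons.
move=> F mF tF mUF; rewrite /tcons_measure /pushforward preimage_bigcup.
apply: measure_semi_sigma_additive.
- by move=> k; exact: mpre.
- apply/trivIsetP => /= i j _ _ ij; rewrite -preimage_setI.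
  by move/trivIsetP : tF => /(_ _ _ _ _ ij) ->//; rewrite preimage_set0.
- by rewrite -preimage_bigcup; exact: mpre.
Qed.

HB.instance Definition _ := isMeasure.Build _ _ _ tcons_measure
  tcons_measure0 tcons_measure_ge0 tcons_measure_sigma_additive.

Let tcons_measure_sigma_finite : sigma_finite setT tcons_measure.
Proof.
have [F FT Foo] := sigma_finite_product m1 m2.
exists (fun k => @tuncons n @^-1` F k).
  by rewrite -preimage_bigcup -FT preimage_setT.
move=> k; have [mF Fk] := Foo k; split.
  by rewrite -[X in measurable X]setTI; exact: measurable_tuncons.
rewrite /tcons_measure /pushforward; apply: le_lt_trans Fk.
apply: le_measure; rewrite ?inE//.
  rewrite -[X in measurable X]setTI; apply: measurable_tcons => //.
  by rewrite -[X in measurable X]setTI; exact: measurable_tuncons.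
by move=> [x t]; rewrite /tuncons /tcons /= theadE; congr F; congr pair;
  exact/val_inj.
Qed.

HB.instance Definition _ := Measure_isSigmaFinite.Build _ _ _ tcons_measure
  tcons_measure_sigma_finite.

End step.

Fixpoint tuple_measure (mu : {sigma_finite_measure set T -> \bar R}) (n : nat) :
    {sigma_finite_measure set (n.-tuple T) -> \bar R} :=
  match n with
  | 0%N => \d_ [tuple]
  | m.+1 => tcons_measure mu (tuple_measure mu m)
  end.

End tuple_measure.

Local Open Scope complex_scope.

Section complex_space.
Context (R : realType) (n : nat).
Local Notation Cn := 'rV[R[i]]_n.

Definition lebesgueR2n := tuple_measure (@lebesgue_measure R) (n + n).

(* The identification of R^(2n) with C^n. *)
Definition toCn (t : (n + n).-tuple (measurableTypeR R)) : Cn :=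
  \row_j (tnth t (lshift n j) +i* tnth t (rshift n j)).

Definition Cn_integrable (W : set Cn) (f : Cn -> R) : Prop :=
  lebesgueR2n.-integrable (toCn @^-1` W) (fun t => (f (toCn t))%:E).

Definition Cn_integral (W : set Cn) (f : Cn -> R) : R :=
  \int[lebesgueR2n]_(t in toCn @^-1` W) f (toCn t).

Lemma measurable_toCn_open (W : set Cn) : open W ->
  measurable (toCn @^-1` W).
Proof.
move=> oW.
pose box (i : {ffun 'I_(n + n) -> rat} * rat) :
    set ((n + n).-tuple (measurableTypeR R)) :=
  \bigcap_(j in [set: 'I_(n + n)])
    (@tnth _ (measurableTypeR R) ^~ j @^-1` ball (ratr (i.1 j) : R) (ratr i.2)).
have mbox i : measurable (box i).
  apply: fin_bigcap_measurable; first exact: finite_finset.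
  move=> j _; rewrite -[X in measurable X]setTI; apply: measurable_tnth => //.
  by rewrite ball_itv; exact: measurable_itv.
have -> : toCn @^-1` W =
    \bigcup_i (if `[< box i `<=` toCn @^-1` W >] then box i else set0).
  apply/seteqP; split => [t Wt|t [i _]]; last first.
    by case: ifPn => // /asboolP; exact.
  have : nbhs (toCn t) W by apply: open_nbhs_nbhs.
  move=> /nbhs_ballP[e /= e0 eW].
  have [r re] : exists r : R, e = r%:C.
    by exists (complex.Re e); rewrite RRe_real// gtr0_real.
  rewrite {}re in e0 eW.
  have r0 : 0 < r by move: e0; rewrite ltcR.
  have r40 : 0 < r / 4 by rewrite divr_gt0.
  have [q /andP[q0 q4]] : exists q : rat, 0 < (ratr q : R) < r / 4.
    by have [q qr] := rat_in_itvoo r40; exists q; move: qr; rewrite in_itv.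
  have : forall j, exists p : rat, `|ratr p - tnth t j| < ratr q :> R.
    move=> j.
    have [|p] := @rat_in_itvoo R (tnth t j) (tnth t j + ratr q).
      by rewrite ltrDl.
    rewrite in_itv /= => /andP[p1 p2]; exists p.
    by rewrite ger0_norm ?subr_ge0 ?ltW// ltrBlDl.
  move=> /choice[p pt]; exists ([ffun j => p j], q) => //.
  rewrite ifT; last first.
    apply/asboolP => s sbox; apply: eW; split => // i j.
    rewrite !mxE /ball /= normc_def /= ltcR.
    have st k : `|tnth t k - tnth s k| < r / 2.
      have := sbox k I; rewrite /ball /= ffunE => spk.
      rewrite -[_ - _](subrKA (ratr (p k))).
      apply: le_lt_trans (ler_normD _ _) _.
      rewrite -(distrC (ratr (p k))) (splitr (r / 2)).
      rewrite ltrD//; apply: lt_trans; [exact: pt| |exact: spk|].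
        by rewrite -mulrA -invfM -natrM.
      by rewrite -mulrA -invfM -natrM.
    rewrite -[ltRHS]gtr0_norm// -sqrtr_sqr ltr_sqrt ?exprn_gt0//.
    have sq k : (tnth t k - tnth s k) ^+ 2 < (r / 2) ^+ 2.
      by rewrite -real_normK ?num_real// ltr_pXn2r ?nnegrE// divr_ge0 ?ltW.
    apply: (lt_le_trans (ltrD (sq _) (sq _))).
    have := sqr_ge0 r; rewrite expr_div_n; lra.
  by move=> k _; rewrite /= /ball /= ffunE.
apply: countable_bigcupT_measurable; first exact: countableP.
by move=> i; case: ifPn.
Qed.

(* Complex differentiability, the scalar field of 'rV[R[i]]_n being R[i]. *)
Definition holomorphic (V : normedModType R[i]) (W : set Cn) (f : Cn -> V) :
  Prop := forall z, W z -> differentiable f z.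

(* Real differentiability on C^n = R^(2n) is expressed by the derivatives at 0
   of t |-> f (z + t v), t real; on an open set, f is C^k iff all its iterated
   directional derivatives of order at most k exist and are continuous. *)
Definition real_line (f : Cn -> R) (z v : Cn) : R -> R :=
  fun t => f (z + t%:C *: v).

Fixpoint real_Ck (k : nat) (V : set Cn) (f : Cn -> R) : Prop :=
  (forall z, V z -> {for z, continuous f}) /\
  match k with
  | 0%N => True
  | m.+1 => forall v,
      (forall z, V z -> derivable (real_line f z v) 0 1) /\
      real_Ck m V (fun z => derive1 (real_line f z v) 0)
  end.

Definition real_smooth (V : set Cn) (f : Cn -> R) : Prop :=
  forall k, real_Ck k V f.

(* For W open, closure W `\` W is the boundary of W; rho is a local defining
   function. *)
Definition smooth_boundary (W : set Cn) : Prop :=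
  forall p, (closure W `\` W) p -> exists (V : set Cn) (rho : Cn -> R),
    [/\ open V, V p, real_smooth V rho,
        exists v, derive1 (real_line rho p v) 0 != 0
      & W `&` V = [set z | rho z < 0] `&` V].

(* Plurisubharmonicity of a continuous real-valued function: the submean value
   inequality on every closed disc z + tau w, |tau| <= 1, contained in W. *)
Definition continuous_psh (W : set Cn) (u : Cn -> R) : Prop :=
  (forall z, W z -> {for z, continuous u}) /\
  forall z w : Cn, (forall tau : R[i], `|tau| <= 1 -> W (z + tau *: w)) ->
    u z <= (2 * pi)^-1 *
      \int[@lebesgue_measure R]_(t in `[0, 2 * pi])
        u (z + (cos t +i* sin t) *: w).

(* Existence of a continuous plurisubharmonic exhaustion function. *)
Definition pseudoconvex (W : set Cn) : Prop :=
  exists u : Cn -> R, continuous_psh W u /\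
    forall c : R, compact (W `&` [set z | u z <= c]).

(* A biholomorphic self-map of W is encoded, together with its inverse, as a
   bijection of C^n that is the identity off W: equality in Aut W is then
   equality of maps on W (lemma aut_eq). *)
Record Aut (W : set Cn) := MkAut {
  aut_fun :> Cn -> Cn;
  aut_inv : Cn -> Cn;
  aut_hol : holomorphic W aut_fun;
  aut_inv_hol : holomorphic W aut_inv;
  aut_maps : forall z, W z -> W (aut_fun z);
  aut_inv_maps : forall z, W z -> W (aut_inv z);
  aut_funK : cancel aut_fun aut_inv;
  aut_invK : cancel aut_inv aut_fun;
  aut_out : forall z, ~ W z -> aut_fun z = z
}.

Section automorphisms.
Variable W : set Cn.
Implicit Types f g : Aut W.

Lemma aut_eq f g : (forall z, W z -> f z = g z) -> f = g.
Proof.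
move=> fgW; have fg : aut_fun f = aut_fun g.
  apply/funext => z; have [Wz|Wz] := pselect (W z); first exact: fgW.
  by rewrite !aut_out.
have fg' : aut_inv f = aut_inv g.
  apply/funext => z; apply: (can_inj (aut_funK g)).
  by rewrite aut_invK -fg aut_invK.
case: f g fg fg' {fgW} => [f f' hf hf' Wf Wf' fK fK' fo].
case=> [g g' hg hg' Wg Wg' gK gK' go] /= fg fg'; subst g g'.
by congr MkAut; apply: Prop_irrelevance.
Qed.

Lemma aut_inv_out f z : ~ W z -> aut_inv f z = z.
Proof. by move=> Wz; rewrite -[in LHS](aut_out f Wz) aut_funK. Qed.

HB.instance Definition _ := gen_eqMixin (Aut W).
HB.instance Definition _ := gen_choiceMixin (Aut W).

Definition aut1 : Aut W.
Proof.
apply: (@MkAut W id id) => // z _; exact: differentiable_id.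
Defined.

Definition autV f : Aut W :=
  MkAut (aut_inv_hol f) (aut_hol f) (aut_inv_maps f) (aut_maps f)
    (aut_invK f) (aut_funK f) (aut_inv_out f).

Definition autM f g : Aut W.
Proof.
apply: (@MkAut W (f \o g) (aut_inv g \o aut_inv f)).
- by move=> z Wz; apply: differentiable_comp;
    [exact: aut_hol|apply: aut_hol; exact: aut_maps].
- by move=> z Wz; apply: differentiable_comp;
    [exact: aut_inv_hol|apply: aut_inv_hol; exact: aut_inv_maps].
- by move=> z Wz; apply: aut_maps; exact: aut_maps.
- by move=> z Wz; apply: aut_inv_maps; exact: aut_inv_maps.
- by apply: can_comp; exact: aut_funK.
- by apply: can_comp; exact: aut_invK.
- by move=> z Wz; rewrite /= !aut_out.
Defined.

Fact autMA : associative autM.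
Proof. by move=> f g h; exact: aut_eq. Qed.
Fact aut1M : left_id aut1 autM.
Proof. by move=> f; exact: aut_eq. Qed.
Fact autM1 : right_id aut1 autM.
Proof. by move=> f; exact: aut_eq. Qed.
Fact autVM : left_inverse aut1 autV autM.
Proof. by move=> f; apply: aut_eq => z _; exact: aut_funK. Qed.
Fact autMV : right_inverse aut1 autV autM.
Proof. by move=> f; apply: aut_eq => z _; exact: aut_invK. Qed.

HB.instance Definition _ := isGroup.Build (Aut W) autMA aut1M autM1 autVM autMV.

(* The compact-open topology. W carries the induced topology, and maps W -> W
   are regarded as maps W -> C^n, which induces the same topology on them. *)
HB.instance Definition _ := Topological.copy (Aut W)
  (@initial_topology (Aut W) {compact-open, W -> Cn}
     (fun f => aut_fun f \o set_val)).

Definition subgroup (G : set (Aut W)) : Prop :=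
  [/\ G 1%g, forall f g, G f -> G g -> G (f * g)%g
    & forall f, G f -> G f^-1%g].

End automorphisms.

(* A function on W is encoded by its extension by 0 to C^n. *)
Record Bergman (W : set Cn) := MkBergman {
  berg_fun :> Cn -> R[i];
  berg_hol : holomorphic W berg_fun;
  berg_sqint : Cn_integrable W (fun z => Normc.normc (berg_fun z) ^+ 2);
  berg_out : forall z, ~ W z -> berg_fun z = 0
}.

Definition L2inner (W : set Cn) (f g : Cn -> R[i]) : R[i] :=
  Cn_integral W (fun z => complex.Re (f z * (g z)^*)) +i*
  Cn_integral W (fun z => complex.Im (f z * (g z)^*)).

Definition L2norm (W : set Cn) (f : Cn -> R[i]) : R :=
  Num.sqrt (Cn_integral W (fun z => Normc.normc (f z) ^+ 2)).

Lemma near_eq_differentiable (V : normedModType R[i]) (f g : Cn -> V) z :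
  (\near z, f z = g z) -> differentiable f z -> differentiable g z.
Proof.
move=> fg /diffP[cf df].
have fz : f z = g z by exact: nbhs_singleton fg.
have limz : lim (nbhs_filter_on z) = z by rewrite lim_id.
apply/diffP; apply: (@getPex _ (fun L : {linear Cn -> V} => continuous L /\ _)).
exists ('d f z); split => //; apply/funeqP; apply/eqaddoP => _/posnumP[e].
move/funeqP : df => /eqaddoP/(_ _ (gt0 e)); rewrite limz => df.
near=> x; have -> : (g - (fun y => g z + 'd f z (y - z))) x =
    (f - (fun y => f z + 'd f z (y - z))) x.
  by rewrite /= fz; congr (_ - _); rewrite -(near fg x).
by near: x.
Unshelve. all: by end_near. Qed.

Section restriction.
Variables (W U : set Cn) (oW : open W) (oU : open U) (UW : U `<=` W).

Lemma berg_restr_hol (f : Bergman W) :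
  holomorphic U (patch (fun=> 0) U f).
Proof.
move=> z Uz; apply: (@near_eq_differentiable _ f).
  have : nbhs z U by apply: open_nbhs_nbhs.
  by apply: filterS => x /mem_set Ux; rewrite patchT.
by apply: berg_hol; exact: UW.
Qed.

Lemma berg_restr_sqint (f : Bergman W) :
  Cn_integrable U (fun z => Normc.normc (patch (fun=> 0) U f z) ^+ 2).
Proof.
have := berg_sqint f; rewrite /Cn_integrable.
move=> /(integrableS (measurable_toCn_open oW) (measurable_toCn_open oU)).
move=> /(_ (fun t => @UW _)); apply: eq_integrable.
  exact: measurable_toCn_open.
by move=> t /set_mem Ut; rewrite patchT// mem_set.
Qed.

Definition berg_restr (f : Bergman W) : Bergman U.
Proof.
apply: (MkBergman (berg_restr_hol f) (berg_restr_sqint f)).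
by move=> z Uz; rewrite patchN// notin_setE.
Defined.

End restriction.

(* S' is the Hilbert space adjoint of S. For S bounded linear there is exactly
   one such S', as Bergman spaces over open sets are Hilbert spaces. *)
Definition is_adjoint (W U : set Cn) (S : Bergman W -> Bergman U)
    (S' : Bergman U -> Bergman W) : Prop :=
  forall (f : Bergman W) (g : Bergman U),
    L2inner U (S f) g = L2inner W f (S' g).

(* For T linear: bounded sequences are mapped to sequences having a
   norm-convergent subsequence. *)
Definition compact_operator (W U : set Cn) (T : Bergman W -> Bergman U) :
    Prop :=
  forall f : nat -> Bergman W,
    (exists M : R, forall k, L2norm W (f k) <= M) ->
    exists (phi : nat -> nat) (g : Bergman U),
      {homo phi : i j / (i < j)%N} /\
      L2norm U (fun z => T (f (phi k)) z - g z) @[k --> \oo] --> (0 : R).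

End complex_space.

(* Main.v *)
(* Were every f in G to move some point of a fixed compact L to a point of L, a
   normal families argument would make G compact. So, exhausting Omega by
   compacts L_k, there are f_k in G with f_k(L_k) disjoint from L_k. Let
   J_k = det f_k'. Up to constants, the integral of |J_k|^2 over A is the
   volume of f_k(A): it is bounded for A = Omega, constant for A = U as
   f_k(U) = U, and tends to 0 for A compact, as f_k(A) eventually leaves L_k.
   Hence J_k tends weakly to 0 in A^2(Omega). If T_U were compact, a subsequence
   of T_U J_k would converge in norm and |J_k|_U^2 = <T_U J_k, J_k> would tend
   to 0 along it, a contradiction. The change of variables is needed only as
   an inequality up to a constant; Cauchy-Schwarz is replaced by the inequality
   ab <= e a^2 + b^2 / e. *)
Require Import Defs.
From HB Require Import structures.
From mathcomp Require Import all_boot all_order all_algebra.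
From mathcomp Require Import all_classical all_reals all_analysis.
From mathcomp Require Import complex measurable_realfun perm ring lra.

Set Implicit Arguments.
Unset Strict Implicit.
Unset Printing Implicit Defensive.

Import Order.TTheory GRing.Theory Num.Theory.
Import numFieldNormedType.Exports.

Local Open Scope classical_set_scope.
Local Open Scope ring_scope.
Local Open Scope complex_scope.

(** Two obstacles shape the proof. First, a limit of automorphisms might degenerate at the boundary.
    This is excluded by [cara_le], a distance bound invariant under automorphisms: near each point
    it is dominated by the Euclidean distance, by the Cauchy estimates, and it dominates the
    Euclidean distance because Omega is bounded. It makes Aut(Omega) equicontinuous and shows that
    the points whose images converge inside Omega form an open and closed subset of Omega, so that
    connectedness applies. The inverses are treated alike, and the two limits are inverse to each
    other. Second, the Jacobian. A complex linear map L scales volumes by a factor kappa(L), by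
    uniqueness of translation invariant measures. A triangular factorization bounds kappa(L) by K
    |det L|^2; as kappa is multiplicative, this bound for the inverse of L is a lower bound for L.
    Comparing f with its differential on small dyadic cells transfers both bounds to integrals of
    |det f'|^2. Ultrafilters take the place of sequences: along them bounded quantities converge at
    once, all derivatives and all values simultaneously. *)

Section real_norm.
Context {R : realType}.
Implicit Types V W : normedModType R[i].

(* `|x| is an element of R[i]; nrm x is the same number in R. *)
Definition nrm V (x : V) : R := complex.Re `|x|.

Lemma nrmE V (x : V) : `|x| = (nrm x)%:C.
Proof. by rewrite /nrm RRe_real// ger0_real. Qed.

Lemma nrm_ge0 V (x : V) : 0 <= nrm x.
Proof. by rewrite -lecR -nrmE; exact: normr_ge0. Qed.

Lemma nrm0 V : nrm (0 : V) = 0.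
Proof. by rewrite /nrm normr0. Qed.

Lemma nrm_gt0 V (x : V) : x != 0 -> 0 < nrm x.
Proof. by move=> x0; rewrite -ltcR -nrmE -[X in X < _]/(0 : R[i]) normr_gt0. Qed.

Lemma nrmN V (x : V) : nrm (- x) = nrm x.
Proof. by rewrite /nrm normrN. Qed.

Lemma nrmC V (x y : V) : nrm (x - y) = nrm (y - x).
Proof. by rewrite /nrm distrC. Qed.

Lemma nrmD V (x y : V) : nrm (x + y) <= nrm x + nrm y.
Proof. by rewrite -lecR rmorphD /= -!nrmE ler_normD. Qed.

Lemma nrmB V (x y : V) : nrm (x - y) <= nrm x + nrm y.
Proof. by rewrite -(nrmN y) nrmD. Qed.

Lemma nrm_triangle V (x y z : V) : nrm (x - z) <= nrm (x - y) + nrm (y - z).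
Proof. by rewrite -{1}(subrK y x) -addrA nrmD. Qed.

Lemma nrmM (x y : R[i]) : nrm (x * y) = nrm x * nrm y.
Proof. by apply: complexI; rewrite rmorphM /= -!nrmE normrM. Qed.

Lemma nrmV (x : R[i]) : nrm x^-1 = (nrm x)^-1.
Proof. by apply: complexI; rewrite fmorphV /= -!nrmE normfV. Qed.

Lemma nrmZ V (a : R[i]) (x : V) : nrm (a *: x) = nrm a * nrm x.
Proof. by apply: complexI; rewrite rmorphM /= -!nrmE normrZ. Qed.

Lemma nrm_real (x : R) : nrm (x%:C : R[i]) = `|x|.
Proof. by rewrite /nrm normc_def /= expr0n /= addr0 sqrtr_sqr. Qed.

Lemma nrm_i : nrm ('i : R[i]) = 1.
Proof. by rewrite /nrm normc_def /= expr0n /= add0r expr1n sqrtr1. Qed.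

Lemma nrm1 : nrm (1 : R[i]) = 1.
Proof. by rewrite nrm_real normr1. Qed.

Lemma nrm_normc (x : R[i]) : nrm x = Normc.normc x.
Proof. by case: x. Qed.

Lemma sqr_nrm (x : R[i]) : nrm x ^+ 2 = complex.Re x ^+ 2 + complex.Im x ^+ 2.
Proof. by rewrite /nrm normc_def /= sqr_sqrtr// addr_ge0// sqr_ge0. Qed.

Lemma Re_le_nrm (x : R[i]) : `|complex.Re x| <= nrm x.
Proof.
rewrite -(ler_pXn2r (_ : 0 < 2)%N) ?nnegrE ?nrm_ge0//.
by rewrite real_normK ?num_real// sqr_nrm lerDl sqr_ge0.
Qed.

Lemma Im_le_nrm (x : R[i]) : `|complex.Im x| <= nrm x.
Proof.
rewrite -(ler_pXn2r (_ : 0 < 2)%N) ?nnegrE ?nrm_ge0//.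
by rewrite real_normK ?num_real// sqr_nrm lerDr sqr_ge0.
Qed.

Lemma nrm_le_ReIm (x : R[i]) : nrm x <= `|complex.Re x| + `|complex.Im x|.
Proof.
have -> : x = (complex.Re x)%:C + 'i * (complex.Im x)%:C.
  by case: x => a b; simpc.
apply: (le_trans (nrmD _ _)); rewrite nrmM nrm_i mul1r !nrm_real.
by case: x => a b; simpc.
Qed.

Lemma ball_nrmP V (x : V) (r : R) y : ball x r%:C y <-> nrm (y - x) < r.
Proof. by rewrite -ball_normE /ball_ /= distrC nrmE ltcR. Qed.

Lemma nbhs_nrmP V (x : V) (A : set V) :
  nbhs x A <-> exists2 r : R, 0 < r & forall y, nrm (y - x) < r -> A y.
Proof.
split=> [/nbhs_ballP[e /= e0 eA]|[r r0 rA]].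
  have er : e = (complex.Re e)%:C by rewrite RRe_real// gtr0_real.
  rewrite er in e0 eA; exists (complex.Re e); first by move: e0; rewrite ltcR.
  by move=> y /ball_nrmP; exact: eA.
apply/nbhs_ballP; exists r%:C => /=; first by rewrite ltcR.
by move=> y /ball_nrmP; exact: rA.
Qed.

Lemma differentiable_nrm V W (f : V -> W) z : differentiable f z ->
  forall e : R, 0 < e -> exists2 d : R, 0 < d & forall h, nrm h < d ->
    nrm (f (z + h) - f z - 'd f z h) <= e * nrm h.
Proof.
move=> /diff_locallyP[_ fz] e e0.
move/eqaddoP: fz => /(_ e%:C); rewrite ltcR => /(_ e0).
move=> /nbhs_nrmP[d d0 dP]; exists d => // h hd.
have := dP h; rewrite subr0 => /(_ hd).
rewrite /= !nrmE -rmorphM /= lecR.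
suff -> : (f \o shift z - (cst (f z) + 'd f z)) h = f (z + h) - f z - 'd f z h.
  by [].
by rewrite !fctE /= opprD addrA [h + z]addrC.
Qed.

Lemma nrm_differentiable V W (f : V -> W) z (L : {linear V -> W}) :
  continuous L ->
  (forall e : R, 0 < e -> exists2 d : R, 0 < d & forall h, nrm h < d ->
    nrm (f (z + h) - f z - L h) <= e * nrm h) ->
  differentiable f z /\ 'd f z = L :> (V -> W).
Proof.
move=> Lc Lf.
have dfz : f \o shift z = cst (f z) + L +o_ (0 : V) id.
  apply/eqaddoP => e e0.
  have er : e = (complex.Re e)%:C by rewrite RRe_real// gtr0_real.
  have [|d d0 dP] := Lf (complex.Re e); first by move: e0; rewrite er ltcR.
  apply/nbhs_nrmP; exists d => // h; rewrite subr0 => /dP.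
  rewrite /= !nrmE er -rmorphM /= lecR.
  suff -> : (f \o shift z - (cst (f z) + L)) h = f (z + h) - f z - L h by [].
  by rewrite !fctE /= opprD addrA [h + z]addrC.
have dE := diff_unique Lc dfz; split => //.
by apply/diff_locallyP; rewrite dE; split.
Qed.

End real_norm.

(** * One complex variable *)

Section trapezoid.
Context {R : realType}.
Local Notation C := R[i].
Implicit Types (f g : C -> C) (p v w z : C).

(* The trapezoid sum, over 3^m equal pieces, of the integral of g along the
   segment from p to p + v. Only these sums are used: path integrals are never
   needed, and subdividing into three keeps a middle square, so that an annulus
   is handled by the same subdivision. *)
Fixpoint Ls m g p v : C :=
  if m is k.+1 then
    Ls k g p (v / 3) + Ls k g (p + v / 3) (v / 3) + Ls k g (p + v / 3 *+ 2) (v / 3)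
  else (g p + g (p + v)) / 2 * v.

(* The same for the boundary of the square with corner p and side v. *)
Definition Sq m g p v : C :=
  Ls m g p v + Ls m g (p + v) ('i * v) - Ls m g (p + 'i * v) v
    - Ls m g p ('i * v).

(** An interior edge belongs to two adjacent subsquares, with opposite signs. The identity is exact
    because level [m.+1] along a side is by definition level [m] along each third. *)
Lemma Sq_subdivide m g p v :
  Sq m.+1 g p v = \sum_(a < 3) \sum_(b < 3)
    Sq m g (p + v / 3 *+ a + ('i * (v / 3)) *+ b) (v / 3).
Proof.
set w := v / 3; have vE : v = w *+ 3 by rewrite /w; field.
pose pt a b := p + w *+ a + ('i * w) *+ b.
have SE a b : Sq m g (pt a b) w = Ls m g (pt a b) w
    + Ls m g (pt a.+1 b) ('i * w) - Ls m g (pt a b.+1) w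
    - Ls m g (pt a b) ('i * w).
  rewrite /Sq; congr (_ + Ls _ _ _ _ - Ls _ _ _ _ - _).
    by rewrite /pt mulrSr; ring.
  by rewrite /pt [in RHS]mulrSr; ring.
under eq_bigr do under eq_bigr do rewrite -/(pt _ _) SE.
rewrite !big_ord_recr !big_ord0 /=.
have -> : Sq m.+1 g p v =
    (Ls m g (pt 0 0) w + Ls m g (pt 1 0) w + Ls m g (pt 2 0) w)
    + (Ls m g (pt 3 0) ('i * w) + Ls m g (pt 3 1) ('i * w) + Ls m g (pt 3 2) ('i * w))
    - (Ls m g (pt 0 3) w + Ls m g (pt 1 3) w + Ls m g (pt 2 3) w)
    - (Ls m g (pt 0 0) ('i * w) + Ls m g (pt 0 1) ('i * w) + Ls m g (pt 0 2) ('i * w)).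
  rewrite /Sq /= -!mulrA -!/w vE /pt !mulr0n !mulr1n !addr0.
  congr (_ + (_ + Ls _ _ _ _ + Ls _ _ _ _) - (Ls _ _ _ _ + Ls _ _ _ _ + Ls _ _ _ _) - _);
   ring.
ring.
Qed.

Lemma LsD m f g p v : Ls m (fun z => f z + g z) p v = Ls m f p v + Ls m g p v.
Proof. by elim: m p v => [|m IH] p v /=; [|rewrite !IH]; ring. Qed.

Lemma LsZ m a g p v : Ls m (fun z => a * g z) p v = a * Ls m g p v.
Proof. by elim: m p v => [|m IH] p v /=; [|rewrite !IH]; ring. Qed.

(** The trapezoid rule is exact on affine functions at every level. Hence [Sq_affine]: on a small
    square only the error of the affine approximation contributes. *)
Lemma Ls_affine m a b p v :
  Ls m (fun z => a + b * z) p v = a * v + b * (p * v + v * v / 2).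
Proof. by elim: m p v => [|m IH] p v /=; [|rewrite !IH]; field. Qed.

Lemma SqD m f g p v : Sq m (fun z => f z + g z) p v = Sq m f p v + Sq m g p v.
Proof. by rewrite /Sq !LsD; ring. Qed.

Lemma SqZ m a g p v : Sq m (fun z => a * g z) p v = a * Sq m g p v.
Proof. by rewrite /Sq !LsZ; ring. Qed.

Lemma Sq_affine m a b p v : Sq m (fun z => a + b * z) p v = 0.
Proof. by rewrite /Sq !Ls_affine; field. Qed.

(* Both the norm bound and the lower bound on imaginary parts are instances of
   a bound by a convex, positively homogeneous function. *)
Lemma Ls_convex (q : C -> R) m g p v (B : R) :
  (forall x y, q (x + y) <= q x + q y) ->
  (forall (a : R) x, 0 <= a -> q (a%:C * x) = a * q x) ->
  (forall u : R, 0 <= u <= 1 -> q (g (p + u%:C * v) * v) <= B) ->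
  q (Ls m g p v) <= B.
Proof.
move=> qD qZ; elim: m p v B => [|m IH] p v B gB /=.
  have := gB 0; have := gB 1; rewrite rmorph0 rmorph1 mul0r mul1r addr0.
  rewrite !lexx ler01 /= => /(_ isT) B1 /(_ isT) B2.
  have -> : (g p + g (p + v)) / 2 * v =
      (2^-1 : R)%:C * (g p * v) + (2^-1 : R)%:C * (g (p + v) * v).
    by rewrite fmorphV /= rmorph_nat; field.
  by apply: (le_trans (qD _ _)); rewrite !qZ ?invr_ge0//; lra.
have pr k (u : R) : (k < 3)%N -> 0 <= u <= 1 -> 0 <= (u + k%:R) / 3 <= 1.
  by case: k => [|[|[|//]]] _ /andP[u0 u1]; lra.
have E k (u : R) : p + v / 3 *+ k + u%:C * (v / 3) = p + ((u + k%:R) / 3)%:C * v.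
  rewrite rmorphM fmorphV /= rmorphD /= !rmorph_nat -mulr_natr; by field.
have H (j : nat) : (j < 3)%N -> q (Ls m g (p + v / 3 *+ j) (v / 3)) <= B / 3.
  move=> k3; apply: IH => u u01; rewrite E.
  have -> : v / 3 = (3^-1 : R)%:C * v by rewrite fmorphV /= rmorph_nat; field.
  rewrite mulrCA qZ ?invr_ge0// mulrC ler_pM2r//; apply: gB; exact: pr.
have := H 0%N; have := H 1%N; have := H 2%N; rewrite addr0 mulr1n.
move=> /(_ isT) h2 /(_ isT) h1 /(_ isT) h0.
apply: (le_trans (qD _ _)); apply: (le_trans (lerD (qD _ _) h2)).
by lra.
Qed.

Lemma Ls_bound m g p v (B : R) :
  (forall u : R, 0 <= u <= 1 -> nrm (g (p + u%:C * v)) <= B) ->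
  nrm (Ls m g p v) <= B * nrm v.
Proof.
move=> gB; apply: Ls_convex => [x y|a x a0|u u01].
- exact: nrmD.
- by rewrite nrmM nrm_real ger0_norm.
- by rewrite nrmM ler_wpM2r ?nrm_ge0//; exact: gB.
Qed.

Lemma Ls_Im_ge m g p v (B : R) :
  (forall u : R, 0 <= u <= 1 -> B <= complex.Im (g (p + u%:C * v) * v)) ->
  B <= complex.Im (Ls m g p v).
Proof.
move=> gB; rewrite -lerN2.
apply: (@Ls_convex (fun x => - complex.Im x)) => [[a b] [c d]|a [b c] a0|u u01].
- by rewrite /=; lra.
- by rewrite /= mul0r addr0; ring.
- by rewrite lerN2; exact: gB.
Qed.

Definition on_square (p z : C) (s : R) : Prop :=
  complex.Re p <= complex.Re z <= complex.Re p + s /\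
  complex.Im p <= complex.Im z <= complex.Im p + s.

Definition on_edge (p z : C) (s : R) : Prop :=
  on_square p z s /\
  [\/ complex.Re z = complex.Re p, complex.Re z = complex.Re p + s,
      complex.Im z = complex.Im p | complex.Im z = complex.Im p + s].

Lemma on_edgeP (p : C) (s u : R) : 0 <= s -> 0 <= u <= 1 ->
  [/\ on_edge p (p + u%:C * s%:C) s, on_edge p (p + s%:C + u%:C * ('i * s%:C)) s,
   on_edge p (p + 'i * s%:C + u%:C * s%:C) s
   & on_edge p (p + u%:C * ('i * s%:C)) s].
Proof.
case: p => x y s0 u01; have us : 0 <= u * s <= s.
  by case/andP: u01 => u0 u1; rewrite mulr_ge0//= ler_piMl.
case/andP: us => a b; rewrite /on_edge /on_square; simpc => /=.
split; (split; first by lra).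
- by apply: Or43.
- by apply: Or42.
- by apply: Or44.
- by apply: Or41.
Qed.

Lemma Sq_bound m g p (s B : R) : 0 <= s ->
  (forall z, on_edge p z s -> nrm (g z) <= B) ->
  nrm (Sq m g p s%:C) <= 4 * B * s.
Proof.
move=> s0 gB.
have ns : nrm (s%:C : C) = s by rewrite nrm_real ger0_norm.
have nis : nrm ('i * s%:C : C) = s by rewrite nrmM nrm_i mul1r.
have H p' v : (forall u : R, 0 <= u <= 1 -> on_edge p (p' + u%:C * v) s) ->
    nrm v = s -> nrm (Ls m g p' v) <= B * s.
  by move=> pv <-; apply: Ls_bound => u u01; apply: gB; exact: pv.
have E u := @on_edgeP p s u s0.
have h1 : nrm (Ls m g p s%:C) <= B * s by apply: H => // u /E[].
have h2 : nrm (Ls m g (p + s%:C) ('i * s%:C)) <= B * s by apply: H => // u /E[].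
have h3 : nrm (Ls m g (p + 'i * s%:C) s%:C) <= B * s by apply: H => // u /E[].
have h4 : nrm (Ls m g p ('i * s%:C)) <= B * s by apply: H => // u /E[].
rewrite /Sq; apply: (le_trans (nrmB _ _)); apply: (le_trans (lerD (nrmB _ _) h4)).
apply: (le_trans (lerD (lerD (nrmD _ _) h3) (lexx _))); lra.
Qed.

End trapezoid.

Section goursat.
Context {R : realType}.
Local Notation C := R[i].
Implicit Types (f g : C -> C) (p v w z : C).

Definition subsquare p (t : R) (a b : 'I_3) : C :=
  p + (t / 3)%:C *+ a + ('i * (t / 3)%:C) *+ b.

Lemma subsquareE p t a b : subsquare p t a b =
  (complex.Re p + (t / 3) *+ a) +i* (complex.Im p + (t / 3) *+ b).
Proof.
case: p => x y; rewrite /subsquare -rmorphMn -mulrnAr -rmorphMn /=; simpc.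
by [].
Qed.

(** Otherwise a failing square has a failing subsquare, and the nested failing squares shrink to a
    point, around which small squares satisfy [P]. Stated as an induction principle, it allows [P]
    to hide a threshold, as in [goursat]. *)
Lemma cousin (P : C -> R -> Prop) p s : 0 < s ->
  (forall q t, 0 < t ->
    (forall a b, P (subsquare q t a b) (t / 3)) -> P q t) ->
  (forall z, on_square p z s -> exists2 d : R, 0 < d & forall q t,
    0 < t < d -> on_square q z t -> P q t) ->
  P p s.
Proof.
move=> s0 Psub Ploc; apply: contrapT => nP.
(* [F] picks a failing subsquare, and returns the square itself where nothing fails. *)
have /choice[F FP] : forall x : C * R, exists y : C * R,
    0 < x.2 -> ~ P x.1 x.2 -> ~ P y.1 y.2 /\
    exists a b, y = (subsquare x.1 x.2 a b, x.2 / 3).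
  move=> [q t]; have [tP|] := pselect (0 < t /\ ~ P q t); last first.
    by move=> h; exists (q, t) => /= h1 h2; case: h.
  have [a [b nab]] : exists a b, ~ P (subsquare q t a b) (t / 3).
    apply: contrapT => h; apply: tP.2; apply: Psub => [|a b]; first exact: tP.1.
    by apply: contrapT => h'; apply: h; exists a, b.
  by exists (subsquare q t a b, t / 3) => /= _ _; split => //; exists a, b.
pose u k := iter k F (p, s).
have uP k : (u k).2 = s / 3 ^+ k /\ ~ P (u k).1 (u k).2.
  elim: k => [|k [IH1 IH2]]; first by rewrite expr0 divr1.
  have u0 : 0 < (u k).2 by rewrite IH1 divr_gt0// exprn_gt0.
  have [? [a [b E]]] := FP _ u0 IH2; split => //.
  by rewrite [u k.+1]E /= IH1 exprSr invfM mulrA.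
have us k : 0 < (u k).2 by rewrite (uP k).1 divr_gt0// exprn_gt0.
have uS k : complex.Re (u k).1 <= complex.Re (u k.+1).1 /\
    complex.Re (u k.+1).1 + (u k.+1).2 <= complex.Re (u k).1 + (u k).2 /\
    complex.Im (u k).1 <= complex.Im (u k.+1).1 /\
    complex.Im (u k.+1).1 + (u k.+1).2 <= complex.Im (u k).1 + (u k).2.
  have [_ [a [b E]]] := FP _ (us k) (uP k).2; rewrite [u k.+1]E /= subsquareE /=.
  have hk (c : 'I_3) : 0 <= (u k).2 / 3 *+ c <= (u k).2 / 3 *+ 2.
    by case: c => -[|[|[|//]]] _ /=; have := us k; lra.
  have /andP[a1 a2] := hk a; have /andP[b1 b2] := hk b.
  by have := us k; move: a1 a2 b1 b2; lra.
(* Used with [h] the real and the imaginary part: the left endpoints increase and stay below all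
   right endpoints, so their supremum lies in every interval. *)
have mono (h : C -> R) (hS : forall k, h (u k).1 <= h (u k.+1).1 /\
      h (u k.+1).1 + (u k.+1).2 <= h (u k).1 + (u k).2) :
    exists l, forall k, h (u k).1 <= l <= h (u k).1 + (u k).2.
  have inc : {homo (fun k => h (u k).1) : k l / (k <= l)%N >-> k <= l}.
    by apply/nondecreasing_seqP => k; exact: (hS k).1.
  have dec k l : (k <= l)%N -> h (u l).1 + (u l).2 <= h (u k).1 + (u k).2.
    elim: l => [|l IH]; first by rewrite leqn0 => /eqP->.
    by rewrite leq_eqVlt => /predU1P[->//|/IH]; apply: le_trans; exact: (hS l).2.
  have le k l : h (u k).1 <= h (u l).1 + (u l).2.
    apply: (@le_trans _ _ (h (u (maxn k l)).1)); first by rewrite inc ?leq_maxl.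
    apply: le_trans (dec l (maxn k l) (leq_maxr _ _)).
    by rewrite lerDl ltW.
  exists (sup (range (fun k => h (u k).1))) => k; apply/andP; split.
    apply: ub_le_sup; last by exists k.
    by exists (h (u 0).1 + (u 0).2) => _ [l _ <-]; exact: le.
  by apply: ge_sup; [exists (h (u 0).1), 0%N|move=> _ [l _ <-]; exact: le].
have [x xP] : exists l, forall k, complex.Re (u k).1 <= l <= complex.Re (u k).1 + (u k).2.
  by apply: mono => k; have [? [? [? ?]]] := uS k.
have [y yP] : exists l, forall k, complex.Im (u k).1 <= l <= complex.Im (u k).1 + (u k).2.
  by apply: mono => k; have [? [? [? ?]]] := uS k.
have [|d d0 dP] := Ploc (x +i* y); first by split; [exact: (xP 0%N)|exact: (yP 0%N)].
have [k kd] : exists k, s / 3 ^+ k < d.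
  have : (fun k => s * (3^-1) ^+ k) @ \oo --> (s * 0 : R).
    by apply: cvgM; [exact: cvg_cst|apply: cvg_expr; rewrite ger0_norm; lra].
  rewrite mulr0 => /cvgrPdist_lt/(_ _ d0)[k _ /(_ k (leqnn k))] /=.
  rewrite sub0r normrN ger0_norm ?mulr_ge0 ?exprn_ge0 ?invr_ge0 ?ltW//.
  by rewrite exprVn => ?; exists k.
apply: (uP k).2; apply: dP; last by split; [exact: xP|exact: yP].
by rewrite us (uP k).1.
Qed.

Lemma on_square_dist p z w (s : R) : on_square p z s -> on_square p w s ->
  nrm (w - z) <= 2 * s.
Proof.
case: p z w => [a b] [x y] [x' y'] [/=/andP[? ?] /andP[? ?]] [/=/andP[? ?] /andP[? ?]].
apply: (le_trans (nrm_le_ReIm _)) => /=.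
rewrite (_ : 2 * s = s + s) ?lerD//; last by ring.
all: rewrite ler_norml; apply/andP; split; lra.
Qed.

Lemma diff1_nrm g z : differentiable g z -> exists a, 'd g z 1 = a /\
  forall e : R, 0 < e -> exists2 d : R, 0 < d & forall h, nrm h < d ->
    nrm (g (z + h) - g z - a * h) <= e * nrm h.
Proof.
move=> /differentiable_nrm gz; exists ('d g z 1); split => // e /gz[d d0 dP].
have dE h : 'd g z h = 'd g z 1 * h.
  have hE : h = h *: (1 : C) by rewrite -[RHS]/(h * 1) mulr1.
  by rewrite {1}hE linearZ /= mulrC.
by exists d => // h hd; rewrite -dE; exact: dP.
Qed.

(** The bound is proportional to the area, hence additive over the nine subsquares. A trapezoid sum
    of low level need not be small, whence the threshold [m0]. *)
Lemma goursat g p s : 0 < s ->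
  (forall z, on_square p z s -> differentiable g z) ->
  forall e : R, 0 < e ->
  exists m0, forall m, (m0 <= m)%N -> nrm (Sq m g p s%:C) <= e * s ^+ 2.
Proof.
move=> s0 gD e e0.
apply: (cousin (P := fun q t => exists m0, forall m, (m0 <= m)%N ->
  nrm (Sq m g q t%:C) <= e * t ^+ 2)) => // [q t t0 IH|z zs].
  have {}IH (ab : 'I_3 * 'I_3) : exists m0, forall m, (m0 <= m)%N ->
      nrm (Sq m g (subsquare q t ab.1 ab.2) (t / 3)%:C) <= e * (t / 3) ^+ 2.
    exact: IH.
  have /choice[M MP] := IH.
  (* One level is spent on the subdivision. *)
  exists (\max_ab M ab).+1 => -[//|m]; rewrite ltnS => Mm.
  rewrite Sq_subdivide; have -> : t%:C / 3 = (t / 3)%:C :> C.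
    by rewrite rmorphM fmorphV /= rmorph_nat.
  have H a b : nrm (Sq m g (subsquare q t a b) (t / 3)%:C) <= e * (t / 3) ^+ 2.
    apply: (MP (a, b)); apply: leq_trans Mm; exact: (leq_bigmax (a, b)).
  have nsum (I : finType) (F : I -> C) B : (forall i, nrm (F i) <= B) ->
      nrm (\sum_i F i) <= B *+ #|I|.
    move=> FB; rewrite -sumr_const; elim/big_ind2: _ => [|x b y c xb yc|i _].
    - by rewrite nrm0.
    - by apply: (le_trans (nrmD _ _)); exact: lerD.
    - exact: FB.
  apply: (@le_trans _ _ ((e * (t / 3) ^+ 2) *+ 3 *+ 3)).
    by have := nsum _ _ _ (fun a => nsum _ _ _ (H a)); rewrite !card_ord.
  by rewrite le_eqVlt; apply/orP; left; apply/eqP; field.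
have [a [_ aP]] := diff1_nrm (gD z zs).
(* The error is at most e/8 times the distance 2t, on a boundary of length 4t: this gives e t^2. *)
have e8 : 0 < e / 8 by rewrite divr_gt0.
have [d d0 dP] := aP _ e8; exists (d / 2); first by rewrite divr_gt0.
move=> q t /andP[t0 td] zt; exists 0%N => m _.
pose err w := g w - g z - a * (w - z).
have gE : g = (fun w => ((g z - a * z) + a * w) + err w).
  by apply/funext => w; rewrite /err; ring.
rewrite gE SqD Sq_affine add0r.
have -> : e * t ^+ 2 = 4 * (e / 8 * (2 * t)) * t by field.
apply: Sq_bound => [|w [wt _]]; first exact: ltW.
have wz := on_square_dist zt wt.
have := dP (w - z); rewrite [z + _]addrC subrK => h.
apply: (le_trans (h _)); first by move: wz td; lra.
by rewrite ler_pM2l.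
Qed.

(** A substitute for the value 2 pi i of the integral of 1/z. On each side, of length 2r, the value
    to be averaged has imaginary part 2r^2 / (r^2 + y^2) up to the sign in [Sq], where y is the
    coordinate along the side. It is at least 1 for |y| <= r, so each of the four sides contributes
    at least 1, at every level. *)
Lemma Sq_inv_ge m (r : R) : 0 < r ->
  4 <= nrm (Sq m (fun z => z^-1) (- r%:C - 'i * r%:C) (2 * r)%:C).
Proof.
move=> r0; apply: le_trans (le_trans (ler_norm _) (Im_le_nrm _)).
have ImB (x y : C) : complex.Im (x - y) = complex.Im x - complex.Im y.
  by case: x y => [? ?] [? ?].
have ImD (x y : C) : complex.Im (x + y) = complex.Im x + complex.Im y.
  by case: x y => [? ?] [? ?].
have key (y : R) : - r <= y <= r -> 1 <= 2 * r * r / (r ^+ 2 + y ^+ 2).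
  move=> /andP[y1 y2]; rewrite ler_pdivlMr; last first.
    by rewrite ltr_wpDr ?sqr_ge0// exprn_gt0.
  by rewrite mul1r; nra.
have par (u : R) : 0 <= u <= 1 -> - r <= - r + u * (2 * r) <= r.
  by move=> /andP[? ?]; nra.
have LsN p v : - Ls m (fun z : C => z^-1) p v = Ls m (fun z => -1 * z^-1) p v.
  by rewrite LsZ mulN1r.
rewrite /Sq ImB ImB ImD.
have h1 : 1 <= complex.Im (Ls m (fun z : C => z^-1) (- r%:C - 'i * r%:C) (2 * r)%:C).
  apply: Ls_Im_ge => u u01; have := key _ (par u u01); simpc => /=.
  set y := - r + _ => h; apply: le_trans h _; rewrite le_eqVlt; apply/orP; left.
  apply/eqP; rewrite sqrrN addrC [y ^+ 2 + _]addrC; ring.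
have h2 : 1 <= complex.Im (Ls m (fun z : C => z^-1) (- r%:C - 'i * r%:C + (2 * r)%:C) ('i * (2 * r)%:C)).
  apply: Ls_Im_ge => u u01; have := key _ (par u u01); simpc => /=.
  have -> : - r + 2 * r = r by ring.
  set y := - r + _ => h; apply: le_trans h _; rewrite le_eqVlt; apply/orP; left.
  apply/eqP; ring.
have h3 : 1 <= - complex.Im (Ls m (fun z : C => z^-1) (- r%:C - 'i * r%:C + 'i * (2 * r)%:C) (2 * r)%:C).
  have -> x : - complex.Im x = complex.Im (- x) :> R by case: x.
  rewrite LsN; apply: Ls_Im_ge => u u01; have := key _ (par u u01); simpc => /=.
  have -> : - r + 2 * r = r by ring.
  set y := - r + _ => h; apply: le_trans h _; rewrite le_eqVlt; apply/orP; left.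
  apply/eqP; rewrite [y ^+ 2 + _]addrC; ring.
have h4 : 1 <= - complex.Im (Ls m (fun z : C => z^-1) (- r%:C - 'i * r%:C) ('i * (2 * r)%:C)).
  have -> x : - complex.Im x = complex.Im (- x) :> R by case: x.
  rewrite LsN; apply: Ls_Im_ge => u u01; have := key _ (par u u01); simpc => /=.
  set y := - r + _ => h; apply: le_trans h _; rewrite le_eqVlt; apply/orP; left.
  apply/eqP; rewrite sqrrN; ring.
move: h1 h2 h3 h4; lra.
Qed.
End goursat.

Section cauchy_estimate.
Context {R : realType}.
Local Notation C := R[i].
Implicit Types (f g : C -> C) (p v w z : C).

(** With side [2 * s] the square is centred at 0, and its middle subsquare is the same square with
    [s / 3] in place of [s]. *)
Definition corner (s : R) : C := - s%:C - 'i * s%:C.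

(** The upper bound, that is 3s/2, is a rational majorant of the half-diagonal s sqrt 2. *)
Lemma corner_edge (s : R) z : on_edge (corner s) z (2 * s) -> s <= nrm z <= s * 2 - s / 2.
Proof.
have -> : corner s = (- s) +i* (- s) by rewrite /corner; simpc.
case: z => x y [[/= /andP[x1 x2] /andP[y1 y2]] xy].
have s0 : 0 <= s by lra.
have nz := sqr_nrm (x +i* y); rewrite /= in nz; apply/andP; split.
  have : s ^+ 2 <= nrm (x +i* y) ^+ 2.
    by rewrite nz; case: xy => ->; nra.
  by rewrite ler_pXn2r// nnegrE nrm_ge0.
rewrite -(ler_pXn2r (_ : 0 < 2)%N) ?nnegrE ?nrm_ge0//; last by lra.
by rewrite nz; nra.
Qed.

Lemma center_subsquare (s : R) (a b : 'I_3) : a = 1%N :> nat -> b = 1%N :> nat ->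
  subsquare (corner s) (2 * s) a b = corner (s / 3).
Proof.
move=> a1 b1; rewrite subsquareE a1 b1 /corner; simpc => /=.
by congr Complex; field.
Qed.

Lemma off_center_subsquare (s : R) z (a b : 'I_3) : 0 < s ->
  ~ (a = 1%N :> nat /\ b = 1%N :> nat) ->
  on_square (subsquare (corner s) (2 * s) a b) z (2 * s / 3) ->
  z != 0 /\ nrm z <= s * 2 - s / 2.
Proof.
rewrite subsquareE; have -> : corner s = (- s) +i* (- s) by rewrite /corner; simpc.
case: z => x y s0 nab [/= /andP[x1 x2] /andP[y1 y2]].
have ha : 0 <= 2 * s / 3 *+ a <= 2 * s / 3 *+ 2.
  by case: (a) => -[|[|[|//]]] _ /=; lra.
have hb : 0 <= 2 * s / 3 *+ b <= 2 * s / 3 *+ 2.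
  by case: (b) => -[|[|[|//]]] _ /=; lra.
split.
  apply/eqP => -[xE yE]; rewrite {}xE {}yE in x1 x2 y1 y2.
  apply: nab; move: x1 x2 y1 y2 {ha hb}.
  by case: a b => -[|[|[|//]]] ? [] [|[|[|//]]] ? /=; move=> *;
    first [by split | exfalso; lra].
rewrite -(ler_pXn2r (_ : 0 < 2)%N) ?nnegrE ?nrm_ge0//; last by lra.
by rewrite sqr_nrm /=; nra.
Qed.

(** Goursat's theorem applies to the eight outer subsquares, which avoid the singularity at 0; only
    the middle one survives, one level lower. *)
Lemma annulus_step g (s e : R) : 0 < s -> 0 < e ->
  (forall z, z != 0 -> nrm z <= s * 2 - s / 2 -> differentiable g z) ->
  exists m0, forall m, (m0 <= m)%N ->
    nrm (Sq m.+1 g (corner s) (2 * s)%:C) <=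
      e + nrm (Sq m g (corner (s / 3)) (2 * (s / 3))%:C).
Proof.
move=> s0 e0 gD; pose o : 'I_3 := inord 1.
have o1 : o = 1%N :> nat by rewrite inordK.
have s20 : 0 < 2 * s by rewrite mulr_gt0.
have IH (ab : 'I_3 * 'I_3) : exists m0, forall m, (m0 <= m)%N -> ab != (o, o) ->
    nrm (Sq m g (subsquare (corner s) (2 * s) ab.1 ab.2) (2 * s / 3)%:C) <= e / 9.
  have [->|abo] := eqVneq ab (o, o); first by exists 0%N.
  have s30 : 0 < 2 * s / 3 by rewrite divr_gt0.
  (* Division by the area turns the bound of [goursat] into e/9. *)
  have e30 : 0 < e / 9 / (2 * s / 3) ^+ 2 by rewrite !divr_gt0// exprn_gt0.
  have subD z : on_square (subsquare (corner s) (2 * s) ab.1 ab.2) z (2 * s / 3) ->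
      differentiable g z.
    move=> /off_center_subsquare[//||? ?]; last exact: gD.
    move=> [a1 b1]; move/eqP: abo; apply.
    by rewrite [ab]surjective_pairing; congr pair; apply: val_inj; rewrite /= ?a1 ?b1 o1.
  have [m0 m0P] := goursat s30 subD e30.
  exists m0 => m /m0P; rewrite divfK//.
  by rewrite gt_eqF// exprn_gt0.
have /choice[M MP] := IH.
exists (\max_ab M ab) => m Mm.
rewrite Sq_subdivide pair_bigA /=.
have -> : (2 * s)%:C / 3 = (2 * s / 3)%:C :> C.
  by rewrite [RHS]rmorphM fmorphV /= rmorph_nat.
rewrite (bigD1 (o, o)) //= addrC; apply: (le_trans (nrmD _ _)).
apply: lerD; last first.
  by have := @center_subsquare s o o o1 o1; rewrite /subsquare => ->; rewrite mulrA.
have nsum (P : pred ('I_3 * 'I_3)) (F : 'I_3 * 'I_3 -> C) B : 0 <= B ->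
    (forall i, P i -> nrm (F i) <= B) -> nrm (\sum_(i | P i) F i) <= B *+ 9.
  move=> B0 FB; have -> : (9 = #|{: 'I_3 * 'I_3}|)%N by rewrite card_prod card_ord.
  rewrite -sumr_const [X in _ <= X](bigID P) /=.
  apply: (@le_trans _ _ (\sum_(i | P i) B)); last by rewrite lerDl sumr_ge0.
  elim/big_ind2: _ => [|x b y c xb yc|i Pi].
  - by rewrite nrm0.
  - by apply: (le_trans (nrmD _ _)); exact: lerD.
  - exact: FB.
have -> : e = (e / 9) *+ 9 by field.
apply: nsum => [|ab abo]; first by rewrite divr_ge0// ltW.
by apply: (MP ab) => //; apply: leq_trans Mm; exact: (leq_bigmax ab).
Qed.

Lemma annulus g k : forall (s e : R), 0 < s -> 0 < e ->
  (forall z, z != 0 -> nrm z <= s * 2 - s / 2 -> differentiable g z) ->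
  exists m0, forall m, (m0 <= m)%N ->
    nrm (Sq (m + k) g (corner s) (2 * s)%:C) <=
      e + nrm (Sq m g (corner (s / 3 ^+ k)) (2 * (s / 3 ^+ k))%:C).
Proof.
elim: k => [|k IH] s e s0 e0 gD.
  by exists 0%N => m _; rewrite addn0 expr0 divr1 lerDr ltW.
have s30 : 0 < s / 3 by rewrite divr_gt0.
have e20 : 0 < e / 2 by rewrite divr_gt0.
have [m1 m1P] := annulus_step s0 e20 gD.
have [z z0 zs|m2 m2P] := IH (s / 3) (e / 2) s30 e20.
  by apply: gD => //; lra.
exists (m1 + m2)%N => m mm; rewrite addnS.
have /m1P h1 : (m1 <= m + k)%N.
  by apply: leq_trans (leq_addr _ _); apply: leq_trans mm; exact: leq_addr.
have /m2P h2 : (m2 <= m)%N by apply: leq_trans mm; exact: leq_addl.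
have -> : s / 3 ^+ k.+1 = s / 3 / 3 ^+ k by rewrite exprS invfM mulrA.
apply: (le_trans h1).
by move: h2; lra.
Qed.

(* Apply Goursat's theorem on the annulus to (f(z) - f(0)) / z^2 - f'(0) / z, which
   is o(1/|z|) near 0, and compare with the sums of 1/z. *)
Lemma cauchy_estimate f (r M : R) : 0 < r ->
  (forall z, nrm z < r -> differentiable f z) ->
  (forall z, nrm z < r -> nrm (f z) <= M) ->
  nrm ('d f 0 1) <= 8 * M / r.
Proof.
move=> r0 fD fM; set a := 'd f 0 1.
pose g z := (f z - f 0) * (z^-1 * z^-1); pose h z := g z + (- a) * z^-1.
pose s := r / 2; have s0 : 0 < s by rewrite divr_gt0.
have sr z : nrm z <= s * 2 - s / 2 -> nrm z < r by rewrite /s; lra.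
have hD z : z != 0 -> nrm z <= s * 2 - s / 2 -> differentiable h z.
  move=> z0 /sr zr.
  have iD : differentiable (fun z : C => z^-1) z by exact: differentiable_Rinv.
  have fzD : differentiable (fun z => f z - f 0) z.
    by apply: differentiableB; [exact: fD|exact: differentiable_cst].
  apply: differentiableD.
    by apply: differentiableM => //; exact: differentiableM.
  by apply: (@differentiableZ _ _ _ _ (-a)).
have [|b [ab bP]] := @diff1_nrm R f 0; first by apply: fD; rewrite nrm0.
rewrite -/a in ab; subst b.
(* The factor 4 comes from [Sq_inv_ge]. On the outer square, of perimeter 8s, |g| is at most 2M /
   s^2. The error is e from the annulus plus 8e from the inner square. *)
suff H e : 0 < e -> 4 * nrm a <= 16 * M / s + 9 * e.
  have {}H e : 0 < e -> nrm a <= 8 * M / r + e.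
    move=> e0; have := H (e / 3); rewrite divr_gt0// => /(_ isT).
    have -> : 16 * M / s = 4 * (8 * M / r) by rewrite /s; field; rewrite gt_eqF.
    by lra.
  by apply/ler_addgt0Pr => e /H.
move=> e0; have [d d0 dP] := bP _ e0.
(* The inner square must lie in the disc where f(z) - f(0) - a z is at most e |z|; there |h| is at
   most e / |z|, which the perimeter compensates. *)
have [k kd] : exists k, 2 * (s / 3 ^+ k) < d.
  have : (fun k => (2 * s) * (3^-1) ^+ k) @ \oo --> (2 * s * 0 : R).
    by apply: cvgM; [exact: cvg_cst|apply: cvg_expr; rewrite ger0_norm; lra].
  rewrite mulr0 => /cvgrPdist_lt/(_ _ d0)[k _ /(_ k (leqnn k))] /=.
  have s20 : 0 <= 2 * s by apply: mulr_ge0 => //; exact: ltW.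
  rewrite sub0r normrN ger0_norm; last by apply: mulr_ge0 => //; rewrite exprn_ge0.
  by rewrite exprVn -mulrA => ?; exists k.
have [m0 /(_ m0 (leqnn _))] := @annulus h k s e s0 e0 hD.
set s' := s / 3 ^+ k; have s'0 : 0 < s' by rewrite divr_gt0// exprn_gt0.
have kd' : 2 * s' < d by exact: kd.
have small : nrm (Sq m0 h (corner s') (2 * s')%:C) <= 8 * e.
  have -> : 8 * e = 4 * (e / s') * (2 * s') by field; rewrite gt_eqF.
  apply: Sq_bound => [|z /corner_edge/andP[z1 z2]]; first by rewrite mulr_ge0// ltW.
  have z0 : 0 < nrm z by apply: lt_le_trans z1.
  have z0' : z != 0 by apply: contraTneq z0 => ->; rewrite nrm0 ltxx.
  have hE : h z = (f z - f 0 - a * z) * (z^-1 * z^-1) by rewrite /h /g; field.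
  rewrite hE !nrmM nrmV; have := dP z; rewrite add0r => fz.
  apply: (@le_trans _ _ (e * nrm z * ((nrm z)^-1 * (nrm z)^-1))).
    rewrite ler_wpM2r ?mulr_ge0 ?invr_ge0 ?nrm_ge0//; apply: fz.
    by move: z2 kd'; lra.
  rewrite mulrA mulfK ?gt_eqF// ler_pM2l// lef_pV2//.
have big m : nrm (Sq m g (corner s) (2 * s)%:C) <= 16 * M / s.
  have -> : 16 * M / s = 4 * (2 * M / s ^+ 2) * (2 * s) by field; rewrite gt_eqF.
  apply: Sq_bound => [|z /corner_edge/andP[z1 z2]]; first by rewrite mulr_ge0// ltW.
  have M0 : 0 <= M by apply: le_trans (nrm_ge0 _) (fM 0 _); rewrite nrm0.
  rewrite !nrmM nrmV ler_pM ?mulr_ge0 ?invr_ge0 ?nrm_ge0//.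
    apply: (le_trans (nrmB _ _)); rewrite (_ : 2 * M = M + M); last by ring.
    by apply: lerD; apply: fM; [exact: sr|rewrite nrm0].
  rewrite expr2 invfM ler_pM ?invr_ge0 ?nrm_ge0// lef_pV2// posrE//.
    by apply: lt_le_trans z1.
  by apply: lt_le_trans z1.
rewrite SqD SqZ => hm.
have := @Sq_inv_ge R (m0 + k) s s0; rewrite -/(corner s) => low.
set X := Sq _ g _ _ in hm; set Y := Sq _ (fun z => z^-1) _ _ in hm low.
have : nrm (- a * Y) <= nrm (X + - a * Y) + nrm X.
  by rewrite -{1}(addKr X (- a * Y)) addrC; exact: nrmB.
rewrite nrmM nrmN => aY.
have := big (m0 + k)%N; rewrite -/X.
have : nrm a * 4 <= nrm a * nrm Y by rewrite ler_wpM2l ?nrm_ge0.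
by move: small hm aY; lra.
Qed.

End cauchy_estimate.

Lemma is_derive_real (R : realType) (F : R -> R) (t a : R) :
  (forall e : R, 0 < e -> exists2 d : R, 0 < d & forall h, `|h| < d ->
    `|F (t + h) - F t - a * h| <= e * `|h|) -> is_derive t 1 F a.
Proof.
move=> Fa.
have cv : (fun h => h^-1 *: ((F \o shift t) (h *: 1) - F t)) @ 0^' --> a.
  apply/cvgrPdist_le => e e0; have [d d0 dP] := Fa e e0.
  exists d => // h /=; rewrite sub0r normrN => hd h0.
  rewrite -[h%:A]/(h * 1) mulr1 [h + t]addrC -[_ *: _]/(_ * _).
  have -> : a - h^-1 * (F (t + h) - F t) = - (h^-1 * (F (t + h) - F t - a * h)).
    by field.
  rewrite normrN normrM normfV mulrC ler_pdivrMr ?normr_gt0//; exact: dP.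
by apply: DeriveDef; [apply: cvgP cv|exact: cvg_lim cv].
Qed.

(** * Holomorphic functions of several variables *)

Section several_variables.
Context {R : realType} {V : normedModType R[i]}.
Local Notation C := R[i].
Implicit Types (f g : V -> C) (z w v : V).

Lemma diff_line f z v (t : C) : differentiable f (z + t *: v) ->
  differentiable (fun s : C => f (z + s *: v)) t /\
  'd (fun s : C => f (z + s *: v)) t 1 = 'd f (z + t *: v) v.
Proof.
move=> fD.
have lD : is_diff t (fun s : C => z + s *: v) (fun s => s *: v).
  have -> : (fun s : C => s *: v) = 0 + (fun s => s *: v) by rewrite add0r.
  exact: is_diffD.
have fD' : is_diff (z + t *: v) f ('d f (z + t *: v)) by exact: differentiableP.
have cD := @is_diff_comp _ _ _ _ _ _ _ _ _ lD fD'.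
split; first by case: cD.
by rewrite (diff_val (is_diff_def := cD)) /= scale1r.
Qed.

Lemma cauchy_estimate_dir f z (r M : R) : 0 < r ->
  (forall w, nrm (w - z) < r -> differentiable f w) ->
  (forall w, nrm (w - z) < r -> nrm (f w) <= M) ->
  forall v, nrm ('d f z v) <= 8 * M / r * nrm v.
Proof.
move=> r0 fD fM v; have [->|v0] := eqVneq v 0; first by rewrite linear0 !nrm0 mulr0.
have nv0 := nrm_gt0 v0.
have inb (t : C) : nrm t < r / nrm v -> nrm (z + t *: v - z) < r.
  by rewrite addrAC subrr add0r nrmZ ltr_pdivlMr.
have fz : differentiable f (z + (0 : C) *: v).
  by rewrite scale0r addr0; apply: fD; rewrite subrr nrm0.
have [_ E] := diff_line fz.
have := @cauchy_estimate R (fun s => f (z + s *: v)) (r / nrm v) M.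
rewrite E scale0r addr0 invfM invrK mulrA; apply; first by rewrite divr_gt0.
  by move=> t /inb /fD /diff_line[].
by move=> t /inb; exact: fM.
Qed.

(** The real mean value theorem is applied to the real part of conj(D) phi(t), where D = phi(1) -
    phi(0): its increment is |D|^2 and its derivative is at most |D| B. *)
Lemma mean_value_complex (phi : C -> C) (a : R -> C) (B : R) :
  (forall t : R, 0 <= t <= 1 ->
    forall e : R, 0 < e -> exists2 d : R, 0 < d & forall h, nrm h < d ->
      nrm (phi (t%:C + h) - phi t%:C - a t * h) <= e * nrm h) ->
  (forall t : R, 0 <= t <= 1 -> nrm (a t) <= B) ->
  nrm (phi 1 - phi 0) <= B.
Proof.
move=> fD fB; set D := phi 1 - phi 0.
have [->|D0] := eqVneq D 0.
  by rewrite nrm0; apply: le_trans (fB 0 _); rewrite ?nrm_ge0 ?lexx ?ler01.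
pose c : C := (D^*)%C; pose F (t : R) := complex.Re (c * phi t%:C).
pose dF (t : R) := complex.Re (c * a t).
have FD (t : R) : 0 <= t <= 1 -> is_derive t 1 F (dF t).
  move=> t01; have aP := fD t t01.
  apply: is_derive_real => e e0.
  have c0 : 0 < nrm c + 1 by rewrite ltr_wpDl ?nrm_ge0.
  have [|d d0 dP] := aP (e / (nrm c + 1)); first by rewrite divr_gt0.
  exists d => // h hd.
  have /dP : nrm (h%:C : C) < d by rewrite nrm_real.
  rewrite nrm_real => hP.
  have -> : F (t + h) - F t - dF t * h =
      complex.Re (c * (phi (t%:C + h%:C) - phi t%:C - a t * h%:C)).
    rewrite /F /dF rmorphD /=; move: (phi _) (phi _) (a t) => [a1 a2] [b1 b2] [d1 d2].
    by case: (c) => c1 c2; simpc => /=; ring.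
  apply: (le_trans (Re_le_nrm _)); rewrite nrmM.
  apply: (@le_trans _ _ (nrm c * (e / (nrm c + 1) * `|h|))).
    by rewrite ler_wpM2l ?nrm_ge0.
  rewrite mulrA ler_wpM2r ?normr_ge0// mulrCA ger_pMr// ler_pdivrMr// mul1r.
  by rewrite lerDl.
have FD' (t : R) : t \in `]0, 1[%R -> is_derive t 1 F (dF t).
  by rewrite in_itv /= => /andP[? ?]; apply: FD; rewrite !ltW.
have Fc : {within `[0, 1], continuous F}.
  apply: derivable_within_continuous => t; rewrite in_itv /= => t01.
  by have [] := FD t t01.
have [t t01] := MVT ltr01 FD' Fc.
have {}t01 : 0 <= t <= 1 by move: t01; rewrite in_itv /= => /andP[? ?]; rewrite !ltW.
rewrite subr0 mulr1 => E.
have FE : F 1 - F 0 = nrm D ^+ 2.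
  rewrite /F sqr_nrm.
  have -> : complex.Re (c * phi 1) - complex.Re (c * phi 0) = complex.Re (c * D).
    rewrite /D; move: (phi 1) (phi 0) => [a1 a2] [b1 b2].
    by case: (c) => c1 c2; simpc => /=; ring.
  by rewrite /c; case: (D) => x y; simpc => /=; ring.
have nD := nrm_gt0 D0.
rewrite -(ler_pM2l nD) -expr2 -FE E.
apply: (le_trans (ler_norm _)); apply: (le_trans (Re_le_nrm _)); rewrite nrmM.
have -> : nrm c = nrm D.
  apply/eqP; rewrite -(eqrXn2 (_ : 0 < 2)%N) ?nrm_ge0//; apply/eqP.
  by rewrite !sqr_nrm /c; case: (D) => x y /=; rewrite sqrrN.
by rewrite ler_wpM2l ?nrm_ge0// fB.
Qed.

Lemma mean_value_ineq f z v (B : R) :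
  (forall t : R, 0 <= t <= 1 -> differentiable f (z + t%:C *: v)) ->
  (forall t : R, 0 <= t <= 1 -> nrm ('d f (z + t%:C *: v) v) <= B) ->
  nrm (f (z + v) - f z) <= B.
Proof.
move=> fD fB.
have := @mean_value_complex (fun s => f (z + s *: v))
  (fun t => 'd f (z + t%:C *: v) v) B _ fB.
rewrite scale1r scale0r addr0; apply => t t01.
by have [lD <-] := diff_line (fD t t01); have [_ [<-]] := diff1_nrm lD.
Qed.

Lemma segment_in_ball z v (r t : R) : 0 <= t <= 1 -> nrm v < r ->
  nrm (z + t%:C *: v - z) < r.
Proof.
move=> /andP[t0 t1] vr; rewrite addrAC subrr add0r nrmZ nrm_real ger0_norm//.
by apply: le_lt_trans vr; rewrite ler_piMl ?nrm_ge0.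
Qed.

Section ball_estimates.
Variables (f : V -> C) (z : V) (r M : R).
Hypothesis r0 : 0 < r.
Hypothesis fD : forall w, nrm (w - z) < r -> differentiable f w.
Hypothesis fM : forall w, nrm (w - z) < r -> nrm (f w) <= M.

Lemma bound_ge0 : 0 <= M.
Proof. by apply: le_trans (fM (w := z) _); rewrite ?nrm_ge0// subrr nrm0. Qed.

Lemma cauchy_estimate_half w v : nrm (w - z) <= r / 2 ->
  nrm ('d f w v) <= 16 * M / r * nrm v.
Proof.
move=> wz; have r20 : 0 < r / 2 by rewrite divr_gt0.
have sub x : nrm (x - w) < r / 2 -> nrm (x - z) < r.
  move=> xw; apply: (le_lt_trans (nrm_triangle _ w _)).
  by move: xw wz; lra.
have := @cauchy_estimate_dir f w (r / 2) M r20 (fun x h => fD (sub x h))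
  (fun x h => fM (sub x h)) v.
by have -> : 8 * M / (r / 2) = 16 * M / r by field; rewrite gt_eqF.
Qed.

Lemma lipschitz_half w : nrm (w - z) <= r / 2 ->
  nrm (f w - f z) <= 16 * M / r * nrm (w - z).
Proof.
move=> wz; have wE : w = z + (w - z) by rewrite addrC subrK.
have r2r : r / 2 < r by move: r0; lra.
rewrite {1}wE; apply: mean_value_ineq => t t01.
  by apply: fD; apply: segment_in_ball => //; apply: le_lt_trans wz _.
apply: cauchy_estimate_half; move: t01 => /andP[t0 t1].
rewrite addrAC subrr add0r nrmZ nrm_real ger0_norm//.
by apply: le_trans wz; rewrite ler_piMl ?nrm_ge0.
Qed.

End ball_estimates.

Lemma nrm_le_lim (T : Type) (F : set_system T) (FF : ProperFilter F)
    (h : T -> C) (a : C) (B : R) :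
  (forall e : R, 0 < e -> F [set x | nrm (h x - a) < e]) ->
  (\forall x \near F, nrm (h x) <= B) -> nrm a <= B.
Proof.
move=> ha hB; apply/ler_addgt0Pr => e e0.
have [x [/= xa xB]] := filter_ex (filterI (ha e e0) hB).
rewrite -[a](subrK (h x)); apply: (le_trans (nrmD _ _)).
by rewrite nrmC; move: xa xB; lra.
Qed.

(** The Lipschitz estimate is applied to the difference quotients of f in the direction v: on the
    ball of radius r/2 they are holomorphic and bounded uniformly in small t, and t then tends to 0.
    Bounding the quotients is itself a Lipschitz estimate; both use radius r/2, so 2 * 16 = 32
    occurs twice. *)
Lemma diff_lipschitz f z (r M : R) : 0 < r ->
  (forall w, nrm (w - z) < r -> differentiable f w) ->
  (forall w, nrm (w - z) < r -> nrm (f w) <= M) ->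
  forall w v, nrm (w - z) <= r / 4 ->
  nrm ('d f w v - 'd f z v) <= 32 ^+ 2 * M / r ^+ 2 * nrm v * nrm (w - z).
Proof.
move=> r0 fD fM w v wz.
have M0 := bound_ge0 r0 fM.
have r20 : 0 < r / 2 by rewrite divr_gt0.
have [->|v0] := eqVneq v 0; first by rewrite (linear0 ('d f w)) (linear0 ('d f z)) subrr !nrm0 mulr0 mul0r.
have nv0 := nrm_gt0 v0.
pose D (t : R) (x : V) := (t%:C)^-1 * (f (x + t%:C *: v) - f x).
have DD (t : R) : 0 < t -> t * nrm v <= r / 4 ->
    nrm (D t w - D t z) <= 32 ^+ 2 * M / r ^+ 2 * nrm v * nrm (w - z).
  move=> t0 tv.
  have ntv : nrm (t%:C *: v) = t * nrm v by rewrite nrmZ nrm_real gtr0_norm.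
  have sub x y : nrm (x - z) < r / 2 -> nrm (y - x) < r / 2 -> nrm (y - z) < r.
    move=> xz yx; apply: (le_lt_trans (nrm_triangle _ x _)).
    by move: xz yx; lra.
  have shE x : x + t%:C *: v - x = t%:C *: v by rewrite addrAC subrr add0r.
  have shP x : nrm (x - z) < r / 2 -> nrm (x + t%:C *: v - z) < r.
    by move=> xz; apply: (sub x) => //; rewrite shE ntv; move: tv r0; lra.
  have shD x : nrm (x - z) < r / 2 -> differentiable (fun x => f (x + t%:C *: v)) x.
    by move=> /shP /fD fxD; apply: (@differentiable_comp _ _ _ _ (fun x => x + t%:C *: v)) => //.
  have Dd x : nrm (x - z) < r / 2 -> differentiable (D t) x.
    move=> xz; apply: (@differentiableZ _ _ _ (fun x => f (x + t%:C *: v) - f x)).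
    apply: differentiableB; first exact: shD.
    by apply: fD; move: xz r0; lra.
  have DB x : nrm (x - z) < r / 2 -> nrm (D t x) <= 32 * M / r * nrm v.
    move=> xz; rewrite nrmM nrmV nrm_real gtr0_norm// mulrC ler_pdivrMr//.
    have := @lipschitz_half f x (r / 2) M r20 _ _ (x + t%:C *: v).
    rewrite shE ntv; have -> : 32 * M / r * nrm v * t = 16 * M / (r / 2) * (t * nrm v).
      by field; rewrite gt_eqF.
    apply.
    - by move=> y yx; apply: fD; exact: (sub x).
    - by move=> y yx; apply: fM; exact: (sub x).
    - by move: tv; lra.
  have := @lipschitz_half (D t) z (r / 2) (32 * M / r * nrm v) r20 Dd DB w.
  have -> : 32 ^+ 2 * M / r ^+ 2 * nrm v * nrm (w - z) =
    16 * (32 * M / r * nrm v) / (r / 2) * nrm (w - z) by field; rewrite gt_eqF.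
  by apply; move: wz; lra.
have Dlim x (e : R) : nrm (x - z) < r -> 0 < e ->
    \forall t \near (0 : R)^'+, nrm (D t x - 'd f x v) < e.
  move=> xz e0; have e20 : 0 < e / 2 / nrm v by rewrite !divr_gt0.
  have [d d0 dP] := differentiable_nrm (fD x xz) e20.
  exists (d / nrm v) => /=; first by rewrite divr_gt0.
  move=> t /=; rewrite sub0r normrN => td t0; rewrite gtr0_norm// in td.
  have tC : t%:C != 0 :> C by rewrite (inj_eq (@complexI R)) gt_eqF.
  have ntv : nrm (t%:C *: v) = t * nrm v by rewrite nrmZ nrm_real gtr0_norm.
  have := dP (t%:C *: v); rewrite ntv -ltr_pdivlMr// => /(_ td).
  have -> : D t x - 'd f x v =
      (t%:C)^-1 * (f (x + t%:C *: v) - f x - 'd f x (t%:C *: v)).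
    by rewrite linearZ mulrBr; congr (_ - _); rewrite [RHS]mulKf.
  rewrite nrmM nrmV nrm_real gtr0_norm// => h.
  rewrite mulrC ltr_pdivrMr//; apply: (le_lt_trans h).
  rewrite mulrA mulrAC divfK ?gt_eqF// ltr_pM2r//; move: e0; lra.
have zz : nrm (z - z) < r by rewrite subrr nrm0.
have wr : nrm (w - z) < r by move: wz r0; lra.
apply: (@nrm_le_lim R (0 : R)^'+ _ (fun t => D t w - D t z)).
  move=> e e0; have e20 : 0 < e / 2 by rewrite divr_gt0.
  near=> t; rewrite /= (_ : _ - _ - _ = (D t w - 'd f w v) - (D t z - 'd f z v)).
    have h1 : nrm (D t w - 'd f w v) < e / 2 by near: t; exact: Dlim.
    have h2 : nrm (D t z - 'd f z v) < e / 2 by near: t; exact: Dlim.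
    by apply: (le_lt_trans (nrmB _ _)); move: h1 h2; lra.
  by rewrite !opprB addrACA [RHS]addrACA; congr (_ + _); rewrite addrC.
near=> t; apply: DD; first by near: t; exact: nbhs_right_gt.
rewrite -ler_pdivlMr//; near: t; apply: nbhs_right_le; by rewrite !divr_gt0.
Unshelve. all: by end_near. Qed.

(** The constant depends on f only through M, so the estimate passes to pointwise limits; this is
    how [holomorphic_limit] obtains differentiability. *)
Lemma taylor_estimate f z (r M : R) : 0 < r ->
  (forall w, nrm (w - z) < r -> differentiable f w) ->
  (forall w, nrm (w - z) < r -> nrm (f w) <= M) ->
  forall v, nrm v <= r / 4 ->
  nrm (f (z + v) - f z - 'd f z v) <= 32 ^+ 2 * M / r ^+ 2 * nrm v ^+ 2.
Proof.
move=> r0 fD fM v vr; have M0 := bound_ge0 r0 fM.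
have sb (t : R) : 0 <= t <= 1 -> nrm (z + t%:C *: v - z) < r.
  by move=> t01; apply: segment_in_ball => //; move: vr r0; lra.
pose phi (s : C) := f (z + s *: v) - s * 'd f z v.
have -> : f (z + v) - f z - 'd f z v = phi 1 - phi 0.
  by rewrite /phi scale1r scale0r addr0 mul1r mul0r subr0 addrAC.
apply: (@mean_value_complex phi (fun t => 'd f (z + t%:C *: v) v - 'd f z v)).
  move=> t t01 e e0; have [lD lE] := diff_line (fD _ (sb t t01)).
  have [_ [<- aP]] := diff1_nrm lD; rewrite lE in aP.
  have [d d0 dP] := aP e e0; exists d => // h /dP.
  have alg (p q x y u k : C) : p - (u + k) * y - (q - u * y) - (x - y) * k = p - q - x * k.
    by ring.
  by rewrite /phi alg.
move=> t t01.
have tv : nrm (z + t%:C *: v - z) <= nrm v.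
  move: t01 => /andP[t0 t1].
  by rewrite addrAC subrr add0r nrmZ nrm_real ger0_norm// ler_piMl ?nrm_ge0.
apply: (le_trans (diff_lipschitz r0 fD fM v (le_trans tv vr))).
have K0 : 0 <= 32 ^+ 2 * M / r ^+ 2.
  by apply: divr_ge0; [exact: mulr_ge0 (sqr_ge0 _) M0|exact: exprn_ge0 (ltW r0)].
by rewrite expr2 mulrA; apply: ler_wpM2l tv; exact: mulr_ge0 K0 (nrm_ge0 v).
Qed.

End several_variables.

(** * Ultrafilter limits of holomorphic functions *)

Section limits.
Context {R : realType}.
Local Notation C := R[i].

Lemma cvg_nrmP {V : normedModType C} {T} (F : set_system T) {FF : Filter F}
    (x : T -> V) (a : V) :
  x @ F --> a <-> forall e : R, 0 < e -> \forall t \near F, nrm (x t - a) < e.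
Proof.
split=> [xa e e0|xa A /nbhs_nrmP[e e0 eA]].
  have : nbhs a [set y | nrm (y - a) < e] by apply/nbhs_nrmP; exists e.
  by move=> /xa.
by apply: filterS (xa e e0) => t; exact: eA.
Qed.

Lemma fmap_ultra {T U} (x : T -> U) (F : set_system T) :
  UltraFilter F -> UltraFilter (x @ F).
Proof.
move=> FU; split; first exact: fmap_proper_filter.
move=> G PG FG; apply/seteqP; split => // A GA.
have [//|FnA] := in_ultra_setVsetC (x @^-1` A) FU.
have GnA : G (~` A) by apply: FG.
by have [u []] := filter_ex (filterI GA GnA).
Qed.

(** Plays the role of extracting a convergent subsequence, without changing the index set. *)
Lemma compact_ultra_cvg {T} {U : topologicalType} (x : T -> U) (F : set_system T)
    (A : set U) : UltraFilter F -> compact A -> (\forall t \near F, A (x t)) ->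
  exists2 a, A a & x @ F --> a.
Proof.
move=> FU; rewrite compact_ultra => cA xA.
by have [a [Aa xa]] := cA _ (fmap_ultra x FU) xA; exists a.
Qed.

(** Squares rather than discs, because they are continuous images of products of real segments,
    hence compact. *)
Definition csquare (B : R) : set C :=
  [set z | `|complex.Re z| <= B /\ `|complex.Im z| <= B].

Lemma compact_csquare (B : R) : compact (csquare B).
Proof.
have cf : continuous (fun p : R * R => p.1 +i* p.2 : C).
  move=> [x y]; apply/cvg_nrmP => e e0; have e20 : 0 < e / 2 by rewrite divr_gt0.
  exists (ball x (e / 2), ball y (e / 2)) => /=.
    by split; exact: nbhsx_ballx.
  move=> [x' y'] [/= bx by_].
  apply: (le_lt_trans (nrm_le_ReIm _)) => /=.
  rewrite distrC (distrC y'); rewrite /ball /= in bx by_.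
  by move: bx by_; lra.
have -> : csquare B = (fun p : R * R => p.1 +i* p.2) @` (`[-B, B] `*` `[-B, B]).
  apply/seteqP; split => [[x y] /= [xB yB]|_ [[x y] /= [xB yB] <-]].
    by exists (x, y) => //=; rewrite !in_itv /= -!ler_norml.
  by move: xB yB; rewrite !in_itv /= -!ler_norml.
apply: continuous_compact; first exact: continuous_subspaceT.
by apply: compact_setX; exact: segment_compact.
Qed.

Lemma csquare_nrm (B : R) z : nrm z <= B -> csquare B z.
Proof.
by move=> zB; split; apply: le_trans zB; [exact: Re_le_nrm|exact: Im_le_nrm].
Qed.

Lemma nrm_row_lt n (v : 'rV[C]_n) (e : R) : 0 < e ->
  (nrm v < e <-> forall j, nrm (v 0 j) < e).
Proof.
move=> e0; have H : ball (0 : 'rV[C]_n) (e%:C : C) v <-> nrm v < e.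
  by rewrite -[X in nrm X](subr0 v); exact: ball_nrmP.
rewrite -H; split => [[_ vb] j|vb].
  by have := vb 0 j; rewrite mxE => /ball_nrmP; rewrite subr0.
split; first by rewrite ltcR.
by move=> i j; rewrite mxE ord1; apply/ball_nrmP; rewrite subr0.
Qed.

Lemma nrm_row_le n (v : 'rV[C]_n) (B : R) : 0 <= B ->
  (nrm v <= B <-> forall j, nrm (v 0 j) <= B).
Proof.
move=> B0; split => [vB j|vB].
  apply/ler_addgt0Pr => e e0; apply: ltW.
  have Be : 0 < B + e by rewrite ltr_wpDl.
  by have [+ _] := nrm_row_lt v Be; apply; apply: le_lt_trans vB _; rewrite ltrDl.
apply/ler_addgt0Pr => e e0; apply: ltW.
have Be : 0 < B + e by rewrite ltr_wpDl.
apply/(nrm_row_lt v Be) => j; apply: le_lt_trans (vB j) _; by rewrite ltrDl.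
Qed.

Lemma nrm_coord n (v : 'rV[C]_n) j : nrm (v 0 j) <= nrm v.
Proof. by have [+ _] := nrm_row_le v (nrm_ge0 v); exact. Qed.

Definition csquares n (B : R) : set 'rV[C]_n := [set v | forall j, csquare B (v 0 j)].

Lemma compact_csquares n (B : R) : compact (@csquares n B).
Proof. exact: (@rV_compact C n (fun=> csquare B) (fun=> @compact_csquare B)). Qed.

Lemma csquares_nrm n (B : R) (v : 'rV[C]_n) : nrm v <= B -> csquares B v.
Proof.
by move=> vB j; apply: csquare_nrm; apply: le_trans (nrm_coord _ _) vB.
Qed.

Lemma closed_nrm_le {V : normedModType C} (z : V) (B : R) : closed [set w | nrm (w - z) <= B].
Proof.
rewrite closedE => w /= nw; apply/ler_addgt0Pr => e e0; apply: contrapT => h.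
apply: nw; apply/nbhs_nrmP; exists e => // w' ww' w'z; apply: h.
by apply: (le_trans (nrm_triangle _ w' _)); rewrite nrmC; move: ww' w'z; lra.
Qed.

Lemma nrm_lim_le {V : normedModType C} (T : Type) (F : set_system T) (FF : ProperFilter F)
    (h : T -> V) (a z : V) (B : R) :
  h @ F --> a -> (\forall x \near F, nrm (h x - z) <= B) -> nrm (a - z) <= B.
Proof.
move=> /cvg_nrmP ha hB; apply/ler_addgt0Pr => e e0.
have [x [/= xa xB]] := filter_ex (filterI (ha e e0) hB).
apply: (le_trans (nrm_triangle _ (h x) _)).
by rewrite (nrmC a); move: xa xB; lra.
Qed.

Lemma compact_nrm_le n (z : 'rV[C]_n) (B : R) : compact [set w | nrm (w - z) <= B].
Proof.
apply: (subclosed_compact _ (@compact_csquares n (nrm z + B))).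
  exact: closed_nrm_le.
move=> w wB; apply: csquares_nrm; rewrite -[w](subrK z).
by apply: (le_trans (nrmD _ _)); rewrite addrC lerD2l.
Qed.

Section holomorphic_limits.
Context {V : normedModType C}.
Implicit Types (z w v : V).

(** Weierstrass' theorem from pointwise convergence. By the Cauchy estimates the derivatives at z
    stay in compact sets, so they converge along the ultrafilter to a bounded linear map. The Taylor
    estimate, uniform in t, survives in the limit and makes this map the differential. *)
Lemma holomorphic_limit (T : Type) (F : set_system T) (FU : UltraFilter F)
    (h : T -> V -> C) (phi : V -> C) z (r M : R) : 0 < r ->
  (\forall t \near F, forall w, nrm (w - z) < r ->
     differentiable (h t) w /\ nrm (h t w) <= M) ->
  (forall w, nrm (w - z) < r -> h ^~ w @ F --> phi w) ->
  differentiable phi z /\ (forall v, (fun t => 'd (h t) z v : C) @ F --> ('d phi z v : C)).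
Proof.
move=> r0 hP hphi.
have zz : nrm (z - z) < r by rewrite subrr nrm0.
have dB : \forall t \near F, forall v, nrm ('d (h t) z v) <= 8 * M / r * nrm v.
  apply: filterS hP => t tP v; apply: cauchy_estimate_dir => // w /tP[]//.
have exL : forall v, exists l : C, (fun t => 'd (h t) z v : C) @ F --> l.
  move=> v.
  have [|l _ lP] := @compact_ultra_cvg _ _ (fun t => 'd (h t) z v : C) F _ FU
      (@compact_csquare (8 * M / r * nrm v)).
    by apply: filterS dB => t /(_ v); exact: csquare_nrm.
  by exists l.
have [L LP] := choice exL.
have linL : linear L.
  move=> a v w; apply: (cvg_unique _ (LP _)); first exact: norm_hausdorff.
  have -> : (fun t => 'd (h t) z (a *: v + w)) =
      (fun t => a * 'd (h t) z v + 'd (h t) z w).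
    by apply/funext => t; rewrite linearP.
  by apply: cvgD => //; apply: cvgM => //; exact: cvg_cst.
pose Ll : {linear V -> C} := HB.pack L (GRing.isLinear.Build _ _ _ _ L linL).
have LB v : nrm (L v) <= 8 * M / r * nrm v.
  rewrite -[L v]subr0; apply: (nrm_lim_le _ (LP v)).
  by apply: filterS dB => t /(_ v); rewrite subr0.
have M0 : 0 <= M.
  have [t tP] := filter_ex hP.
  by apply: le_trans (tP z zz).2; rewrite nrm_ge0.
have Lc : continuous Ll.
  move=> v; apply/cvg_nrmP => e e0.
  have K0 : 0 < 8 * M / r + 1.
    apply: ltr_wpDl => //; apply: divr_ge0 (ltW r0).
    exact: mulr_ge0 (ler0n _ _) M0.
  apply/nbhs_nrmP; exists (e / (8 * M / r + 1)); first by rewrite divr_gt0.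
  move=> w; rewrite ltr_pdivlMr// => wv.
  have -> : Ll w - Ll v = L (w - v) by rewrite -[L _]/(Ll _) linearB.
  apply: (le_lt_trans (LB _)); apply: le_lt_trans wv.
  by rewrite [leRHS]mulrC ler_wpM2r ?nrm_ge0// lerDl.
have tay v : nrm v <= r / 4 ->
    nrm (phi (z + v) - phi z - L v) <= 32 ^+ 2 * M / r ^+ 2 * nrm v ^+ 2.
  move=> vr; have vr' : nrm (z + v - z) < r.
    by rewrite addrAC subrr add0r; move: vr r0; lra.
  have cv : (fun t => h t (z + v) - h t z - 'd (h t) z v) @ F -->
      phi (z + v) - phi z - L v.
    by apply: cvgB => //; apply: cvgB; exact: hphi.
  rewrite -[_ - L v]subr0; apply: (nrm_lim_le _ cv).
  apply: filterS hP => t tP; rewrite subr0.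
  exact: (taylor_estimate r0 (fun w wz => (tP w wz).1) (fun w wz => (tP w wz).2) vr).
have [//|e e0|dphi dE] := @nrm_differentiable R V _ phi z Ll.
  pose K := 32 ^+ 2 * M / r ^+ 2 + 1.
  have K1 : 32 ^+ 2 * M / r ^+ 2 <= K by rewrite /K; move: (32 ^+ 2 * M / _) => k; rewrite lerDl.
  have K0 : 0 < K.
    apply: ltr_wpDl => //; apply: divr_ge0; last exact: exprn_ge0 (ltW r0).
    exact: mulr_ge0 (sqr_ge0 _) M0.
  exists (Num.min (r / 4) (e / K)); first by rewrite lt_min !divr_gt0.
  move=> v; rewrite lt_min => /andP[v1]; rewrite ltr_pdivlMr// => v2.
  apply: (le_trans (tay v (ltW v1))); rewrite expr2 mulrA ler_wpM2r ?nrm_ge0//.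
  apply: ltW; apply: le_lt_trans v2; rewrite [leRHS]mulrC -/K.
  by rewrite ler_wpM2r ?nrm_ge0.
split; first exact: dphi.
move=> v; have E : L v = ('d phi z v : C) := esym (congr1 (fun k : V -> C => k v) dE).
exact: (eq_rect (L v) (fun l : C => (fun t => 'd (h t) z v : C) @ F --> l) (LP v) _ E).
Qed.

(** The difference quotients in the direction v are holomorphic, bounded near z uniformly in small t
    > 0, and converge to the derivative. [holomorphic_limit] applies along an ultrafilter finer than
    the right neighbourhoods of 0. *)
Lemma derivative_holomorphic (W : set V) (f : V -> C) v : open W ->
  (forall z, W z -> differentiable f z) ->
  forall z, W z -> differentiable (fun w => 'd f w v) z.
Proof.
move=> oW fW z Wz.
have : nbhs z (W `&` [set w | nrm (f w - f z) < 1]).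
  apply: filterI; first exact: open_nbhs_nbhs.
  have /cvg_nrmP := differentiable_continuous (fW z Wz); exact.
move=> /nbhs_nrmP[r r0 rP]; pose M := nrm (f z) + 1.
have fD w : nrm (w - z) < r -> differentiable f w by move=> /rP[/fW].
have fM w : nrm (w - z) < r -> nrm (f w) <= M.
  move=> /rP[_ /= fwz]; rewrite -[f w](subrK (f z)).
  by apply: (le_trans (nrmD _ _)); rewrite addrC lerD2l ltW.
have M0 : 0 <= M by rewrite addr_ge0 ?nrm_ge0.
have r20 : 0 < r / 2 by rewrite divr_gt0.
have PF : ProperFilter (0 : R)^'+ by exact: at_right_proper_filter.
have [G [GU FG]] := @ultraFilterLemma _ (0 : R)^'+ PF.
pose D (t : R) (x : V) := (t%:C)^-1 * (f (x + t%:C *: v) - f x).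
have [||//] := @holomorphic_limit _ G GU D (fun w => 'd f w v) z (r / 2)
    (32 * M / r * nrm v) r20.
  apply: FG; near=> t; move=> w wz.
  have t0 : 0 < t by near: t; exact: nbhs_right_gt.
  (* The 1 added to |v| covers the case v = 0. *)
  have tv : t * (nrm v + 1) <= r / 4.
    rewrite -ler_pdivlMr ?ltr_wpDl ?nrm_ge0//; near: t; apply: nbhs_right_le.
    by rewrite !divr_gt0// ltr_wpDl ?nrm_ge0.
  have ntv : nrm (t%:C *: v) = t * nrm v by rewrite nrmZ nrm_real gtr0_norm.
  have tv' : t * nrm v <= r / 4 by move: tv; nra.
  have shE : w + t%:C *: v - w = t%:C *: v by rewrite addrAC subrr add0r.
  have sub y : nrm (y - w) < r / 2 -> nrm (y - z) < r.
    by move=> yw; apply: (le_lt_trans (nrm_triangle _ w _)); move: wz yw; lra.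
  have wvr : nrm (w + t%:C *: v - z) < r.
    by apply: sub; rewrite shE ntv; have := r0; move: tv'; lra.
  split.
    apply: (@differentiableZ _ _ _ (fun x => f (x + t%:C *: v) - f x)).
    apply: differentiableB; last by apply: fD; have := r0; move: wz; lra.
    apply: (@differentiable_comp _ _ _ _ (fun x => x + t%:C *: v)) => //.
    exact: fD.
  rewrite nrmM nrmV nrm_real gtr0_norm// mulrC ler_pdivrMr//.
  have := @lipschitz_half R V f w (r / 2) M r20 _ _ (w + t%:C *: v).
  rewrite shE ntv; have -> : 32 * M / r * nrm v * t = 16 * M / (r / 2) * (t * nrm v).
    by field; rewrite gt_eqF.
  apply.
  - by move=> y yx; apply: fD; exact: sub.
  - by move=> y yx; apply: fM; exact: sub.
  - by move: tv'; lra.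
move=> w wz; apply/cvg_nrmP => e e0; apply: FG.
have wr : nrm (w - z) < r by move: wz r0; lra.
have e20 : 0 < e / 2 / (nrm v + 1) by rewrite !divr_gt0// ltr_wpDl ?nrm_ge0.
have [d d0 dP] := differentiable_nrm (fD w wr) e20.
have nv1 : 0 < nrm v + 1 by rewrite ltr_wpDl ?nrm_ge0.
near=> t.
have t0 : 0 < t by near: t; exact: nbhs_right_gt.
have td : t * (nrm v + 1) < d.
  by rewrite -ltr_pdivlMr//; near: t; apply: nbhs_right_lt; rewrite divr_gt0.
have ntv : nrm (t%:C *: v) = t * nrm v by rewrite nrmZ nrm_real gtr0_norm.
have := dP (t%:C *: v); rewrite ntv => /(_ _) h.
have {}h : nrm (f (w + t%:C *: v) - f w - 'd f w (t%:C *: v)) <=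
   e / 2 / (nrm v + 1) * (t * nrm v) by apply: h; move: td t0; nra.
have tC : t%:C != 0 :> C by rewrite (inj_eq (@complexI R)) gt_eqF.
have -> : D t w - 'd f w v =
    (t%:C)^-1 * (f (w + t%:C *: v) - f w - 'd f w (t%:C *: v)).
  by rewrite linearZ mulrBr; congr (_ - _); rewrite [RHS]mulKf.
rewrite nrmM nrmV nrm_real gtr0_norm// mulrC ltr_pdivrMr//; apply: (le_lt_trans h).
have -> : e / 2 / (nrm v + 1) * (t * nrm v) = e / 2 * t * (nrm v / (nrm v + 1)).
  by field; rewrite gt_eqF.
have vv : nrm v / (nrm v + 1) <= 1 by rewrite ler_pdivrMr// mul1r lerDl.
have et : 0 < e / 2 * t by rewrite mulr_gt0// divr_gt0.
apply: (@le_lt_trans _ _ (e / 2 * t * 1)); first by rewrite ler_pM2l.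
by rewrite mulr1 ltr_pM2r//; move: e0; lra.
Unshelve. all: by end_near. Qed.

End holomorphic_limits.
End limits.

(** * Jacobian determinants of holomorphic maps *)

Section jacobian_det.
Context {R : realType} {n : nat}.
Local Notation C := R[i].
Local Notation Cn := 'rV[C]_n.
Implicit Types (f : Cn -> Cn) (z w v : Cn).

Lemma differentiable_coordinate f z j : differentiable f z ->
  differentiable (fun w => f w 0 j) z /\
  forall v, 'd (fun w => f w 0 j) z v = ('d f z v) 0 j.
Proof.
move=> fz.
pose L v : C := ('d f z v) 0 j.
have linL : linear L.
  by move=> a v w; rewrite /L linearP !mxE.
pose Ll : {linear Cn -> C} := HB.pack L (GRing.isLinear.Build _ _ _ _ L linL).
have dc := diff_continuous fz.
have Lc : continuous Ll.
  move=> v; apply/(@cvg_nrmP R _ _ (nbhs v) (nbhs_filter v) Ll (Ll v)) => e e0.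
  have [h' _] := @cvg_nrmP R _ _ (nbhs v) (nbhs_filter v) ('d f z) ('d f z v).
  have h := h' (dc v) e e0.
  apply: (@filterS _ (nbhs v) (nbhs_filter v) _ _ _ h) => w; apply: le_lt_trans.
  by have := @nrm_coord R n ('d f z w - 'd f z v) j; rewrite !mxE.
have [//|e e0|dphi dE] := @nrm_differentiable R Cn _ (fun w => f w 0 j) z Ll.
  have [d d0 dP] := differentiable_nrm fz e0; exists d => // h /dP.
  apply: le_trans; have := @nrm_coord R n (f (z + h) - f z - 'd f z h) j.
  by rewrite !mxE.
split => // v; exact: (congr1 (fun k : Cn -> C => k v) dE).
Qed.

Lemma differentiable_row f z :
  (forall j, differentiable (fun w => f w 0 j) z) -> differentiable f z.
Proof.
move=> fj; have -> : f = \sum_(j < n) (fun w => f w 0 j *: delta_mx 0 j).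
  apply/funext => w; rewrite fct_sumE; apply/rowP => j.
  rewrite summxE (bigD1 j)//= !mxE !eqxx mulr1 big1 ?addr0// => i ij.
  by rewrite !mxE eq_sym (negbTE ij) andbF mulr0.
apply: differentiable_sum => j; exact: differentiableZl.
Qed.

Lemma differentiable_bigsum (I : Type) (r : seq I) (P : pred I) (F : I -> Cn -> C) z :
  (forall i, P i -> differentiable (F i) z) ->
  differentiable (fun w => \sum_(i <- r | P i) F i w) z.
Proof.
move=> FD; elim: r => [|i r IH].
  rewrite (_ : (fun _ => _) = cst 0); first exact: differentiable_cst.
  by apply/funext => w; rewrite big_nil.
have [Pi|Pi] := boolP (P i).
  rewrite (_ : (fun _ => _) = F i \+ (fun w => \sum_(i <- r | P i) F i w)).
    by apply: differentiableD => //; exact: FD.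
  by apply/funext => w; rewrite big_cons Pi.
rewrite (_ : (fun _ => _) = (fun w => \sum_(i <- r | P i) F i w)) //.
by apply/funext => w; rewrite big_cons (negbTE Pi).
Qed.

Lemma differentiable_bigprod (I : Type) (r : seq I) (F : I -> Cn -> C) z :
  (forall i, differentiable (F i) z) ->
  differentiable (fun w => \prod_(i <- r) F i w) z.
Proof.
move=> FD; elim: r => [|i r IH].
  rewrite (_ : (fun _ => _) = cst 1); first exact: differentiable_cst.
  by apply/funext => w; rewrite big_nil.
rewrite (_ : (fun _ => _) = F i * (fun w => \prod_(i <- r) F i w)).
  by apply: differentiableM => //; exact: FD.
by apply/funext => w; rewrite big_cons.
Qed.

Lemma differentiable_cstM (a : C) (g : Cn -> C) z :
  differentiable g z -> differentiable (fun w => a * g w) z.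
Proof. exact: differentiableZ. Qed.

Definition Jac f z : C := \det ('J f z).

Lemma jacobianE f z i j : 'J f z i j = ('d f z (delta_mx 0 i)) 0 j.
Proof. by rewrite !mxE. Qed.

Lemma diff_jacobian f z v : 'd f z v = v *m 'J f z.
Proof.
rewrite {1}(row_sum_delta v) linear_sum /=; apply/rowP => j.
rewrite !mxE summxE; apply: eq_bigr => i _.
by rewrite linearZ !mxE.
Qed.

(** The determinant is a polynomial in the first partial derivatives, which are holomorphic by
    [derivative_holomorphic]. *)
Lemma Jac_holomorphic (W : set Cn) f : open W -> holomorphic W f ->
  holomorphic W (Jac f : Cn -> C).
Proof.
move=> oW fW z Wz; rewrite /Jac /determinant.
apply: differentiable_bigsum => s _.
apply: (@differentiable_cstM ((-1) ^+ s) (fun w => \prod_i 'J f w i (s i))).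
apply: differentiable_bigprod => i.
have H : differentiable (fun w => 'd (fun x => f x 0 (s i)) w (delta_mx 0 i) : C) z.
  apply: (@derivative_holomorphic _ _ W) => // w Ww.
  by have [] := differentiable_coordinate (s i) (fW w Ww).
apply: near_eq_differentiable H.
have : nbhs z W by exact: open_nbhs_nbhs.
apply: filterS => w Ww; rewrite jacobianE.
by have [_ ->] := differentiable_coordinate (s i) (fW w Ww).
Qed.

Section aut_jacobian.
Variables (W : set Cn) (oW : open W) (f : Aut W).

(** The chain rule; since vectors are rows, the Jacobian of the map applied first stands on the
    left. *)
Lemma aut_jacobian_mul z : W z -> 'J f z *m 'J (aut_inv f) (f z) = 1%:M.
Proof.
move=> Wz; have fD := aut_hol f Wz.
have gD := aut_inv_hol f (aut_maps f Wz).
have cD : is_diff z (aut_inv f \o f) ('d (aut_inv f) (f z) \o 'd f z).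
  exact: (@is_diff_comp _ _ _ _ f _ (aut_inv f) _ z (differentiableP fD) (differentiableP gD)).
have iD : is_diff z (aut_inv f \o f) id.
  rewrite (_ : aut_inv f \o f = id); first exact: is_diff_id.
  by apply/funext => w; exact: aut_funK.
have E := etrans (esym (@diff_val _ _ _ _ _ _ _ cD)) (@diff_val _ _ _ _ _ _ _ iD).
have H v : v *m ('J f z *m 'J (aut_inv f) (f z)) = v.
  rewrite mulmxA -!diff_jacobian; exact: (congr1 (fun k : Cn -> Cn => k v) E).
by apply/row_matrixP => i; rewrite !rowE mulmx1 H.
Qed.

Lemma Jac_aut_neq0 z : W z -> Jac f z != 0.
Proof.
move=> Wz; have : Jac f z * \det ('J (aut_inv f) (f z)) = 1.
  by rewrite /Jac -det_mulmx aut_jacobian_mul// det1.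
move: (Jac f z) => J; apply: contra_eq_neq => ->.
by rewrite mul0r eq_sym oner_eq0.
Qed.

End aut_jacobian.
End jacobian_det.

(** * Lebesgue measure on C^n *)

Local Notation pushm mf := (measure_function_pushforward__canonical__measure_function_Measure _ mf).

Section tuple_lebesgue.
Context {R : realType}.
Local Notation T := (measurableTypeR R).
Local Notation leb := (@lebesgue_measure R).
Local Open Scope ereal_scope.

Lemma lebesgue_translate (a : R) (A : set T) : measurable A ->
  leb ((fun x : T => (x + a)%R : T) @^-1` A) = leb A.
Proof.
have mf : measurable_fun [set: T] (fun x : T => (x + a)%R : T).
  by apply: measurable_funD => //; exact: measurable_cst.
move=> mA; apply/esym; apply: (lebesgue_measure_unique (mu := pushm mf)) => //=.
move=> _ [[x y] _ <-]; rewrite /pushforward.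
have -> : (fun z : T => (z + a)%R : T) @^-1` `]x, y] = `](x - a)%R, (y - a)%R]%classic.
  by apply/seteqP; split => z /=; rewrite !in_itv /= ltrBlDr lerBrDr.
rewrite !lebesgue_measure_itv /= !lte_fin ltrD2r.
by case: ifPn => // _; rewrite -!EFinB; congr EFin; ring.
Qed.

Definition tadd {n} (t s : n.-tuple T) : n.-tuple T :=
  [tuple (tnth t i + tnth s i)%R | i < n].

Lemma measurable_tadd n (s : n.-tuple T) : measurable_fun [set: n.-tuple T] (tadd ^~ s).
Proof.
apply/measurable_fun_tnthP => i.
rewrite (_ : _ \o _ = (fun t : n.-tuple T => (tnth t i + tnth s i)%R)); last first.
  by apply/funext => t /=; rewrite tnth_mktuple.
by apply: measurable_funD; [exact: measurable_tnth|exact: measurable_cst].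
Qed.

Local Notation tm n := (tuple_measure leb n).

(** A translation acts separately on the first coordinate and on the rest, so the image of the
    product measure agrees with it on rectangles; uniqueness of the product measure concludes. *)
Lemma tuple_measure_translate n (s : n.-tuple T) (A : set (n.-tuple T)) :
  measurable A -> tm n ((tadd ^~ s) @^-1` A) = tm n A.
Proof.
elim: n s A => [|n IH] s A mA.
  by congr (tm 0 _); apply/funext => t /=; rewrite (tuple0 (tadd t s)) (tuple0 t).
pose sh (p : T * n.-tuple T) : T * n.-tuple T :=
  ((p.1 + thead s)%R : T, tadd p.2 [tuple of behead s]).
have msh : measurable_fun setT sh.
  apply/measurable_fun_pairP; split.
    by apply: measurable_funD; [exact: measurable_fst|exact: measurable_cst].
  exact: (measurableT_comp (measurable_tadd _) measurable_snd).
rewrite /= /tcons_measure /pushforward.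
have mB : measurable (@tcons _ T n @^-1` A).
  by rewrite -[X in measurable X]setTI; exact: measurable_tcons.
have E p : tadd (tcons p) s = tcons (sh p).
  case: p => x t; apply: eq_from_tnth => i; rewrite tnth_mktuple.
  have [j|] := unliftP ord0 i => ->; last by rewrite !tnth0.
  rewrite !tnthS tnth_mktuple; congr (_ + _)%R.
  by rewrite tnth_behead; congr tnth; apply: val_inj; rewrite /= inordK// ltnS.
rewrite (_ : _ @^-1` _ = sh @^-1` (@tcons _ T n @^-1` A)); last first.
  by apply/seteqP; split => p /=; rewrite E.
apply/esym.
apply: (product_measure_unique (m' := pushm msh)) => // B1 B2 mB1 mB2 /=.
rewrite /pushforward (_ : sh @^-1` _ = (fun x : T => (x + thead s)%R : T) @^-1` B1 `*`
  (tadd ^~ [tuple of behead s]) @^-1` B2) //.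
rewrite product_measure1E.
- by congr (_ * _); [exact: lebesgue_translate|exact: IH].
- rewrite -[X in measurable X]setTI; apply: measurable_funD => //.
- by rewrite -[X in measurable X]setTI; apply: measurable_tadd.
Qed.

(** Half-open, so that dyadic boxes partition the space. *)
Definition tbox {n} (a b : 'I_n -> R) : set (n.-tuple T) :=
  [set t | forall i, (a i <= tnth t i < b i)%R].

Lemma measurable_tbox n (a b : 'I_n -> R) : measurable (tbox a b).
Proof.
rewrite (_ : tbox a b = \bigcap_(i in [set: 'I_n]) ((@tnth _ T ^~ i) @^-1` `[a i, b i[)).
  apply: fin_bigcap_measurable => [|i _]; first exact: finite_finset.
  rewrite -[X in measurable X]setTI; apply: measurable_tnth => //.
by apply/seteqP; split => [t tb i _|t tb i]; have := tb i; rewrite /= in_itv /= => // -> //.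
Qed.

Lemma tuple_measure_box n (a b : 'I_n -> R) : (forall i, a i <= b i)%R ->
  tm n (tbox a b) = (\prod_(i < n) (b i - a i))%:E.
Proof.
elim: n a b => [|n IH] a b ab.
  rewrite big_ord0 /= diracE mem_set//.
  by case.
rewrite /= /tcons_measure /pushforward.
rewrite (_ : _ @^-1` _ = `[a ord0, b ord0[ `*` tbox (a \o lift ord0) (b \o lift ord0)); last first.
  apply/seteqP; split => -[x t] /=.
    move=> xt; split; first by have := xt ord0; rewrite tnth0 in_itv.
    by move=> i; have := xt (lift ord0 i); rewrite tnthS.
  move=> [/= + tb] i; rewrite in_itv /= => xb.
  by have [j|] := unliftP ord0 i => ->; rewrite ?tnthS ?tnth0//; exact: tb.
rewrite product_measure1E//; last exact: measurable_tbox.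
rewrite IH; last by move=> i; exact: ab.
have E : leb `[a ord0, b ord0[%classic = (b ord0 - a ord0)%:E.
  rewrite lebesgue_measure_itv /= lte_fin.
  by case: ltgtP (ab ord0) => // ->; rewrite subrr.
by rewrite big_ord_recl EFinM; congr (_ * _).
Qed.

End tuple_lebesgue.

Section Cn_measure.
Context {R : realType} {n : nat}.
Local Notation C := R[i].
Local Notation Cn := 'rV[R[i]]_n.
Local Notation T := (measurableTypeR R).
Local Open Scope ereal_scope.

Definition Cn_coord (k : 'I_(n + n)) (z : Cn) : R :=
  match fintype.split k with inl j => complex.Re (z ord0 j) | inr j => complex.Im (z ord0 j) end.

Definition ofCn (z : Cn) : (n + n).-tuple T := [tuple Cn_coord k z : T | k < n + n].

Lemma ofCnK : cancel ofCn (@toCn R n).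
Proof.
move=> z; apply/rowP => j; rewrite mxE !tnth_mktuple /Cn_coord.
have -> : fintype.split (lshift n j) = inl j by rewrite -[lshift n j]/(unsplit (inl j)) unsplitK.
have -> : fintype.split (rshift n j) = inr j by rewrite -[rshift n j]/(unsplit (inr j)) unsplitK.
by case: (z ord0 j).
Qed.

Lemma Cn_coord_toCn k t : Cn_coord k (@toCn R n t) = tnth t k.
Proof.
by rewrite /Cn_coord -[in RHS](splitK k); case: fintype.split => j; rewrite mxE.
Qed.

Lemma toCnK : cancel (@toCn R n) ofCn.
Proof.
by move=> t; apply: eq_from_tnth => k; rewrite tnth_mktuple Cn_coord_toCn.
Qed.

(* A measurable structure on C^n transported from R^(2n) by toCn, so that
   integrals over preimages by toCn become integrals over subsets of C^n. *)
Definition Cn_display : measure_display. Proof. exact: default_measure_display. Qed.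

Definition Cn_measurable (A : set Cn) : Prop := measurable (@toCn R n @^-1` A).

Let Cn_measurable0 : Cn_measurable set0.
Proof. by rewrite /Cn_measurable preimage_set0. Qed.

Let Cn_measurableC A : Cn_measurable A -> Cn_measurable (~` A).
Proof. by rewrite /Cn_measurable -preimage_setC; exact: measurableC. Qed.

Let Cn_measurableU (F : (set Cn)^nat) : (forall i, Cn_measurable (F i)) ->
  Cn_measurable (\bigcup_i (F i)).
Proof.
by move=> mF; rewrite /Cn_measurable preimage_bigcup; exact: bigcupT_measurable.
Qed.

HB.instance Definition _ := @isMeasurable.Build Cn_display Cn
  Cn_measurable Cn_measurable0 Cn_measurableC Cn_measurableU.

Lemma measurable_open_Cn (W : set Cn) : open W -> measurable W.
Proof. exact: measurable_toCn_open. Qed.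

Lemma measurable_toCn : measurable_fun setT (@toCn R n).
Proof. by move=> _ A mA; rewrite setTI. Qed.

Lemma measurable_to_Cn d (U : measurableType d) (F : U -> Cn) :
  (forall k, measurable_fun setT (Cn_coord k \o F)) -> measurable_fun setT F.
Proof.
move=> mF _ A mA; rewrite setTI.
have mG : measurable_fun setT (ofCn \o F).
  apply/measurable_fun_tnthP => k.
  rewrite (_ : _ \o _ = Cn_coord k \o F); first exact: mF.
  by apply/funext => x /=; rewrite tnth_mktuple.
have -> : F @^-1` A = (ofCn \o F) @^-1` (@toCn R n @^-1` A).
  by apply/seteqP; split => x /=; rewrite ofCnK.
by rewrite -[X in measurable X]setTI; exact: mG.
Qed.

Lemma measurable_Cn_coord k : measurable_fun setT (Cn_coord k).
Proof.
move=> _ A mA; rewrite setTI.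
have -> : Cn_coord k @^-1` A = [set z | A (Cn_coord k z)] by [].
rewrite /measurable /= /Cn_measurable.
have -> : @toCn R n @^-1` [set z | A (Cn_coord k z)] = (@tnth _ T ^~ k) @^-1` A.
  by apply/seteqP; split => t /=; rewrite Cn_coord_toCn.
by rewrite -[X in measurable X]setTI; exact: measurable_tnth.
Qed.

Lemma Cn_coordD k (z w : Cn) : Cn_coord k (z + w)%R = (Cn_coord k z + Cn_coord k w)%R.
Proof.
by rewrite /Cn_coord; case: fintype.split => j; rewrite mxE; case: (z ord0 j) (w ord0 j) => a b [c d].
Qed.

Lemma Cn_coordN k (z : Cn) : Cn_coord k (- z)%R = (- Cn_coord k z)%R.
Proof.
by rewrite /Cn_coord; case: fintype.split => j; rewrite mxE; case: (z ord0 j) => a b.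
Qed.

Definition mCn (A : set Cn) : \bar R := pushforward (lebesgueR2n R n) (@toCn R n) A.

Let mCn0 : mCn set0 = 0. Proof. exact: (measure0 (pushm measurable_toCn)). Qed.

Let mCn_ge0 A : 0 <= mCn A. Proof. by rewrite /mCn /pushforward; exact: measure_ge0. Qed.

Let mCn_sigma_additive : semi_sigma_additive mCn.
Proof. exact: (@measure_semi_sigma_additive _ _ _ (pushm measurable_toCn)). Qed.

HB.instance Definition _ := isMeasure.Build _ _ _ mCn mCn0 mCn_ge0 mCn_sigma_additive.

Let mCn_sigma_finite : sigma_finite setT mCn.
Proof.
have [F FT Foo] := sigma_finiteT (lebesgueR2n R n).
have E k : @toCn R n @^-1` (ofCn @^-1` F k) = F k.
  by apply/seteqP; split => t /=; rewrite toCnK.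
exists (fun k => ofCn @^-1` F k).
  by rewrite -preimage_bigcup -FT preimage_setT.
move=> k; have [mF Fk] := Foo k; split.
  by rewrite /measurable /= /Cn_measurable E.
by rewrite /mCn /pushforward E.
Qed.

HB.instance Definition _ := Measure_isSigmaFinite.Build _ _ _ mCn mCn_sigma_finite.

Lemma mCn_translate (a : Cn) (A : set Cn) : measurable A ->
  mCn ((fun z => z + a)%R @^-1` A) = mCn A.
Proof.
move=> mA; rewrite /mCn /pushforward /lebesgueR2n.
rewrite -[RHS](tuple_measure_translate (ofCn a))//; congr (tuple_measure _ _ _).
apply/seteqP; split => t /=; (suff -> : (toCn t + a)%R = toCn (tadd t (ofCn a)) by []);
  by apply/rowP => j; rewrite -{1}(ofCnK a) !mxE !tnth_mktuple.
Qed.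

Definition Cn_box (a b : 'I_(n + n) -> R) : set Cn :=
  [set z | forall k, (a k <= Cn_coord k z < b k)%R].

Lemma toCn_box a b : @toCn R n @^-1` Cn_box a b = tbox a b.
Proof. by apply/seteqP; split => t tb k; have := tb k; rewrite Cn_coord_toCn. Qed.

Lemma measurable_Cn_box a b : measurable (Cn_box a b).
Proof. by rewrite /measurable /= /Cn_measurable toCn_box; exact: measurable_tbox. Qed.

Lemma mCn_box a b : (forall k, a k <= b k)%R ->
  mCn (Cn_box a b) = (\prod_k (b k - a k))%:E.
Proof. by move=> ab; rewrite /mCn /pushforward toCn_box; exact: tuple_measure_box. Qed.

(* Sections of {(x, y) | x in A, x + y in B} and {(x, y) | x - y in A, x in B}:
   the two sets have the same measure by translation invariance in x. *)
Lemma invariant_measure_unique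
    (mu : {sigma_finite_measure set Cn -> \bar R}) :
  (forall (a : Cn) (A : set Cn), measurable A ->
    mu ((fun z => z + a)%R @^-1` A) = mu A) ->
  forall A B : set Cn, measurable A -> measurable B ->
  mu A * mCn B = mu B * mCn (-%R @^-1` A).
Proof.
move=> muT A B mA mB.
have mD : measurable_fun setT (fun p : Cn * Cn => (p.1 + p.2)%R).
  apply: measurable_to_Cn => k.
  rewrite (_ : _ \o _ = (fun p : Cn * Cn => (Cn_coord k p.1 + Cn_coord k p.2)%R)); last first.
    by apply/funext => p /=; rewrite Cn_coordD.
  by apply: measurable_funD; apply: (measurableT_comp (measurable_Cn_coord k)).
have mS : measurable_fun setT (fun p : Cn * Cn => (p.1 - p.2)%R).
  apply: measurable_to_Cn => k.
  rewrite (_ : _ \o _ = (fun p : Cn * Cn => (Cn_coord k p.1 - Cn_coord k p.2)%R)); last first.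
    by apply/funext => p /=; rewrite Cn_coordD Cn_coordN.
  by apply: measurable_funB; apply: (measurableT_comp (measurable_Cn_coord k)).
pose S1 : set (Cn * Cn) := (A `*` setT) `&` (fun p => (p.1 + p.2)%R) @^-1` B.
pose S2 : set (Cn * Cn) := (fun p => (p.1 - p.2)%R) @^-1` A `&` (B `*` setT).
have mS1 : measurable S1.
  apply: measurableI; first exact: measurableX.
  by rewrite -[X in measurable X]setTI; exact: mD.
have mS2 : measurable S2.
  apply: measurableI; last exact: measurableX.
  by rewrite -[X in measurable X]setTI; exact: mS.
have prod12 (S : set (Cn * Cn)) : measurable S -> (mu \x mCn) S = (mu \x^ mCn) S.
  by move=> ?; apply: product_measure_unique => //= ? ? ? ?; rewrite product_measure2E.
have E1 : (mu \x mCn) S1 = mu A * mCn B.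
  rewrite /product_measure1 (eq_integral (fun x => (\1_A x)%:E * mCn B)); last first.
    move=> x _ /=; rewrite indicE; have [/set_mem Ax|/negP nA] := boolP (x \in A).
      rewrite mul1e -(mCn_translate x mB); congr mCn.
      apply/seteqP; split => y; rewrite /xsection /= inE /S1 /= addrC; last by [].
      by move=> [].
    rewrite mul0e (_ : xsection _ _ = set0) ?measure0//.
    apply/seteqP; split => y //; rewrite /xsection /= inE /S1 /= => -[[Ax _] _].
    by apply: nA; rewrite inE.
  rewrite ge0_integralZr//; last exact/measurable_EFinP/measurable_indic.
  by rewrite integral_indic// setIT.
have E2 : (mu \x mCn) S2 = mu B * mCn (-%R @^-1` A).
  rewrite /product_measure1 (eq_integral (fun x => (\1_B x)%:E * mCn (-%R @^-1` A))); last first.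
    move=> x _ /=; rewrite indicE; have [/set_mem Bx|/negP nB] := boolP (x \in B).
      have mNA : measurable (-%R @^-1` A : set Cn).
        rewrite -[X in measurable X]setTI; apply: measurable_to_Cn => // k.
        rewrite (_ : _ \o _ = (fun z => - Cn_coord k z)%R); last first.
          by apply/funext => p /=; rewrite Cn_coordN.
        apply: measurable_funN; exact: measurable_Cn_coord.
      rewrite mul1e -(mCn_translate (- x)%R mNA); congr mCn.
      apply/seteqP; split => y; rewrite /xsection /= inE /S2 /= opprB addrC.
        by rewrite addrC => -[].
      by rewrite addrC.
    rewrite mul0e (_ : xsection _ _ = set0) ?measure0//.
    apply/seteqP; split => y //; rewrite /xsection /= inE /S2 /= => -[_ [Bx _]].
    by apply: nB; rewrite inE.
  rewrite ge0_integralZr//; last exact/measurable_EFinP/measurable_indic.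
  by rewrite integral_indic// setIT.
rewrite -E1 -E2 !prod12// /product_measure2; apply: eq_integral => y _ /=.
have -> : ysection S1 y = (fun z => z + y)%R @^-1` ysection S2 y.
  apply/seteqP; split => x; rewrite /ysection /= !inE /S1 /S2 /= addrK.
    by move=> [[]].
  by move=> [Ax [Bx _]].
by rewrite muT//; exact: measurable_ysection.
Qed.

End Cn_measure.

(** * Volume distortion of complex linear maps *)

Section linear_image.
Context {R : realType} {n : nat}.
Local Notation C := R[i].
Local Notation Cn := 'rV[R[i]]_n.
Local Notation m := (@mCn R n).
Implicit Types (L M : 'M[C]_n) (z w : Cn).

Definition nball z (r : R) : set Cn := [set w | nrm (w - z) < r].

Lemma open_nball z r : open (nball z r).
Proof.
rewrite openE => w wz; apply/nbhs_nrmP; exists (r - nrm (w - z)).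
  by rewrite subr_gt0.
by move=> x; rewrite ltrBrDr => xw; apply: le_lt_trans xw; exact: nrm_triangle.
Qed.

Lemma measurable_nball z r : measurable (nball z r).
Proof. by apply: measurable_open_Cn; exact: open_nball. Qed.

Lemma Cn_coord_le k z : `|Cn_coord k z| <= nrm z.
Proof.
rewrite /Cn_coord; case: fintype.split => j; apply: le_trans (nrm_coord z j).
  exact: Re_le_nrm.
exact: Im_le_nrm.
Qed.

Lemma nrm_lt_coord z (r : R) : 0 < r -> (forall k, `|Cn_coord k z| <= r / 2) -> nrm z < r.
Proof.
move=> r0 zr; apply/nrm_row_lt => // j.
have h1 : `|complex.Re (z 0 j)| <= r / 2.
  have := zr (lshift n j); rewrite /Cn_coord.
  by rewrite -[lshift n j]/(unsplit (inl j)) unsplitK.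
have h2 : `|complex.Im (z 0 j)| <= r / 2.
  have := zr (rshift n j); rewrite /Cn_coord.
  by rewrite -[rshift n j]/(unsplit (inr j)) unsplitK.
rewrite -(ltr_pXn2r (_ : 0 < 2)%N) ?nnegrE ?nrm_ge0 ?(ltW r0)// sqr_nrm.
rewrite -(real_normK (num_real (complex.Re _))) -(real_normK (num_real (complex.Im _))).
have : `|complex.Re (z 0 j)| ^+ 2 <= (r / 2) ^+ 2.
  by rewrite ler_pXn2r ?nnegrE// divr_ge0// ltW.
have : `|complex.Im (z 0 j)| ^+ 2 <= (r / 2) ^+ 2.
  by rewrite ler_pXn2r ?nnegrE// divr_ge0// ltW.
by move: r0; rewrite expr_div_n; move: (`|_| ^+ 2) (`|_| ^+ 2) => x y; nra.
Qed.

Lemma mCn_nball_le z (r : R) : 0 <= r -> (m (nball z r) <= ((2 * r) ^+ (n + n))%:E)%E.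
Proof.
move=> r0; pose a k := Cn_coord k z - r; pose b k := Cn_coord k z + r.
have ab k : a k <= b k by rewrite /a /b; move: r0; lra.
have -> : (2 * r) ^+ (n + n) = \prod_(k < n + n) (b k - a k).
  rewrite -[in LHS](card_ord (n + n)) -prodr_const; apply: eq_bigr => k _.
  by rewrite /a /b; ring.
rewrite -mCn_box//; apply: le_measure; rewrite ?inE.
- exact: measurable_nball.
- exact: measurable_Cn_box.
move=> w wz k; have := le_lt_trans (Cn_coord_le k (w - z)) wz.
by rewrite Cn_coordD Cn_coordN ltr_norml /a /b => /andP[? ?]; apply/andP; split; lra.
Qed.

Lemma mCn_nball_ge z (r : R) : 0 < r -> ((r ^+ (n + n))%:E <= m (nball z r))%E.
Proof.
move=> r0; pose a k := Cn_coord k z - r / 2; pose b k := Cn_coord k z + r / 2.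
have ab k : a k <= b k by rewrite /a /b; move: r0; lra.
have -> : r ^+ (n + n) = \prod_(k < n + n) (b k - a k).
  rewrite -[in LHS](card_ord (n + n)) -prodr_const; apply: eq_bigr => k _.
  by rewrite /a /b; field.
rewrite -mCn_box//; apply: le_measure; rewrite ?inE.
- exact: measurable_Cn_box.
- exact: measurable_nball.
move=> w wz; apply: nrm_lt_coord => // k; have := wz k.
by rewrite Cn_coordD Cn_coordN ler_norml /a /b => /andP[? ?]; apply/andP; split; lra.
Qed.

Lemma mCn_nball_fin z (r : R) : 0 < r -> m (nball z r) \is a fin_num.
Proof.
move=> r0; rewrite ge0_fin_numE//; apply: le_lt_trans (mCn_nball_le z (ltW r0)) _.
exact: ltry.
Qed.

Lemma measurable_mulmx L : measurable_fun setT (fun z : Cn => z *m L : Cn).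
Proof.
apply: measurable_to_Cn => k.
pose c (j : 'I_n) : C := L j (match fintype.split k with inl i => i | inr i => i end).
pose x (j : 'I_n) z := Cn_coord (lshift n j) z.
pose y (j : 'I_n) z := Cn_coord (rshift n j) z.
pose g z : R := match fintype.split k with
  | inl _ => \sum_j (x j z * complex.Re (c j) - y j z * complex.Im (c j))
  | inr _ => \sum_j (x j z * complex.Im (c j) + y j z * complex.Re (c j)) end.
have ReS (I : Type) (r : seq I) (F : I -> C) :
    complex.Re (\sum_(i <- r) F i) = \sum_(i <- r) complex.Re (F i).
  elim: r => [|i r IH]; first by rewrite !big_nil.
  by rewrite !big_cons -IH; case: (F i) (\sum_(_ <- _) F _) => a1 a2 [b1 b2].
have ImS (I : Type) (r : seq I) (F : I -> C) :
    complex.Im (\sum_(i <- r) F i) = \sum_(i <- r) complex.Im (F i).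
  elim: r => [|i r IH]; first by rewrite !big_nil.
  by rewrite !big_cons -IH; case: (F i) (\sum_(_ <- _) F _) => a1 a2 [b1 b2].
have xE j z : x j z = complex.Re (z 0 j).
  by rewrite /x /Cn_coord -[lshift n j]/(unsplit (inl j)) unsplitK.
have yE j z : y j z = complex.Im (z 0 j).
  by rewrite /y /Cn_coord -[rshift n j]/(unsplit (inr j)) unsplitK.
rewrite (_ : _ \o _ = g); last first.
  apply/funext => z; rewrite /g /c /= /Cn_coord; case: fintype.split => j.
    rewrite mxE ReS; apply: eq_bigr => i _; rewrite xE yE.
    by case: (z 0 i) (L i j) => a b [u v].
  rewrite mxE ImS; apply: eq_bigr => i _; rewrite xE yE.
  by case: (z 0 i) (L i j) => a b [u v].
have mc j : measurable_fun setT (x j) by exact: measurable_Cn_coord.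
have mc' j : measurable_fun setT (y j) by exact: measurable_Cn_coord.
rewrite /g; case: fintype.split => _; apply: measurable_sum => j.
  by apply: measurable_funB; apply: measurable_funM => //; exact: measurable_cst.
by apply: measurable_funD; apply: measurable_funM => //; exact: measurable_cst.
Qed.

Definition lin_preim L (A : set Cn) : set Cn := (fun z => z *m L) @^-1` A.

Lemma measurable_lin_preim L A : measurable A -> measurable (lin_preim L A).
Proof. by move=> mA; rewrite -[X in measurable X]setTI; exact: measurable_mulmx. Qed.

Section pushforward_linear.
Variables (L : 'M[C]_n) (uL : L \in unitmx).

Definition lin_measure (A : set Cn) : \bar R := m (lin_preim L A).

Let lin_measure0 : lin_measure set0 = 0%E.
Proof. exact: (measure0 (pushm (measurable_mulmx L))). Qed.
Let lin_measure_ge0 A : (0 <= lin_measure A)%E. Proof. exact: measure_ge0. Qed.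
Let lin_measure_sigma_additive : semi_sigma_additive lin_measure.
Proof. exact: (@measure_semi_sigma_additive _ _ _ (pushm (measurable_mulmx L))). Qed.

HB.instance Definition _ := isMeasure.Build _ _ _ lin_measure
  lin_measure0 lin_measure_ge0 lin_measure_sigma_additive.

Let lin_measure_sigma_finite : sigma_finite setT lin_measure.
Proof.
have [F FT Foo] := sigma_finiteT m.
have E k : lin_preim L (lin_preim (invmx L) (F k)) = F k.
  by apply/seteqP; split => z; rewrite /lin_preim /= mulmxK.
exists (fun k => lin_preim (invmx L) (F k)).
  by rewrite -preimage_bigcup -FT preimage_setT.
move=> k; have [mF Fk] := Foo k; split; first exact: measurable_lin_preim.
by rewrite /lin_measure E.
Qed.

HB.instance Definition _ := Measure_isSigmaFinite.Build _ _ _ lin_measure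
  lin_measure_sigma_finite.

(** The preimage under L of a translate by a is a translate, by a times the inverse of L, of the
    preimage: the measure is translation invariant. *)
Lemma lin_measure_unique (A B : set Cn) : measurable A -> measurable B ->
  (lin_measure A * m B = lin_measure B * m (-%R @^-1` A))%E.
Proof.
apply: invariant_measure_unique => a D mD.
rewrite -[RHS](mCn_translate (a *m invmx L) (measurable_lin_preim L mD)).
congr (m _); apply/seteqP; split => z; rewrite /lin_preim /= mulmxDl mulmxKV//.
Qed.

End pushforward_linear.

Local Notation D := (nball 0 1).

(* The factor by which z |-> z *m L multiplies volumes. *)
Definition kappa L : R := fine (m (lin_preim (invmx L) D)) / fine (m D).

Lemma mD_gt0 : 0 < fine (m D).
Proof.
rewrite fine_gt0//; apply/andP; split; last by rewrite -ge0_fin_numE ?mCn_nball_fin.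
by apply: lt_le_trans (mCn_nball_ge 0 ltr01); rewrite expr1n lte_fin.
Qed.

Lemma nrm_mulmx_le L z : nrm (z *m L) <= (\sum_i \sum_j nrm (L i j)) * nrm z.
Proof.
have S0 : 0 <= \sum_i \sum_j nrm (L i j).
  by apply: sumr_ge0 => i _; apply: sumr_ge0 => j _; exact: nrm_ge0.
apply/nrm_row_le => [|j]; first by rewrite mulr_ge0 ?nrm_ge0.
rewrite mxE mulr_suml.
apply: (@le_trans _ _ (\sum_i nrm (z 0 i * L i j))).
  elim/big_ind2 : _ => [|a b c d ab cd|//]; first by rewrite nrm0.
  by apply: (le_trans (nrmD _ _)); exact: lerD.
apply: ler_sum => i _; rewrite nrmM mulrC.
apply: ler_pM; rewrite ?nrm_ge0 ?nrm_coord//.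
by rewrite (bigD1 j)//= lerDl sumr_ge0// => k _; exact: nrm_ge0.
Qed.

Lemma lin_preim_ball_fin L : L \in unitmx -> m (lin_preim (invmx L) D) \is a fin_num.
Proof.
move=> uL; rewrite ge0_fin_numE//; pose K := (\sum_i \sum_j nrm (L i j)) + 1.
have K0 : 0 < K.
  rewrite ltr_wpDl//; apply: sumr_ge0 => i _.
  by apply: sumr_ge0 => j _; exact: nrm_ge0.
apply: (@le_lt_trans _ _ (m (nball 0 K))); last first.
  by rewrite -ge0_fin_numE// mCn_nball_fin.
apply: le_measure; rewrite ?inE.
- by apply: measurable_lin_preim; exact: measurable_nball.
- exact: measurable_nball.
move=> z; rewrite /lin_preim /nball /= !subr0 => zD.
rewrite -[z](mulmxKV uL); apply: (le_lt_trans (nrm_mulmx_le _ _)).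
apply: (@le_lt_trans _ _ (\sum_i \sum_j nrm (L i j))); last by rewrite ltrDl.
apply: ler_piMr (ltW zD); apply: sumr_ge0 => i _.
by apply: sumr_ge0 => j _; exact: nrm_ge0.
Qed.

(** The unit ball is symmetric about 0. Taken as first set in [lin_measure_unique], it absorbs the
    reflection, and the two measures become proportional. *)
Lemma kappaE L (A : set Cn) : L \in unitmx -> measurable A ->
  (m (lin_preim (invmx L) A) = (kappa L)%:E * m A)%E.
Proof.
move=> uL mA; have uL' : invmx L \in unitmx by rewrite unitmx_inv.
have := lin_measure_unique uL' (measurable_nball 0 1) mA.
have -> : -%R @^-1` D = D :> set Cn.
  by apply/seteqP; split => z; rewrite /nball /= !subr0 nrmN.
rewrite -[lin_measure _ D]/(m (lin_preim (invmx L) D)).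
rewrite -[lin_measure _ A]/(m (lin_preim (invmx L) A)).
rewrite -[in X in X = _](fineK (lin_preim_ball_fin uL)) -[in X in _ = X](fineK (mCn_nball_fin 0 ltr01)).
rewrite /kappa; have := mD_gt0; move: (fine (m D)) (fine (m (lin_preim _ _))) => d a d0 E.
rewrite [X in X%:E]mulrC EFinM -muleA E muleCA.
have dV : d^-1 * d = 1 by rewrite mulVf// gt_eqF.
by rewrite (_ : _%:E * d%:E = 1)%E ?mule1//; exact: (congr1 EFin dV).
Qed.

Lemma kappa_ge0 L : 0 <= kappa L.
Proof. by rewrite /kappa divr_ge0 ?fine_ge0. Qed.

Lemma kappa1 : kappa 1%:M = 1.
Proof.
rewrite /kappa invmx1 (_ : lin_preim _ _ = D) ?divff ?gt_eqF ?mD_gt0//.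
by apply/seteqP; split => z; rewrite /lin_preim /= mulmx1.
Qed.

Lemma kappaM L M : L \in unitmx -> M \in unitmx ->
  kappa (L *m M) = kappa L * kappa M.
Proof.
move=> uL uM; rewrite {1}/kappa.
have -> : lin_preim (invmx (L *m M)) D = lin_preim (invmx M) (lin_preim (invmx L) D).
  have -> : invmx (L *m M) = invmx M *m invmx L.
    have uLM : L *m M \in unitmx by rewrite unitmx_mul uL uM.
    apply: (can_inj (mulmxK uLM)); rewrite mulVmx// mulmxA mulmxKV//.
    by rewrite mulVmx.
  by apply/seteqP; split => z; rewrite /lin_preim /= mulmxA.
have mD := measurable_nball 0 1.
rewrite !kappaE//; last exact: measurable_lin_preim.
have := mCn_nball_fin 0 ltr01; have := mD_gt0.
move: (kappa L) (kappa M) => kl km; case: (m D) => [d d0 _|/=|/=]; last 2 first.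
- by rewrite ltxx.
- by rewrite ltxx.
rewrite -[X in X / _]/(km * (kl * d)) -[fine _]/d in d0 *.
by rewrite mulrA mulfK ?gt_eqF// mulrC.
Qed.

Lemma kappaV L : L \in unitmx -> kappa L * kappa (invmx L) = 1.
Proof. by move=> uL; rewrite -kappaM ?unitmx_inv// mulmxV// kappa1. Qed.

(** The unit ball contains a box of side 1 and so has measure at least 1; its image under L has
    measure at least kappa(L). *)
Lemma kappa_bound L (A : set Cn) : L \in unitmx -> measurable A ->
  (forall z, nrm z < 1 -> A (z *m L)) -> ((kappa L)%:E <= m A)%E.
Proof.
move=> uL mA LA; have mD1 := mCn_nball_ge 0 ltr01; rewrite expr1n in mD1.
apply: (@le_trans _ _ ((kappa L)%:E * m D)%E).
  by rewrite -[leLHS]mule1 lee_pmul// lee_fin kappa_ge0.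
rewrite -kappaE//; last exact: measurable_nball.
apply: le_measure; rewrite ?inE//.
  by apply: measurable_lin_preim; exact: measurable_nball.
by move=> z; rewrite /lin_preim /nball /= subr0 => /LA; rewrite mulmxKV.
Qed.

Lemma mCn_affine_ball L p q (r : R) : L \in unitmx -> 0 <= r ->
  (m ((fun z => (z - p) *m invmx L) @^-1` nball q r) = (kappa L)%:E * m (nball q r))%E.
Proof.
move=> uL r0; have mB := measurable_nball q r.
exact: (etrans (mCn_translate (- p) (measurable_lin_preim (invmx L) mB)) (kappaE uL mB)).
Qed.

End linear_image.

Section kappa_det.
Context {R : realType}.
Local Notation C := R[i].

Lemma kappa_perm n (A : 'M[C]_n) : is_perm_mx A -> kappa A <= 2 ^+ (n + n).
Proof.
move=> /is_perm_mxP[s ->]; rewrite -[2]mulr1 -lee_fin.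
apply: le_trans (mCn_nball_le (0 : 'rV[C]_n) ler01).
apply: kappa_bound; rewrite ?unitmx_perm//; first exact: measurable_nball.
move=> z z1; rewrite /nball /= subr0; apply/nrm_row_lt => // j.
rewrite -[s]invgK -col_permE mxE; apply: le_lt_trans z1; exact: nrm_coord.
Qed.

(** The unit ball is mapped into a box whose sides along the real and imaginary parts of the j-th
    coordinate are both 2 |d_j|. *)
Lemma kappa_diag n (d : 'rV[C]_n) : (forall j, d 0 j != 0) ->
  kappa (diag_mx d) <= 4 ^+ n * nrm (\det (diag_mx d)) ^+ 2.
Proof.
move=> d0.
have uD : diag_mx d \in unitmx.
  by rewrite unitmxE det_diag unitfE; apply/prodf_neq0 => j _; exact: d0.
pose c (k : 'I_(n + n)) : R :=
  match fintype.split k with inl j => nrm (d 0 j) | inr j => nrm (d 0 j) end.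
have c0 k : 0 <= c k by rewrite /c; case: fintype.split => j; exact: nrm_ge0.
have nprod (I : Type) (r : seq I) (F : I -> C) :
    nrm (\prod_(i <- r) F i) = \prod_(i <- r) nrm (F i).
  elim: r => [|i r IH]; first by rewrite !big_nil nrm1.
  by rewrite !big_cons nrmM IH.
have E : 4 ^+ n * nrm (\det (diag_mx d)) ^+ 2 = \prod_k (c k - (- c k)).
  rewrite big_split_ord /=.
  have cl (j : 'I_n) : c (lshift n j) = nrm (d 0 j).
    by rewrite /c -[lshift n j]/(unsplit (inl j)) unsplitK.
  have cr (j : 'I_n) : c (rshift n j) = nrm (d 0 j).
    by rewrite /c -[rshift n j]/(unsplit (inr j)) unsplitK.
  under eq_bigr do rewrite cl opprK -mulr2n -mulr_natl.
  under [X in _ = _ * X]eq_bigr do rewrite cr opprK -mulr2n -mulr_natl.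
  rewrite !big_split /= !prodr_const !card_ord -nprod -det_diag.
  rewrite (_ : 4 = 2 * 2); last by ring.
  by rewrite exprMn; ring.
rewrite -lee_fin E -mCn_box; last by move=> k; have := c0 k; lra.
apply: kappa_bound => //; first exact: measurable_Cn_box.
move=> z z1 k.
suff : `|Cn_coord k (z *m diag_mx d)| < c k.
  by rewrite ltr_norml => /andP[/ltW -> ->].
have H j : nrm ((z *m diag_mx d) 0 j) < nrm (d 0 j).
  rewrite mul_mx_diag mxE nrmM gtr_pMl ?nrm_gt0//.
  by apply: le_lt_trans z1; exact: nrm_coord.
rewrite /Cn_coord /c; case: fintype.split => j; apply: le_lt_trans (H j).
  exact: Re_le_nrm.
exact: Im_le_nrm.
Qed.

(* Conjugating a unipotent triangular matrix by diag(t^(e i)) with t small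
   brings it close to the identity without changing kappa. *)
Lemma kappa_unitriangular n (e : 'I_n -> nat) (V : 'M[C]_n) : V \in unitmx ->
  (forall i, V i i = 1) ->
  (forall i j, i != j -> V i j != 0 -> (e j < e i)%N) ->
  kappa V <= 4 ^+ (n + n).
Proof.
move=> uV V1 Ve.
pose S : R := \sum_i \sum_j nrm (V i j).
have S0 : 0 <= S.
  by apply: sumr_ge0 => i _; apply: sumr_ge0 => j _; exact: nrm_ge0.
have VS i j : nrm (V i j) <= S.
  rewrite /S (bigD1 i)//= (bigD1 j)//= -addrA lerDl addr_ge0// ?sumr_ge0// => *.
    exact: nrm_ge0.
  by apply: sumr_ge0 => *; exact: nrm_ge0.
(* [S] bounds all entries and t (S + 1) = 1 / (n + 1). After conjugation the off-diagonal entries of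
   a column sum to at most 1 in modulus, so the unit ball is mapped into the ball of radius 2. *)
pose t : R := ((n%:R + 1) * (S + 1))^-1.
have n1 : 1 <= n%:R + 1 :> R by rewrite lerDr.
have t0 : 0 < t by rewrite invr_gt0 mulr_gt0// ltr_wpDl.
have t1 : t <= 1.
  by rewrite invf_le1 ?mulr_gt0 ?ltr_wpDl// mulr_ege1// lerDr.
pose d : 'rV[C]_n := \row_i (t ^+ e i)%:C.
pose d' : 'rV[C]_n := \row_i ((t ^+ e i)^-1)%:C.
have tn0 i : t ^+ e i != 0 by rewrite expf_neq0// gt_eqF.
have dd' : diag_mx d *m diag_mx d' = 1%:M.
  apply/matrixP => i j; rewrite mul_diag_mx !mxE; case: eqVneq => [->|]; last by rewrite !mulr0n mulr0.
  by rewrite !mulr1n -rmorphM mulfV.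
have uD : diag_mx d \in unitmx by case/mulmx1_unit: dd'.
have uD' : diag_mx d' \in unitmx by case/mulmx1_unit: dd'.
pose V' := diag_mx d *m V *m diag_mx d'.
have V'E i j : V' i j = (t ^+ e i)%:C * V i j * ((t ^+ e j)^-1)%:C.
  by rewrite /V' mul_mx_diag mxE mul_diag_mx mxE !mxE.
have uV' : V' \in unitmx by rewrite !unitmx_mul uD uV uD'.
have -> : kappa V = kappa V'.
  rewrite /V' kappaM ?unitmx_mul ?uD// kappaM// mulrAC -kappaM// dd'.
  by rewrite kappa1 mul1r.
have V'1 i : V' i i = 1 by rewrite V'E V1 mulr1 -rmorphM mulfV.
have V's i j : i != j -> nrm (V' i j) <= (n%:R + 1)^-1.
  move=> ij; have [V0|V0] := eqVneq (V i j) 0.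
    by rewrite V'E V0 mulr0 mul0r nrm0 invr_ge0 (le_trans ler01).
  have eji := Ve i j ij V0.
  rewrite V'E !nrmM !nrm_real !ger0_norm ?invr_ge0 ?exprn_ge0 ?(ltW t0)//.
  rewrite mulrAC -expfB ?(ltW eji)// -?subn_gt0 //.
  apply: (@le_trans _ _ (t * (S + 1))); last first.
    by rewrite /t invfM -mulrA mulVf ?mulr1// gt_eqF// ltr_wpDl.
  apply: ler_pM; rewrite ?exprn_ge0 ?(ltW t0) ?nrm_ge0//.
    move: eji; rewrite -subn_gt0; case: (_ - _)%N => // k _.
    by rewrite exprS ger_pMr// exprn_ile1// ltW.
  by apply: le_trans (VS i j) _; rewrite lerDl.
rewrite (_ : 4 = 2 * 2); last by ring.
rewrite -lee_fin; apply: le_trans (mCn_nball_le (0 : 'rV[C]_n) (ler0n R 2)).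
apply: kappa_bound => //; first exact: measurable_nball.
move=> z z1; rewrite /nball /= subr0; apply/nrm_row_lt => // j.
rewrite mxE (bigD1 j)//= V'1 mulr1; apply: (le_lt_trans (nrmD _ _)).
have zj : nrm (z 0 j) < 1 by apply: le_lt_trans z1; exact: nrm_coord.
suff : nrm (\sum_(i < n | i != j) z 0 i * V' i j) <= 1 by move: zj; lra.
apply: (@le_trans _ _ (\sum_(i < n | i != j) (n%:R + 1)^-1)).
  elim/big_ind2 : _ => [|a b x y ab xy|i ij]; first by rewrite nrm0.
    by apply: (le_trans (nrmD _ _)); exact: lerD.
  rewrite nrmM -[leRHS]mul1r ler_pM ?nrm_ge0 ?V's//.
  by apply: ltW; apply: le_lt_trans z1; exact: nrm_coord.
apply: (@le_trans _ _ (\sum_(i < n) (n%:R + 1)^-1)).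
  rewrite [leRHS](bigID (fun i => i != j)) /= lerDl.
  by apply: sumr_ge0 => i _; rewrite invr_ge0; exact: le_trans ler01 n1.
by rewrite sumr_const card_ord -[leLHS]mulr_natr [leLHS]mulrC ler_pdivrMr ?mul1r ?lerDl//.
Qed.

(** The LUP factorization is refined to A = P^-1 L D U', with L and U' unitriangular and D the
    diagonal of U. All factors but D have bounded kappa and a determinant of modulus 1. *)
Lemma kappa_le_det n : exists2 K : R, 0 < K &
  forall A : 'M[C]_n, A \in unitmx -> kappa A <= K * nrm (\det A) ^+ 2.
Proof.
case: n => [|n].
  exists 1 => // A _; rewrite (flatmx0 A) -(flatmx0 1%:M) kappa1 det1 nrm1.
  by rewrite expr1n mulr1.
pose N := n.+1; exists (2 ^+ (N + N) * 4 ^+ (N + N) * 4 ^+ N * 4 ^+ (N + N)).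
  by rewrite !mulr_gt0// exprn_gt0.
move=> A uA.
have := cormen_lup_correct A; have := cormen_lup_perm A.
have := @cormen_lup_lower _ _ A; have := @cormen_lup_upper _ _ A; have := cormen_lup_detL A.
case: (cormen_lup A) => [[P L] U] /= detL Uu Ll permP PALU.
have {}PALU : P *m A = L *m U by [].
have uP : P \in unitmx by case/is_perm_mxP: permP => s ->; exact: unitmx_perm.
have uL : L \in unitmx by rewrite unitmxE detL unitr1.
have uU : U \in unitmx.
  have : P *m A \in unitmx by rewrite unitmx_mul uP uA.
  by rewrite PALU unitmx_mul => /andP[].
have permV : is_perm_mx (invmx P).
  by case/is_perm_mxP: permP => s ->; apply/is_perm_mxP; exists s^-1%g; rewrite perm_mxV.
have uV : invmx P \in unitmx by rewrite unitmx_inv.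
have AE : A = invmx P *m (L *m U) by rewrite -PALU mulKmx.
have detU : \det U = \prod_i U i i.
  rewrite -det_tr det_trig; first by apply: eq_bigr => i _; rewrite mxE.
  by apply/is_trig_mxP => i j ij; rewrite mxE Uu.
have U0 i : U i i != 0.
  move: uU; rewrite unitmxE detU unitfE => /prodf_neq0; exact.
pose d : 'rV[C]_n.+1 := \row_i U i i.
pose U' := \matrix_(i, j) (U i j / U i i).
have UE : U = diag_mx d *m U'.
  apply/matrixP => i j; rewrite mul_diag_mx !mxE mulrCA mulfV ?mulr1//.
have uD : diag_mx d \in unitmx.
  by rewrite unitmxE det_diag unitfE; apply/prodf_neq0 => j _; rewrite mxE.
have uU' : U' \in unitmx by move: uU; rewrite UE unitmx_mul => /andP[].
have detUD : \det U = \det (diag_mx d).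
  by rewrite detU det_diag; apply: eq_bigr => i _; rewrite mxE.
have detA : nrm (\det A) = nrm (\det (diag_mx d)).
  rewrite AE !det_mulmx detL mul1r detUD nrmM.
  case/is_perm_mxP: permV => s ->; rewrite det_perm.
  by case: odd_perm; rewrite ?expr1 ?nrmN ?nrm1 mul1r.
have kP := kappa_perm permV.
have kL : kappa L <= 4 ^+ (N + N).
  apply: (@kappa_unitriangular _ (fun i => nat_of_ord i)) => // [i|i j ij].
    by rewrite Ll// eqxx.
  by rewrite ltnNge; apply: contraNN => ij'; rewrite Ll// (negbTE ij).
have kU : kappa U' <= 4 ^+ (N + N).
  (* U' has its nonzero off-diagonal entries above the diagonal, so the weights decrease with the
     index. *)
  apply: (@kappa_unitriangular _ (fun i => n.+1 - i)%N) => // [i|i j ij].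
    by rewrite mxE mulfV.
  rewrite mxE mulf_eq0 negb_or => /andP[Uij _].
  have : (i < j)%N.
    rewrite ltn_neqAle ij /= leqNgt; apply: contraNN Uij => ji.
    by rewrite Uu.
  by move=> ij'; rewrite ltn_sub2l// (leq_trans ij')// ltnW// ltn_ord.
have kD : kappa (diag_mx d) <= 4 ^+ N * nrm (\det A) ^+ 2.
  by rewrite detA; apply: kappa_diag => j; rewrite mxE.
have uLU : L *m U \in unitmx by rewrite unitmx_mul uL uU.
rewrite [in leLHS]AE kappaM// kappaM// UE kappaM//.
set X := nrm _ ^+ 2 in kD *; set a := 4 ^+ (N + N) in kL kU *; set b := 4 ^+ N in kD *.
have -> : 2 ^+ (N + N) * a * b * a * X = 2 ^+ (N + N) * (a * ((b * X) * a)) by ring.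
have kk (M : 'M[C]_n.+1) : 0 <= kappa M by exact: kappa_ge0.
have h1 : kappa (diag_mx d) * kappa U' <= b * X * a by apply: ler_pM.
have h2 : kappa L * (kappa (diag_mx d) * kappa U') <= a * (b * X * a).
  exact: (ler_pM (kk _) (mulr_ge0 (kk _) (kk _)) kL h1).
exact: (ler_pM (kk _) (mulr_ge0 (kk _) (mulr_ge0 (kk _) (kk _))) kP h2).
Qed.

End kappa_det.

(** * Volumes of images under automorphisms *)

Section dyadic_comparison.
Context {R : realType} {n : nat}.
Local Notation Cn := 'rV[R[i]]_n.
Local Notation key := {ffun 'I_(n + n) -> int}.

Definition dyadic_key (k : nat) (z : Cn) : key :=
  [ffun i => Num.floor (2 ^+ k * Cn_coord i z)].

Definition dyadic_cell (k : nat) (q : key) : set Cn := [set z | dyadic_key k z = q].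

Lemma dyadic_cell_box k q : dyadic_cell k q =
  Cn_box (fun i => (q i)%:~R / 2 ^+ k) (fun i => (q i)%:~R / 2 ^+ k + (2 ^+ k)^-1) :> set Cn.
Proof.
have p0 : 0 < 2 ^+ k :> R by rewrite exprn_gt0.
apply/seteqP; split => z.
  move=> <- i; rewrite ffunE ler_pdivrMr// [_ * 2 ^+ k]mulrC floor_le_tmp /=.
  rewrite -[X in _ + X]mul1r -mulrDl ltr_pdivlMr// [_ * 2 ^+ k]mulrC.
  by have := floorD1_gt (2 ^+ k * Cn_coord i z); rewrite intrD.
move=> zq; apply/ffunP => i; rewrite ffunE; apply/eqP; rewrite floor_eq.
have /andP[h1 h2] := zq i; apply/andP; split.
  by move: h1; rewrite ler_pdivrMr// mulrC.
by move: h2; rewrite -[X in _ + X]mul1r -mulrDl ltr_pdivlMr// mulrC intrD.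
Qed.

Lemma floor_half (x y : R) : Num.floor (2 * x) = Num.floor (2 * y) ->
  Num.floor x = Num.floor y.
Proof.
have H (a b : R) : Num.floor (2 * a) = Num.floor (2 * b) ->
    Num.floor a <= Num.floor b.
  move=> ab; have h : 2 * Num.floor a <= Num.floor (2 * a).
    by rewrite floor_ge_int intrM ler_pM2l// floor_le_tmp.
  rewrite floor_ge_int -(ler_pM2l (_ : 0 < 2 :> R))// -[2 in leLHS]/(2%:~R) -intrM.
  by rewrite -floor_ge_int -ab.
by move=> xy; apply/eqP; rewrite eq_le !H.
Qed.

Lemma dyadic_key_le (j k : nat) (z w : Cn) : (j <= k)%N ->
  dyadic_key k z = dyadic_key k w -> dyadic_key j z = dyadic_key j w.
Proof.
move=> jk; elim: k jk => [|k IH]; first by rewrite leqn0 => /eqP ->.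
rewrite leq_eqVlt => /predU1P[->//|jk] E; apply: IH => //.
apply/ffunP => i; move/ffunP: E => /(_ i); rewrite !ffunE !exprS -!mulrA.
exact: floor_half.
Qed.

(** Taking around each point the coarsest good cell partitions A into cells on which the inequality
    holds. Additivity is asked only along partitions of A, so that volumes of images and integrals
    over variable sets can be inserted directly. *)
Lemma dyadic_comparison (mu nu : set Cn -> \bar R) (A : set Cn) :
  (forall B, (0 <= mu B)%E) -> (forall B, (0 <= nu B)%E) ->
  (forall F : nat -> set Cn, (forall i, measurable (F i)) ->
    trivIset setT F -> \bigcup_i F i = A ->
    mu A = (\sum_(i <oo) mu (F i))%E /\ nu A = (\sum_(i <oo) nu (F i))%E) ->
  mu set0 = 0%E ->
  (forall z, A z -> exists N, forall k, (N <= k)%N -> forall q, dyadic_cell k q z ->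
    dyadic_cell k q `<=` A /\ (mu (dyadic_cell k q) <= nu (dyadic_cell k q))%E) ->
  (mu A <= nu A)%E.
Proof.
move=> mu0 nu0 add muE loc.
pose good k (z : Cn) : bool := `[< dyadic_cell k (dyadic_key k z) `<=` A /\
  (mu (dyadic_cell k (dyadic_key k z)) <= nu (dyadic_cell k (dyadic_key k z)))%E >].
have exgood z : A z -> exists k, good k z.
  by move=> /loc[N NP]; exists N; apply/asboolP; exact: NP.
pose lev z : nat := if pselect (A z) is left Az then ex_minn (exgood z Az) else 0%N.
have levP z : A z -> good (lev z) z /\ forall k, good k z -> (lev z <= k)%N.
  by rewrite /lev; case: pselect => // Az _; case: ex_minnP.
have goodE k z w j : dyadic_key k z = dyadic_key k w -> (j <= k)%N -> good j z = good j w.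
  by move=> E jk; rewrite /good (dyadic_key_le jk E).
(* Indexed by the code of a level and a key, each [F i] is empty or a single cell. *)
pose F (i : nat) : set Cn := [set z | A z /\
  pickle (lev z, dyadic_key (lev z) z) = i].
have FE i z : F i z -> F i = dyadic_cell (lev z) (dyadic_key (lev z) z).
  move=> [Az Ei]; have [gz minz] := levP z Az.
  have := gz; move=> /asboolP[subA _].
  apply/seteqP; split => w.
    move=> [Aw]; rewrite -Ei => /(pcan_inj pickleK) [lw kw].
    by rewrite /dyadic_cell /= -kw -lw.
  move=> wz; have wz' : dyadic_key (lev z) w = dyadic_key (lev z) z by [].
  have Aw : A w by exact: subA.
  have [gw minw] := levP w Aw.
  (* Goodness at a level j <= k depends only on the cell of level k, so the points of this cell
     share their minimal level. *)
  have lw : lev w = lev z.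
    apply/eqP; rewrite eqn_leq; apply/andP; split.
      by apply: minw; rewrite (goodE _ _ _ _ wz' (leqnn _)).
    have lwz : (lev w <= lev z)%N by apply: minw; rewrite (goodE _ _ _ _ wz' (leqnn _)).
    by apply: minz; rewrite -(goodE _ _ _ _ wz' lwz).
  by split => //; rewrite lw wz' -Ei.
have mF i : measurable (F i).
  have [->|/set0P[z Fz]] := eqVneq (F i) set0; first exact: measurable0.
  by rewrite (FE _ _ Fz) dyadic_cell_box; exact: measurable_Cn_box.
have tF : trivIset setT F.
  apply/trivIsetP => i j _ _ ij; apply/seteqP; split => // z [[_ Ei] [_ Ej]].
  by move/eqP : ij; apply; rewrite -Ei -Ej.
have UF : \bigcup_i F i = A.
  apply/seteqP; split => [z [i _ []]//|z Az].
  by exists (pickle (lev z, dyadic_key (lev z) z)) => //; split.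
have [-> ->] := add F mF tF UF.
apply: lee_nneseries => // i _.
have [->|/set0P[z Fz]] := eqVneq (F i) set0; first by rewrite muE.
rewrite (FE _ _ Fz); have [/asboolP[]//] := levP z Fz.1.
Qed.

End dyadic_comparison.

Section change_of_variables.
Context {R : realType}.
Local Notation C := R[i].

Lemma measurable_continuous_Cn n (W : set 'rV[C]_n) (g : 'rV[C]_n -> R) : open W ->
  (forall z, W z -> {for z, continuous g}) -> measurable_fun W g.
Proof.
move=> oW gc; apply: (measurability _ (RGenOInfty.measurableE R)).
move=> _ [_ [x ->] <-]; apply: measurable_open_Cn.
rewrite openE => z [Wz gz]; have oz := open_nbhs_nbhs (conj oW Wz).
apply: filterI => //; apply: gc => //.
by apply: open_nbhs_nbhs; split => //; exact: interval_open.
Qed.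

(** Continuity gives measurability on W; off W the map is the identity. *)
Lemma measurable_aut n (W : set 'rV[C]_n) (F : 'rV[C]_n -> 'rV[C]_n) : open W ->
  holomorphic W F -> (forall z, ~ W z -> F z = z) -> measurable_fun setT F.
Proof.
move=> oW hF Fout; apply: measurable_to_Cn => k.
have mW := measurable_open_Cn oW.
rewrite -(setUv W); apply/measurable_funU => //; first exact: measurableC.
split.
  apply: measurable_continuous_Cn => // z Wz.
  have Fc : {for z, continuous F} by apply: differentiable_continuous; exact: hF.
  have [h _] := @cvg_nrmP R _ _ (nbhs z) (nbhs_filter z) F (F z).
  apply/(@cvgrPdist_lt _ _ _ (nbhs z) (nbhs_filter z)) => e e0.
  apply: (@filterS _ (nbhs z) (nbhs_filter z) _ _ _ (h Fc e e0)) => w Fwz.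
  rewrite /= -Cn_coordN -Cn_coordD; apply: le_lt_trans (Cn_coord_le _ _) _.
  by rewrite nrmC.
apply: (@eq_measurable_fun _ _ _ _ _ (Cn_coord k)).
  by move=> z /set_mem Wz; rewrite /= Fout.
by apply: measurable_funTS; exact: measurable_Cn_coord.
Qed.

Lemma dyadic_small (d : R) : 0 < d -> exists N, forall k, (N <= k)%N -> (2 ^+ k)^-1 < d.
Proof.
move=> d0; have : (fun k => (2^-1 : R) ^+ k) @ \oo --> (0 : R).
  by apply: cvg_expr; rewrite ger0_norm; lra.
move=> /cvgrPdist_lt/(_ _ d0)[N _ NP]; exists N => k /NP /=.
by rewrite sub0r normrN ger0_norm ?exprn_ge0// exprVn.
Qed.

(** Here b lies between 3a/4 and 5a/4, and 9/16 >= 1/2, 25/16 <= 2. *)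
Lemma sqr_near (a b x : R) : 0 < a -> 0 <= b -> x < a / 4 -> a <= b + x ->
  b <= a + x -> a ^+ 2 / 2 <= b ^+ 2 <= 2 * a ^+ 2.
Proof.
move=> a0 b0 xa k1 k2.
have p1 : 0 <= (b - 3 / 4 * a) * (b + 3 / 4 * a) by apply: mulr_ge0; lra.
have p2 : 0 <= (5 / 4 * a - b) * (5 / 4 * a + b) by apply: mulr_ge0; lra.
have p3 : 0 <= a * a by apply: mulr_ge0; exact: ltW.
by rewrite !expr2; apply/andP; split; lra.
Qed.

Section cell.
Context {n : nat}.
Local Notation Cn := 'rV[C]_n.
Local Notation m := (@mCn R n).

Lemma mCn_dyadic_cell k q :
  m (dyadic_cell k q) = (((2 ^+ k)^-1) ^+ (n + n))%:E.
Proof.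
rewrite dyadic_cell_box mCn_box; last by move=> i; rewrite lerDl invr_ge0 exprn_ge0.
under eq_bigr do rewrite addrAC subrr add0r.
by rewrite prodr_const card_ord.
Qed.

Lemma dyadic_cell_sub k q (z : Cn) : dyadic_cell k q z ->
  dyadic_cell k q `<=` nball z (2 * (2 ^+ k)^-1).
Proof.
rewrite dyadic_cell_box => zq w wq; have s0 : 0 < (2 ^+ k)^-1 :> R.
  by rewrite invr_gt0 exprn_gt0.
rewrite /nball /=; apply: nrm_lt_coord; first by rewrite mulr_gt0.
move=> i; rewrite Cn_coordD Cn_coordN ler_norml.
have := zq i; have := wq i.
by move: ((q i)%:~R / 2 ^+ k) => a; move: (2 ^+ k)^-1 s0 => b s0 /andP[? ?] /andP[? ?]; apply/andP; split; lra.
Qed.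

Lemma dyadic_cell_sup k q (z : Cn) : dyadic_cell k q z ->
  exists2 c, nrm (c - z) < (2 ^+ k)^-1 & nball c ((2 ^+ k)^-1 / 2) `<=` dyadic_cell k q.
Proof.
rewrite dyadic_cell_box => zq; have s0 : 0 < (2 ^+ k)^-1 :> R.
  by rewrite invr_gt0 exprn_gt0.
pose t := [tuple (q i)%:~R / 2 ^+ k + (2 ^+ k)^-1 / 2 : measurableTypeR R | i < n + n].
have tc i : Cn_coord i (toCn t) = (q i)%:~R / 2 ^+ k + (2 ^+ k)^-1 / 2.
  by rewrite Cn_coord_toCn tnth_mktuple.
exists (toCn t).
  apply: nrm_lt_coord => // i; rewrite Cn_coordD Cn_coordN tc ler_norml.
  have := zq i.
  by move: ((q i)%:~R / 2 ^+ k) => a; move: (2 ^+ k)^-1 s0 => b s0 /andP[? ?]; apply/andP; split; lra.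
move=> w wc i; have := le_lt_trans (Cn_coord_le i _) wc.
rewrite Cn_coordD Cn_coordN tc ltr_norml.
by move: ((q i)%:~R / 2 ^+ k) => a; move: (2 ^+ k)^-1 s0 => b s0 /andP[? ?]; apply/andP; split; lra.
Qed.

Lemma measurable_affine_preim (L : 'M[C]_n) p (B : set Cn) : measurable B ->
  measurable ((fun z => (z - p) *m L) @^-1` B).
Proof.
move=> mB; have mt : measurable_fun setT (fun z : Cn => z - p : Cn).
  apply: measurable_to_Cn => k.
  rewrite (_ : _ \o _ = (fun z => Cn_coord k z - Cn_coord k p)); last first.
    by apply/funext => z /=; rewrite Cn_coordD Cn_coordN.
  by apply: measurable_funB; [exact: measurable_Cn_coord|exact: measurable_cst].
have := mt measurableT _ (measurable_lin_preim L mB); rewrite setTI; exact.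
Qed.

Section local_estimate.
Variables (Omega : set Cn) (oO : open Omega) (f : Aut Omega) (z : Cn).
Hypothesis Oz : Omega z.
Variable K : R.
Hypothesis K0 : 0 < K.
Hypothesis KP : forall A : 'M[C]_n, A \in unitmx -> kappa A <= K * nrm (\det A) ^+ 2.

Let A := 'J f z.
Let J2 := nrm (Jac f z) ^+ 2.

Lemma aut_jacobian_unit : A \in unitmx.
Proof. by rewrite unitmxE unitfE; exact: Jac_aut_neq0. Qed.

Let uA := aut_jacobian_unit.

Let J0 : 0 < nrm (Jac f z). Proof. by apply: nrm_gt0; exact: Jac_aut_neq0. Qed.

(** The upper bound for the inverse matrix, combined with [kappaV]. *)
Lemma kappa_lower : J2 <= K * kappa A.
Proof.
have E := kappaV uA; have uV : invmx A \in unitmx by rewrite unitmx_inv.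
have := KP uV; rewrite det_inv nrmV exprVn -[\det A]/(Jac f z) -/J2 => h.
have J20 : 0 < J2 by rewrite exprn_gt0.
have h' : kappa (invmx A) * J2 <= K by rewrite -ler_pdivlMr.
by rewrite -[leLHS]mul1r -E -mulrA [leRHS]mulrC; apply: ler_wpM2l h'; exact: kappa_ge0.
Qed.

Let jac_inv : 'J (aut_inv f) (f z) = invmx A.
Proof.
by have := aut_jacobian_mul f Oz => E; rewrite -[RHS]mulmx1 -E mulKmx.
Qed.

(** The preimage of S under [aut_inv f] is f(S). It lies in the affine image, under the differential
    A, of a ball of radius 3s: 2s for S itself and s for the linearization error pulled back by
    A. *)
Lemma aut_image_upper : exists2 d : R, 0 < d & forall s, 0 < s < d ->
  forall S : set Cn, measurable S -> S `<=` Omega -> S `<=` nball z (2 * s) ->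
  (m (aut_inv f @^-1` S) <= (kappa A * (6 * s) ^+ (n + n))%:E)%E.
Proof.
pose K1 : R := \sum_i \sum_j nrm (invmx A i j).
have K10 : 0 <= K1.
  by apply: sumr_ge0 => i _; apply: sumr_ge0 => j _; exact: nrm_ge0.
(* The inverse of A has norm at most [K1], so the error pulled back is at most K1 / (K1 + 1) times
   s. *)
have e0 : 0 < (2 * (K1 + 1))^-1 by rewrite invr_gt0 mulr_gt0// ltr_wpDl.
have [d d0 dP] := differentiable_nrm (aut_hol f Oz) e0.
exists (d / 2); first by rewrite divr_gt0.
move=> s /andP[s0 sd] S mS SO Sz; have s30 : 0 <= 3 * s by rewrite mulr_ge0// ltW.
have : (m ((fun y => (y - f z) *m invmx A) @^-1` nball 0 (3 * s)) <=
    (kappa A * (6 * s) ^+ (n + n))%:E)%E.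
  rewrite mCn_affine_ball// [X in (_ <= X)%E](EFinM (kappa A)) lee_pmul ?lee_fin ?kappa_ge0//.
  have -> : 6 * s = 2 * (3 * s) by ring.
  exact: mCn_nball_le.
apply: le_trans; apply: le_measure; rewrite ?inE.
- rewrite -[X in measurable X]setTI.
  exact: (measurable_aut oO (aut_inv_hol f) (@aut_inv_out _ _ _ f)).
- by apply: measurable_affine_preim; exact: measurable_nball.
move=> y Sy; rewrite /nball /= subr0; set w := aut_inv f y.
have yE : y = f w by rewrite /w aut_invK.
have wz : nrm (w - z) < 2 * s by exact: (Sz _ Sy).
have := dP (w - z); rewrite [z + _]addrC subrK -yE diff_jacobian -/A => h.
have {}h : nrm (y - f z - (w - z) *m A) <= (2 * (K1 + 1))^-1 * nrm (w - z).
  by apply: h; move: wz sd; lra.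
have -> : (y - f z) *m invmx A = (w - z) + (y - f z - (w - z) *m A) *m invmx A.
  by rewrite [in RHS]mulmxBl mulmxK// [RHS]addrC subrK.
apply: (le_lt_trans (nrmD _ _)).
suff : nrm ((y - f z - (w - z) *m A) *m invmx A) <= s by move: wz; lra.
apply: (le_trans (nrm_mulmx_le _ _)); rewrite -/K1.
apply: (@le_trans _ _ (K1 * ((2 * (K1 + 1))^-1 * (2 * s)))).
  apply: ler_wpM2l => //; apply: (le_trans h); apply: ler_wpM2l (ltW wz).
  exact: ltW.
have -> : K1 * ((2 * (K1 + 1))^-1 * (2 * s)) = K1 / (K1 + 1) * s.
  by field; rewrite gt_eqF// ltr_wpDl.
rewrite ger_pMl// ler_pdivrMr ?mul1r ?lerDl// ltr_wpDl//.
Qed.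

(** Linearizing the inverse map at f(z) turns the lower bound into an inclusion: it sends the affine
    image of a ball of radius s/4 into the ball of radius s/2 about c. *)
Lemma aut_image_lower : exists2 d : R, 0 < d & forall s, 0 < s < d ->
  forall (S : set Cn) c, measurable S -> nrm (c - z) < s -> nball c (s / 2) `<=` S ->
  ((kappa A * (s / 4) ^+ (n + n))%:E <= m (aut_inv f @^-1` S))%E.
Proof.
pose K2 : R := \sum_i \sum_j nrm (A i j).
have K20 : 0 <= K2.
  by apply: sumr_ge0 => i _; apply: sumr_ge0 => j _; exact: nrm_ge0.
have K21 : 0 < K2 + 1 by rewrite ltr_wpDl.
(* On the affine image |y - f(z)| is at most 2s (K2 + 1), so the error is at most s/4. *)
have e0 : 0 < (8 * (K2 + 1))^-1 by rewrite invr_gt0 mulr_gt0.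
have [d d0 dP] := differentiable_nrm (aut_inv_hol f (aut_maps f Oz)) e0.
exists (d / 2 / (K2 + 1)); first by rewrite !divr_gt0.
move=> s /andP[s0]; rewrite ltr_pdivlMr// => sd S c mS cz cS.
have s40 : 0 < s / 4 by rewrite divr_gt0.
have : ((kappa A * (s / 4) ^+ (n + n))%:E <=
    m ((fun y => (y - f z) *m invmx A) @^-1` nball (c - z) (s / 4)))%E.
  rewrite mCn_affine_ball ?(ltW s40)// [X in (X <= _)%E](EFinM (kappa A)) lee_pmul ?lee_fin ?kappa_ge0 ?exprn_ge0 ?(ltW s40)//.
  exact: mCn_nball_ge.
move=> /le_trans; apply; apply: le_measure; rewrite ?inE.
- by apply: measurable_affine_preim; exact: measurable_nball.
- rewrite -[X in measurable X]setTI.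
  exact: (measurable_aut oO (aut_inv_hol f) (@aut_inv_out _ _ _ f)).
move=> y; rewrite /nball /=; set h := (y - f z) *m invmx A => hc; apply: cS.
have yE : y - f z = h *m A by rewrite /h mulmxKV.
have hs : nrm h < 2 * s.
  have := nrmD (h - (c - z)) (c - z); rewrite subrK => hh.
  by apply: (le_lt_trans hh); move: hc cz; lra.
have yz : nrm (y - f z) <= K2 * (2 * s).
  rewrite yE; apply: (le_trans (nrm_mulmx_le _ _)); apply: ler_wpM2l => //.
  exact: ltW.
have yz' : nrm (y - f z) <= (K2 + 1) * (2 * s).
  by apply: (le_trans yz); rewrite ler_wpM2r ?lerDl// mulr_ge0// ltW.
have := dP (y - f z); rewrite [f z + _]addrC subrK diff_jacobian jac_inv aut_funK -/h.
move=> H; have {}H : nrm (aut_inv f y - z - h) <= (8 * (K2 + 1))^-1 * nrm (y - f z).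
  by apply: H; apply: (le_lt_trans yz'); move: sd; lra.
have {}H : nrm (aut_inv f y - z - h) <= s / 4.
  apply: (le_trans H); apply: (@le_trans _ _ ((8 * (K2 + 1))^-1 * ((K2 + 1) * (2 * s)))).
    by apply: ler_wpM2l => //; exact: ltW.
  rewrite le_eqVlt; apply/orP; left; apply/eqP; field; rewrite gt_eqF//.
rewrite /nball /= (_ : _ - c = (aut_inv f y - z - h) + (h - (c - z))).
  by apply: (le_lt_trans (nrmD _ _)); move: H hc; lra.
by rewrite addrA subrK opprB addrA subrK.
Qed.

Lemma Jac_near : exists2 d : R, 0 < d & forall w, nrm (w - z) < d ->
  J2 / 2 <= nrm (Jac f w) ^+ 2 <= 2 * J2.
Proof.
have Jc : {for z, continuous (Jac f : Cn -> C)}.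
  by apply: differentiable_continuous; apply: (Jac_holomorphic oO (aut_hol f)).
have e0 : 0 < nrm (Jac f z) / 4 by rewrite divr_gt0.
have [h _] := @cvg_nrmP R _ _ (nbhs z) (nbhs_filter z) (Jac f) (Jac f z).
have /nbhs_nrmP[d d0 dP] := h Jc _ e0; exists d => // w /dP /= wz.
have tri (a b : C) : nrm a <= nrm b + nrm (a - b).
  by have := nrmD b (a - b); rewrite [b + _]addrC subrK.
have h1 := tri (Jac f z) (Jac f w); rewrite nrmC in h1.
have h2 := tri (Jac f w) (Jac f z).
exact: (sqr_near J0 (nrm_ge0 _) wz h1 h2).
Qed.

End local_estimate.
End cell.
End change_of_variables.

Section volume.
Context {R : realType} {n : nat}.
Local Notation C := R[i].
Local Notation Cn := 'rV[C]_n.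
Local Notation m := (@mCn R n).
Local Notation N2 := (n + n)%N.

Lemma measurable_nrm_holomorphic (W : set Cn) (g : Cn -> C) : open W ->
  (forall z, W z -> {for z, continuous g}) ->
  measurable_fun W (fun z => nrm (g z)).
Proof.
move=> oW gc; apply: measurable_continuous_Cn => // z Wz.
have [h _] := @cvg_nrmP R _ _ (nbhs z) (nbhs_filter z) g (g z).
apply/(@cvgrPdist_lt _ _ _ (nbhs z) (nbhs_filter z)) => e e0.
apply: (@filterS _ (nbhs z) (nbhs_filter z) _ _ _ (h (gc z Wz) e e0)) => w.
have tri (a b : C) : nrm a <= nrm b + nrm (a - b).
  by have := nrmD b (a - b); rewrite [b + _]addrC subrK.
have := tri (g z) (g w); have := tri (g w) (g z); rewrite (nrmC (g z)) /=.
move: (nrm (g w - g z)) (nrm (g w)) (nrm (g z)) => x b a h1 h2 xe.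
by rewrite ltr_norml; apply/andP; split; lra.
Qed.

Lemma integral_pinch (S : set Cn) (g : Cn -> R) (a b : R) : measurable S ->
  measurable_fun S g -> 0 <= a ->
  (forall z, S z -> a <= g z <= b) ->
  (a%:E * m S <= \int[m]_(z in S) (g z)%:E <= b%:E * m S)%E.
Proof.
move=> mS mg a0 gab; apply/andP; split.
  rewrite -integral_cst//; apply: ge0_le_integral => //.
  - exact/measurable_EFinP.
  - by move=> z Sz; rewrite lee_fin; have /andP[] := gab z Sz.
rewrite -integral_cst//; apply: ge0_le_integral => //.
- by move=> z Sz; rewrite lee_fin (le_trans a0)//; have /andP[] := gab z Sz.
- exact/measurable_EFinP.
- by move=> z Sz; rewrite lee_fin; have /andP[] := gab z Sz.
Qed.

Lemma integral_sum (A : set Cn) (g : Cn -> R) (F : nat -> set Cn) :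
  measurable_fun A g -> (forall z, A z -> 0 <= g z) ->
  (forall i, measurable (F i)) -> trivIset setT F -> \bigcup_i F i = A ->
  (\int[m]_(z in A) (g z)%:E = \sum_(i <oo) \int[m]_(z in F i) (g z)%:E)%E.
Proof.
move=> mg g0 mF tF FA; rewrite -FA ge0_integral_bigcup// ?FA.
  exact/measurable_EFinP.
by move=> z Az; rewrite lee_fin g0.
Qed.

Lemma cell_algebra_upper (ka K J2 s a : R) : 0 <= s -> ka <= K * J2 ->
  0 <= a -> ka * (a * s) <= 2 * K * a * (J2 / 2 * s).
Proof.
move=> s0 kK a0; have as0 : 0 <= a * s by apply: mulr_ge0.
have -> : 2 * K * a * (J2 / 2 * s) = (K * J2) * (a * s) by field.
exact: ler_wpM2r.
Qed.

Lemma cell_algebra_lower (ka K J2 s a b : R) : 0 <= s -> J2 <= K * ka ->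
  0 < a -> a <= b -> 0 <= K -> 0 <= ka -> 2 * J2 * s <= 2 * K * b * (ka * (a^-1 * s)).
Proof.
move=> s0 JK a0 ab K0 ka0.
have Ks : 0 <= K * ka * s by rewrite !mulr_ge0.
apply: (@le_trans _ _ (2 * (K * ka * s))).
  by rewrite -mulrA ler_pM2l// ler_wpM2r.
have -> : 2 * K * b * (ka * (a^-1 * s)) = 2 * ((b / a) * (K * ka * s)) by field; rewrite gt_eqF.
by rewrite ler_pM2l// ler_peMl// ler_pdivlMr// mul1r.
Qed.

(** Two uses of [dyadic_comparison], on cells where f is close to its differential at a given point
    and |det f'|^2 stays within a factor 2 of its value there. The constant depends on the dimension
    alone, hence serves a whole sequence of automorphisms. *)
Lemma aut_volume : exists2 K : R, 0 < K &
  forall (Omega : set Cn) (oO : open Omega) (f : Aut Omega) (A : set Cn),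
  open A -> A `<=` Omega ->
  (m (aut_inv f @^-1` A) <= \int[m]_(z in A) (K * nrm (Jac f z) ^+ 2)%:E)%E /\
  (\int[m]_(z in A) (nrm (Jac f z) ^+ 2)%:E <= K%:E * m (aut_inv f @^-1` A))%E.
Proof.
have [K K0 KP] := @kappa_le_det R n.
(* The 2 absorbs the variation of |det f'|^2 on a cell and [K] the comparison of kappa with the
   determinant. The 6 comes from the ball of radius 3s and also covers the 4 of
   [aut_image_lower]. *)
pose K' := 2 * K * 6 ^+ N2.
have K'0 : 0 < K' by rewrite /K' !mulr_gt0// exprn_gt0.
exists K' => // Omega oO f A oA AO.
pose g z := nrm (Jac f z) ^+ 2.
have g0 z : 0 <= g z by exact: sqr_ge0.
have mg : measurable_fun A g.
  apply: measurable_funX; apply: measurable_nrm_holomorphic => // z Az.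
  by apply: differentiable_continuous; exact: (Jac_holomorphic oO (aut_hol f) (AO _ Az)).
have mK : measurable_fun A (fun z => K' * g z).
  by apply: measurable_funM => //; exact: measurable_cst.
have mi := measurable_aut oO (aut_inv_hol f) (@aut_inv_out _ _ _ f).
have loc z : A z -> exists N, forall k, (N <= k)%N -> forall q, dyadic_cell k q z ->
    let S := dyadic_cell k q in let s := ((2 ^+ k)^-1 : R) in
    [/\ S `<=` A,
      (m (aut_inv f @^-1` S) <= (K' * (g z / 2 * s ^+ N2))%:E)%E,
      ((2 * g z * s ^+ N2)%:E <= K'%:E * m (aut_inv f @^-1` S))%E &
      forall w, S w -> g z / 2 <= g w <= 2 * g z].
  move=> Az; have Oz := AO z Az.
  have [d1 d10 H1] := aut_image_upper oO f Oz.
  have [d2 d20 H2] := aut_image_lower oO f Oz.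
  have [d3 d30 H3] := Jac_near oO f Oz.
  have /nbhs_nrmP[d4 d40 H4] : nbhs z A by exact: open_nbhs_nbhs.
  have [|N NP] := @dyadic_small R (Num.min (Num.min d1 d2) (Num.min (d3 / 2) (d4 / 2))).
    by rewrite !lt_min d10 d20 !divr_gt0.
  exists N => k /NP; rewrite !lt_min => /andP[/andP[k1 k2] /andP[k3 k4]] q zq S s.
  have s0 : 0 < s by rewrite invr_gt0 exprn_gt0.
  have Ss w : S w -> nrm (w - z) < 2 * s by move=> Sw; exact: (dyadic_cell_sub zq Sw).
  have SA : S `<=` A.
    by move=> w /Ss wz; apply: H4; apply: lt_trans wz _; rewrite mulrC -ltr_pdivlMr.
  have mS : measurable S by rewrite /S dyadic_cell_box; exact: measurable_Cn_box.
  have uA := aut_jacobian_unit f Oz.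
  have sN : 0 <= s ^+ N2 by rewrite exprn_ge0// ltW.
  split => //.
  - have h : (m (aut_inv f @^-1` S) <= (kappa ('J f z) * (6 * s) ^+ N2)%:E)%E.
      apply: H1 => //; first by rewrite s0 k1.
      by move=> w /SA /AO.
    apply: (le_trans h); rewrite lee_fin exprMn.
    exact: (cell_algebra_upper sN (KP _ uA) (exprn_ge0 _ (ler0n R 6))).
  - have [c cz cS] := dyadic_cell_sup zq.
    have h : ((kappa ('J f z) * (s / 4) ^+ N2)%:E <= m (aut_inv f @^-1` S))%E.
      by apply: (H2 s _ S c) => //; rewrite s0 k2.
    apply: (@le_trans _ _ (K'%:E * (kappa ('J f z) * (s / 4) ^+ N2)%:E)%E); last first.
      by apply: lee_wpmul2l h; rewrite lee_fin ltW.
    rewrite -EFinM lee_fin expr_div_n [s ^+ N2 / _]mulrC.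
    apply: cell_algebra_lower => //.
    + exact: (kappa_lower f Oz KP).
    + by apply: lerXn2r; rewrite ?nnegrE//; lra.
    + exact: ltW.
    + exact: kappa_ge0.
  - move=> w /Ss wz; apply: H3; apply: lt_trans wz _.
    by rewrite mulrC -ltr_pdivlMr.
have g20 z : 0 <= g z / 2 by rewrite divr_ge0.
have mcell k q : measurable (dyadic_cell k q : set Cn).
  by rewrite dyadic_cell_box; exact: measurable_Cn_box.
have pinch k q z : dyadic_cell k q `<=` A ->
    (forall w, dyadic_cell k q w -> g z / 2 <= g w <= 2 * g z) ->
    ((g z / 2 * (2 ^+ k)^-1 ^+ N2)%:E <= \int[m]_(z in dyadic_cell k q) (g z)%:E <=
      (2 * g z * (2 ^+ k)^-1 ^+ N2)%:E)%E.
  move=> SA gS; rewrite (EFinM (g z / 2)) (EFinM (2 * g z)) -(mCn_dyadic_cell k q).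
  by apply: integral_pinch => //; exact: (measurable_funS (measurable_open_Cn oA) SA mg).
split.
- apply: (dyadic_comparison (mu := fun S => m (aut_inv f @^-1` S))
    (nu := fun S => (\int[m]_(z in S) (K' * g z)%:E)%E)).
  + by move=> B; exact: measure_ge0.
  + by move=> B; apply: integral_ge0 => z _; rewrite lee_fin mulr_ge0// ltW.
  + move=> F mF tF FA; split; last first.
      by apply: integral_sum => // z _; rewrite mulr_ge0// ltW.
    rewrite -FA; apply/esym/cvg_lim => //.
    apply: (@measure_semi_sigma_additive _ _ _ (pushm mi)) => //.
    exact: bigcupT_measurable.
  + by rewrite preimage_set0 measure0.
  + move=> z Az; have [N NP] := loc z Az; exists N => k Nk q zq.
    have [SA h1 _ h3] := NP k Nk q zq; split => //.
    apply: (le_trans h1).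
    have mgS : measurable_fun (dyadic_cell k q) g by exact: (measurable_funS (measurable_open_Cn oA) SA mg).
    under eq_integral => w _ do rewrite (EFinM K').
    rewrite ge0_integralZl//=.
    - rewrite (EFinM K') lee_wpmul2l ?lee_fin ?(ltW K'0)//.
      by have /andP[] := pinch k q z SA h3.
    - exact/measurable_EFinP.
    - by move=> w _; rewrite lee_fin.
    - by rewrite lee_fin ltW.
- apply: (dyadic_comparison (nu := fun S => (K'%:E * m (aut_inv f @^-1` S))%E)
    (mu := fun S => (\int[m]_(z in S) (g z)%:E)%E)).
  + by move=> B; apply: integral_ge0 => z _; rewrite lee_fin.
  + by move=> B; apply: mule_ge0 => //; rewrite lee_fin ltW.
  + move=> F mF tF FA; split; first exact: integral_sum.
    rewrite nneseriesZl//; congr (_ * _)%E.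
    rewrite -FA; apply/esym/cvg_lim => //.
    apply: (@measure_semi_sigma_additive _ _ _ (pushm mi)) => //.
    exact: bigcupT_measurable.
  + by rewrite integral_set0.
  + move=> z Az; have [N NP] := loc z Az; exists N => k Nk q zq.
    have [SA _ h2 h3] := NP k Nk q zq; split => //.
    by apply: le_trans h2; have /andP[] := pinch k q z SA h3.
Qed.

End volume.

(** * Compactness of sets of automorphisms *)

Section automorphism_compactness.
Context {R : realType} {n : nat}.
Local Notation C := R[i].
Local Notation Cn := 'rV[C]_n.
Variable Omega : set Cn.
Hypothesis oO : open Omega.
Implicit Types (f g : Aut Omega) (z w : Cn).

Lemma bounded_nrm : bounded_set Omega ->
  exists2 M : R, 0 < M & forall z, Omega z -> nrm z <= M.
Proof.
move=> [M0 [M0r M0P]].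
exists (Num.max 0 (complex.Re M0) + 1).
  by rewrite ltr_wpDl// le_max lexx.
move=> z Oz; rewrite -lecR -nrmE; apply: M0P => //.
rewrite -(RRe_real M0r) ltcR; apply: (@le_lt_trans _ _ (Num.max 0 (complex.Re M0))).
  by rewrite le_max lexx orbT.
by rewrite ltrDl.
Qed.

(* An upper bound for the Caratheodory distance; every automorphism preserves
   it because it permutes the holomorphic functions bounded by 1. *)
Definition cara_le z w (s : R) : Prop := forall u : Cn -> C,
  holomorphic Omega u -> (forall x, Omega x -> nrm (u x) <= 1) -> nrm (u z - u w) <= s.

Lemma cara_sym z w s : cara_le z w s -> cara_le w z s.
Proof. by move=> zw u hu u1; rewrite nrmC; exact: zw. Qed.

Lemma cara_triangle y z w s t : cara_le z y s -> cara_le y w t -> cara_le z w (s + t).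
Proof.
move=> zy yw u hu u1; apply: (le_trans (nrm_triangle _ (u y) _)).
by apply: lerD; [exact: zy|exact: yw].
Qed.

Lemma cara_aut f z w s : cara_le z w s -> cara_le (f z) (f w) s.
Proof.
move=> zw u hu u1; apply: (zw (u \o f)) => [x Ox|x Ox].
  by apply: differentiable_comp; [exact: aut_hol|apply: hu; exact: aut_maps].
by apply: u1; exact: aut_maps.
Qed.

Lemma cara_aut_inv f z w s : cara_le z w s -> cara_le (aut_inv f z) (aut_inv f w) s.
Proof. exact: (@cara_aut (autV f)). Qed.

Lemma cara_upper z (r : R) w : 0 < r -> nball z r `<=` Omega ->
  nrm (w - z) <= r / 2 -> cara_le w z (16 / r * nrm (w - z)).
Proof.
move=> r0 rO wz u hu u1; have -> : 16 / r = 16 * 1 / r by rewrite mulr1.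
apply: (lipschitz_half r0) => // x /rO Ox; [exact: hu|exact: u1].
Qed.

Variable M : R.
Hypothesis M0 : 0 < M.
Hypothesis OM : forall z, Omega z -> nrm z <= M.

(** The coordinates divided by M serve as test functions. *)
Lemma cara_lower z w s : 0 <= s -> cara_le z w s -> nrm (z - w) <= M * s.
Proof.
move=> s0 zw; apply/nrm_row_le => [|j]; first by rewrite mulr_ge0// ltW.
have hc x : differentiable (fun y : Cn => y 0 j) x by exact: differentiable_coord.
have := zw (fun x => (M^-1)%:C * x 0 j) _ _; rewrite -mulrBr nrmM nrm_real.
rewrite ger0_norm ?invr_ge0 ?(ltW M0)// mulrC ler_pdivrMr// !mxE mulrC; apply.
  by move=> x _; exact: differentiable_cstM.
move=> x Ox; rewrite nrmM nrm_real ger0_norm ?invr_ge0 ?(ltW M0)//.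
by rewrite mulrC ler_pdivrMr// mul1r; apply: le_trans (nrm_coord _ _) (OM Ox).
Qed.

(** Equicontinuity of Aut(Omega): the constant depends on the distance of z to the boundary, but not
    on f. *)
Lemma aut_lipschitz f z (r : R) w : 0 < r -> nball z r `<=` Omega ->
  nrm (w - z) <= r / 2 -> nrm (f w - f z) <= M * (16 / r * nrm (w - z)).
Proof.
move=> r0 rO wz; apply: cara_lower.
  by rewrite mulr_ge0 ?nrm_ge0// divr_ge0// ltW.
by apply: cara_aut; exact: cara_upper.
Qed.

Lemma open_nballP z : Omega z -> exists2 r : R, 0 < r & nball z r `<=` Omega.
Proof.
move=> Oz; have : nbhs z Omega by exact: open_nbhs_nbhs.
by move=> /nbhs_nrmP[r r0 rP]; exists r.
Qed.

Lemma aut_cvg_moving T (F : set_system T) (FF : Filter F) (h : T -> Aut Omega)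
    (x : T -> Cn) (z p : Cn) : Omega z ->
  x @ F --> z -> (fun t => h t (x t) : Cn) @ F --> p -> (fun t => h t z : Cn) @ F --> p.
Proof.
move=> Oz xz hp; have [r r0 rO] := open_nballP Oz.
apply/cvg_nrmP => e e0; have e20 : 0 < e / 2 by rewrite divr_gt0.
have [K KE] : exists K, K = M * (16 / r) by exists (M * (16 / r)).
have K0 : 0 < K by rewrite KE mulr_gt0// divr_gt0.
have d0 : 0 < Num.min (r / 2) (e / 2 / K) by rewrite lt_min !divr_gt0.
have [H1 _] := @cvg_nrmP R _ _ F FF x z; have [H2 _] := @cvg_nrmP R _ _ F FF (fun t => h t (x t)) p.
apply: (@filterS _ F FF _ _ _ (filterI (H1 xz _ d0) (H2 hp _ e20))) => t [/= xt ht].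
move: xt; rewrite lt_min => /andP[/ltW x1].
rewrite ltr_pdivlMr// => x2.
have x3 : nrm (h t z - h t (x t)) <= nrm (x t - z) * K.
  by rewrite nrmC mulrC KE -mulrA; exact: aut_lipschitz.
apply: (le_lt_trans (nrm_triangle _ (h t (x t)) _)).
by move: x2 x3 ht; lra.
Qed.

(** As Omega is bounded, values at a point of Omega converge along any ultrafilter; the content is
    that the limit does not reach the boundary. *)
Definition lim_inside (F : set_system (Aut Omega)) z : Prop :=
  exists2 p : Cn, Omega p & (fun f => aut_fun f z : Cn) @ F --> p.

(** Let f(z') tend to p in Omega, and fix one f0 with f0(z') close to p. By invariance f0^-1(f(w))
    remains close to w for most f, hence in a compact ball inside Omega; applying f0 to its limit
    gives the limit of f(w). The radius depends only on z, not on z' or w. *)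
Lemma lim_inside_locally_constant (F : set_system (Aut Omega)) (FU : UltraFilter F) z :
  Omega z -> exists2 d : R, 0 < d & forall z' w, nrm (z' - z) < d -> nrm (w - z) < d ->
    lim_inside F z' -> lim_inside F w.
Proof.
move=> Oz; have [r r0 rO] := open_nballP Oz; have FF : Filter F by exact: filter_filter.
(* Four comparisons at cost s/3 will be chained, and M times 4s/3 is r/4; with |w - z| < r/2 this
   stays within 3r/4. The bound r s / 96 below makes 16/r times it equal to s/6. *)
pose s := 3 * r / (16 * M); have s0 : 0 < s by rewrite divr_gt0 ?mulr_gt0.
exists (Num.min (r / 2) (r * s / 96)); first by rewrite lt_min !divr_gt0// mulr_gt0.
have cz x : nrm (x - z) < Num.min (r / 2) (r * s / 96) -> cara_le x z (s / 6).
  rewrite lt_min => /andP[x1 x2] u hu u1.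
  apply: (le_trans (cara_upper r0 rO (ltW x1) hu u1)).
  apply: (@le_trans _ _ (16 / r * (r * s / 96))).
    by apply: ler_wpM2l (ltW x2); rewrite divr_ge0// ltW.
  by rewrite le_eqVlt; apply/orP; left; apply/eqP; field; rewrite gt_eqF.
move=> z' w z'z wz [p Op fp].
have wr : nrm (w - z) < r / 2 by move: wz; rewrite lt_min => /andP[].
have Ow : Omega w by apply: rO; rewrite /nball /=; apply: lt_trans wr _; move: r0; lra.
have cw : cara_le w z' (s / 3).
  have -> : s / 3 = s / 6 + s / 6 by field.
  by apply: (@cara_triangle z); [exact: cz|apply: cara_sym; exact: cz].
have [rp rp0 rpO] := open_nballP Op.
have fp' : F [set f : Aut Omega | cara_le (f z') p (s / 3)].
  have rp1 : 0 < 16 / rp by rewrite divr_gt0.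
  have d0 : 0 < Num.min (rp / 2) (s / 3 / (16 / rp)).
    by rewrite lt_min; apply/andP; split; apply: divr_gt0 => //; apply: divr_gt0.
  have [H _] := @cvg_nrmP R _ _ F FF (fun f : Aut Omega => f z' : Cn) p.
  apply: (@filterS _ F FF _ _ _ (H fp _ d0)) => f /=; rewrite lt_min => /andP[/ltW f1].
  rewrite ltr_pdivlMr ?divr_gt0// => /ltW f2 u hu u1.
  by apply: (le_trans (cara_upper rp0 rpO f1 hu u1)); rewrite mulrC.
have [f0 f0p] := @filter_ex _ F _ _ fp'.
(* The chain runs from f0^-1(f(w)) through f0^-1(f(z')), f0^-1(p) and z' to w. *)
have near0 : F [set f : Aut Omega | nrm (aut_inv f0 (f w) - z) <= 3 * r / 4].
  apply: (@filterS _ F FF _ _ _ fp') => f fz'.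
  have c1 : cara_le (f w) p (s / 3 + s / 3).
    by apply: (@cara_triangle (f z')) => //; exact: cara_aut.
  have c2 : cara_le (aut_inv f0 (f w)) z' (s / 3 + s / 3 + s / 3).
    apply: (@cara_triangle (aut_inv f0 p)); first exact: cara_aut_inv.
    apply: cara_sym; rewrite -[z'](aut_funK f0); exact: cara_aut_inv.
  have c3 : cara_le (aut_inv f0 (f w)) w (s / 3 + s / 3 + s / 3 + s / 3).
    by apply: cara_triangle c2 _; exact: cara_sym.
  have := cara_lower _ c3; have s30 : 0 <= s / 3 + s / 3 + s / 3 + s / 3.
    by move: s0; lra.
  move=> /(_ s30) h.
  have E : M * (s / 3 + s / 3 + s / 3 + s / 3) = r / 4.
    by rewrite /s; field; rewrite gt_eqF.
  rewrite E in h; apply: (le_trans (nrm_triangle _ w _)).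
  by move: h wr; move: (nrm _) (nrm _) => a b; lra.
have [y yz fy] := compact_ultra_cvg (x := fun f : Aut Omega => aut_inv f0 (f w) : Cn) FU
  (@compact_nrm_le R n z (3 * r / 4)) near0.
have Oy : Omega y.
  by apply: rO; rewrite /nball /=; apply: le_lt_trans yz _; move: r0; lra.
exists (f0 y); first exact: aut_maps.
have c0 : {for y, continuous f0} by apply: differentiable_continuous; exact: aut_hol.
have := cvg_comp _ _ fy c0; rewrite (_ : f0 \o _ = (fun f : Aut Omega => f w))//.
by apply/funext => f; rewrite /= aut_invK.
Qed.

Hypothesis cO : connected Omega.

(** [lim_inside_locally_constant] is symmetric in its two points, so [lim_inside] and its negation
    both define open subsets of Omega. *)
Lemma lim_inside_all (F : set_system (Aut Omega)) (FU : UltraFilter F) z0 :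
  Omega z0 -> lim_inside F z0 -> forall z, Omega z -> lim_inside F z.
Proof.
move=> Oz0 Fz0; suff E : [set z | Omega z /\ lim_inside F z] = Omega.
  by move=> z; rewrite -{1}E => -[].
have opn (P : Cn -> Prop) :
    (forall z, Omega z -> P z -> exists2 d : R, 0 < d & forall w, nrm (w - z) < d -> P w) ->
    open [set z | Omega z /\ P z].
  move=> Ploc; rewrite openE => z [Oz Pz]; have [d d0 dP] := Ploc z Oz Pz.
  have [r r0 rO] := open_nballP Oz.
  apply/nbhs_nrmP; exists (Num.min r d); first by rewrite lt_min r0.
  by move=> w; rewrite lt_min => /andP[/rO wr /dP].
apply: cO; first by exists z0.
  exists [set z | Omega z /\ lim_inside F z].
    apply: opn => z Oz Fz; have [d d0 dP] := lim_inside_locally_constant FU Oz.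
    by exists d => // w wz; apply: (dP z) => //; rewrite subrr nrm0.
  by apply/seteqP; split => z //= [].
exists (~` [set z | Omega z /\ ~ lim_inside F z]).
  apply: open_closedC; apply: opn => z Oz nFz.
  have [d d0 dP] := lim_inside_locally_constant FU Oz.
  exists d => // w wz Fw; apply: nFz; apply: (dP w) => //.
  by rewrite subrr nrm0.
apply/seteqP; split => z /=; first by move=> [Oz Fz]; split => // -[].
by move=> [Oz nFz]; split => //; apply: contrapT => h; apply: nFz.
Qed.

Lemma aut_limit_holomorphic (T : Type) (F : set_system T) (FU : UltraFilter F)
    (h : T -> Aut Omega) (phi : Cn -> Cn) :
  (forall z, Omega z -> (fun t => h t z) @ F --> phi z) -> holomorphic Omega phi.
Proof.
move=> hphi z Oz; have [r r0 rO] := open_nballP Oz.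
apply: differentiable_row => j.
have [||//] := @holomorphic_limit R Cn T F FU (fun t w => h t w 0 j) (fun w => phi w 0 j) z r M r0.
  apply: filterE => t w /rO Ow; split.
    by have [] := differentiable_coordinate j (aut_hol (h t) Ow).
  by apply: le_trans (nrm_coord _ _) _; apply: OM; exact: aut_maps.
move=> w /rO /hphi hw; apply/cvg_nrmP => e e0.
have [H _] := @cvg_nrmP R _ _ F _ (fun t => h t w) (phi w).
apply: filterS (H hw _ e0) => t; apply: le_lt_trans.
by have := nrm_coord (h t w - phi w) j; rewrite !mxE.
Qed.

(** The points x(f) and f(x(f)) have limits z0 and p in L. By equicontinuity f(z0) tends to p and
    f^-1(p) to z0, which starts the propagation of interior convergence for f and for its inverse.
    Equicontinuity also shows that the two limit maps are inverse to each other. *)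
Lemma ultra_aut_cvg (F : set_system (Aut Omega)) (FU : UltraFilter F) (L : set Cn)
    (x : Aut Omega -> Cn) : compact L -> L `<=` Omega ->
  F [set f : Aut Omega | L (x f) /\ L (f (x f))] -> exists Phi : Aut Omega, F --> Phi.
Proof.
move=> cL LO xL; have FF : Filter F by exact: filter_filter.
have [z0 Lz0 xz0] : exists2 z0, L z0 & x @ F --> z0.
  by apply: compact_ultra_cvg => //; apply: filterS xL => f [].
have [p Lp fxp] : exists2 p, L p & (fun f => f (x f)) @ F --> p.
  by apply: compact_ultra_cvg => //; apply: filterS xL => f [].
have fz0 : (fun f => f z0) @ F --> p.
  exact: (@aut_cvg_moving _ F _ id x z0 p (LO _ Lz0) xz0 fxp).
have inv_p : (fun f => aut_inv f p) @ F --> z0.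
  have E : (fun f => aut_inv f (f (x f))) = x.
    by apply/funext => f; rewrite aut_funK.
  have h : (fun f => aut_inv f (f (x f)) : Cn) @ F --> z0 by rewrite E.
  exact: (@aut_cvg_moving _ F FF (@autV R n Omega) (fun f => f (x f)) p z0 (LO _ Lp) fxp h).
have inF z : Omega z -> lim_inside F z.
  by apply: (lim_inside_all FU (LO _ Lz0)); exists p => //; exact: LO.
(* The inverses are themselves automorphisms, so the results above apply to them along the image
   ultrafilter. *)
pose F' := @autV R n Omega @ F.
have FU' : UltraFilter F' by exact: fmap_ultra.
have inF' z : Omega z -> lim_inside F' z.
  by apply: (lim_inside_all FU' (LO _ Lp)); exists z0; [exact: LO|exact: inv_p].
have /choice[phi phiP] : forall z, exists y, (Omega z -> Omega y /\ (fun f => f z) @ F --> y) /\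
    (~ Omega z -> y = z).
  move=> z; have [Oz|nOz] := pselect (Omega z).
    by have [y Oy Fy] := inF z Oz; exists y; split => // _; split.
  by exists z; split.
have /choice[psi psiP] : forall z, exists y,
    (Omega z -> Omega y /\ (fun f => aut_inv f z) @ F --> y) /\ (~ Omega z -> y = z).
  move=> z; have [Oz|nOz] := pselect (Omega z).
    by have [y Oy Fy] := inF' z Oz; exists y; split => // _; split.
  by exists z; split.
have phiO z : Omega z -> Omega (phi z) by move=> Oz; have [/(_ Oz)[]] := phiP z.
have psiO z : Omega z -> Omega (psi z) by move=> Oz; have [/(_ Oz)[]] := psiP z.
have phic z : Omega z -> (fun f => f z) @ F --> phi z.
  by move=> Oz; have [/(_ Oz)[]] := phiP z.
have psic z : Omega z -> (fun f => aut_inv f z) @ F --> psi z.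
  by move=> Oz; have [/(_ Oz)[]] := psiP z.
have hCn : hausdorff_space Cn by exact: norm_hausdorff.
have phiK : cancel phi psi.
  move=> z; have [Oz|nOz] := pselect (Omega z); last first.
    by have [_ /(_ nOz) ->] := phiP z; have [_ ->] := psiP z.
  have E : (fun f => aut_inv f (f z)) = cst z by apply/funext => f; rewrite aut_funK.
  have h' : (fun f => aut_inv f (f z) : Cn) @ F --> z by rewrite E; exact: cvg_cst.
  have h := @aut_cvg_moving _ F FF (@autV R n Omega) (fun f => f z) (phi z) z
    (phiO _ Oz) (phic _ Oz) h'.
  exact: (cvg_unique hCn (psic _ (phiO _ Oz)) h).
have psiK : cancel psi phi.
  move=> z; have [Oz|nOz] := pselect (Omega z); last first.
    by have [_ /(_ nOz) ->] := psiP z; have [_ ->] := phiP z.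
  have E : (fun f : Aut Omega => f (aut_inv f z)) = cst z.
    by apply/funext => f; rewrite aut_invK.
  have h' : (fun f : Aut Omega => f (aut_inv f z) : Cn) @ F --> z.
    by rewrite E; exact: cvg_cst.
  have h := @aut_cvg_moving _ F FF id (fun f => aut_inv f z) (psi z) z
    (psiO _ Oz) (psic _ Oz) h'.
  exact: (cvg_unique hCn (phic _ (psiO _ Oz)) h).
have phih : holomorphic Omega phi := aut_limit_holomorphic FU phic.
have psih : holomorphic Omega psi := @aut_limit_holomorphic _ F FU (@autV R n Omega) psi psic.
exists (MkAut phih psih phiO psiO phiK psiK (fun z => (phiP z).2)).
(* Neighbourhoods in [Aut Omega] are pulled back from the compact-open topology by restriction to
   Omega. *)
move=> A /= [_ [[B oB <-] /= Bphi sBA]].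
apply: (@filterS _ F FF _ _ sBA).
suff : (fun f : Aut Omega => (aut_fun f \o set_val : {compact-open, Omega -> Cn})) @ F -->
    (phi \o set_val : {compact-open, Omega -> Cn}).
  by apply; exact: open_nbhs_nbhs.
apply/compact_open_cvgP => K O cK oOO phiKO.
(* Pointwise convergence and the Lipschitz bound give convergence uniform near each point;
   compactness of K makes it uniform on K. *)
have Fcov : forall y : Omega, K y ->
    \forall x' \near y & f \near F, (fun (f : Aut Omega) (x : Omega) => O (f (set_val x))) f x'.
  move=> v Kx; have Ox : Omega (set_val v) by exact: set_valP.
  have [r r0 rO] := open_nballP Ox.
  have Op : O (phi (set_val v)) by apply: phiKO; exists v.
  have /nbhs_nrmP[e e0 eO] : nbhs (phi (set_val v)) O by exact: open_nbhs_nbhs.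
  have e20 : 0 < e / 2 by rewrite divr_gt0.
  have [k kE] : exists k, k = M * (16 / r) by exists (M * (16 / r)).
  have k0 : 0 < k by rewrite kE mulr_gt0// divr_gt0.
  pose d := Num.min (r / 2) (e / 2 / k).
  have d0 : 0 < d by rewrite lt_min !divr_gt0.
  exists ([set x' | nrm (set_val x' - set_val v) < d],
          [set f : Aut Omega | nrm (f (set_val v) - phi (set_val v)) < e / 2]) => /=.
    split.
      have : nbhs (set_val v) [set y | nrm (y - set_val v) < d] by apply/nbhs_nrmP; exists d.
      exact: (@initial_continuous _ _ (set_val : Omega -> Cn) v).
    have [H _] := @cvg_nrmP R _ _ F FF (fun f : Aut Omega => f (set_val v) : Cn) (phi (set_val v)).
    exact: (H (phic _ Ox) _ e20).
  move=> [x' f] [/= x'x fx]; apply: eO.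
  move: x'x; rewrite lt_min => /andP[/ltW x1]; rewrite ltr_pdivlMr// => x2.
  have x3 : nrm (f (set_val x') - f (set_val v)) <= nrm (set_val x' - set_val v) * k.
    by rewrite mulrC kE -mulrA; exact: aut_lipschitz.
  apply: (le_lt_trans (nrm_triangle _ (f (set_val v)) _)).
  by move: x2 x3 fx; lra.
have /compact_near_coveringP/(_ (Aut Omega) F _ FF Fcov) KF := cK.
by apply: (@filterS _ F FF _ _ _ KF) => f fK _ [y Ky <-]; exact: fK.
Qed.

Lemma compact_aut_subset (G : set (Aut Omega)) (L : set Cn) : closed G ->
  compact L -> L `<=` Omega -> (forall f, G f -> exists2 z, L z & L (f z)) -> compact G.
Proof.
move=> clG cL LO GL; rewrite compact_ultra => F FU FG.
have /choice[x xP] : forall f, exists z, G f -> L z /\ L (f z).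
  move=> f; have [Gf|nGf] := pselect (G f); last by exists 0.
  by have [z Lz Lfz] := GL f Gf; exists z.
have [Phi FPhi] : exists Phi : Aut Omega, F --> Phi.
  by apply: (@ultra_aut_cvg F FU L x) => //; apply: filterS FG => f /xP.
exists Phi; split => //; apply: clG => B PB.
by apply: (@filter_ex _ F); apply: filterI => //; exact: FPhi.
Qed.

End automorphism_compactness.

(** * The restriction operator *)

Section weak_estimate.
Context d (T : measurableType d) (R : realType) (mu : {measure set T -> \bar R}).
Implicit Types (D V : set T) (p h : T -> R).

Lemma integrable_comb3 D (a b c : R) p1 p2 p3 : measurable D ->
  mu.-integrable D (EFin \o p1) -> mu.-integrable D (EFin \o p2) ->
  mu.-integrable D (EFin \o p3) ->
  mu.-integrable D (EFin \o (fun x => a * p1 x + (b * p2 x + c * p3 x))) /\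
  \int[mu]_(x in D) (a * p1 x + (b * p2 x + c * p3 x)) =
  a * \int[mu]_(x in D) p1 x + (b * \int[mu]_(x in D) p2 x + c * \int[mu]_(x in D) p3 x).
Proof.
move=> mD i1 i2 i3.
have Z k p : mu.-integrable D (EFin \o p) -> mu.-integrable D (EFin \o (fun x => k * p x)).
  by move=> ip; exact: (integrableZl mD k ip).
have i23 : mu.-integrable D (EFin \o (fun x => b * p2 x + c * p3 x)).
  exact: (integrableD mD (Z b _ i2) (Z c _ i3)).
split; first exact: (integrableD mD (Z a _ i1) i23).
rewrite (RintegralD mD (Z a _ i1) i23) (RintegralD mD (Z b _ i2) (Z c _ i3)).
by rewrite (RintegralZl _ mD i1) (RintegralZl _ mD i2) (RintegralZl _ mD i3).
Qed.

Lemma Rintegral_setD D V p : measurable D -> measurable V -> V `<=` D ->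
  mu.-integrable D (EFin \o p) ->
  \int[mu]_(x in D) p x = \int[mu]_(x in V) p x + \int[mu]_(x in D `\` V) p x.
Proof.
move=> mD mV VD ip; rewrite -Rintegral_setU ?setDUK//.
- exact: measurableD.
- by apply/disj_setPS => x [? []].
Qed.

Lemma amgm_mul (e j u : R) : 0 < e -> 0 <= j -> 0 <= u ->
  j * u <= e * j ^+ 2 + e^-1 * u ^+ 2.
Proof.
move=> e0 j0 u0; have k0 : 0 < e^-1 by rewrite invr_gt0.
have ek : e * e^-1 = 1 by rewrite divff// gt_eqF.
move: (e^-1) k0 ek => k k0 ek; rewrite -subr_ge0.
have -> : e * j ^+ 2 + k * u ^+ 2 - j * u =
    (e * j ^+ 2 + k * u ^+ 2) / 2 + e / 2 * (j - k * u) ^+ 2 -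
    (e * k - 1) * (k * u ^+ 2 / 2) + (e * k - 1) * (j * u).
  by field.
rewrite ek subrr !mul0r subr0 addr0 addr_ge0//.
  by rewrite divr_ge0// addr_ge0// mulr_ge0 ?sqr_ge0 ?ltW.
by rewrite mulr_ge0 ?sqr_ge0// divr_ge0// ltW.
Qed.

(* The role of weak convergence: if j is bounded in L^2 and small in L^2(V),
   with V filling most of D, then the pairing of j with g is small; u is the
   distance to g of the function paired with j. *)
Lemma Rintegral_split_le D V (h j g u : T -> R) (e : R) :
  measurable D -> measurable V -> V `<=` D -> 0 < e ->
  mu.-integrable D (EFin \o h) ->
  mu.-integrable D (EFin \o (fun x => j x ^+ 2)) ->
  mu.-integrable D (EFin \o (fun x => g x ^+ 2)) ->
  mu.-integrable D (EFin \o (fun x => u x ^+ 2)) ->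
  (forall x, D x -> [/\ 0 <= j x, 0 <= g x, 0 <= u x & h x <= j x * (u x + g x)]) ->
  \int[mu]_(x in D) h x <=
    2 * e * \int[mu]_(x in D) j x ^+ 2 + e * \int[mu]_(x in D) g x ^+ 2 +
    e^-1 * (\int[mu]_(x in D) u x ^+ 2 + \int[mu]_(x in V) j x ^+ 2 +
            \int[mu]_(x in D `\` V) g x ^+ 2).
Proof.
move=> mD mV VD e0 ih ij ig iu hle; have k0 : 0 < e^-1 by rewrite invr_gt0.
have mE : measurable (D `\` V) by exact: measurableD.
have ED : D `\` V `<=` D by move=> x [].
have iV p := integrableS mD mV VD (mu := mu) (f := EFin \o p).
have iE p := integrableS mD mE ED (mu := mu) (f := EFin \o p).
rewrite !(Rintegral_setD mD mV VD)//.
(* On V, where j is small, j g is split with weight 1/e on j^2 and e on g^2; off V, where g is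
   small, the weights are exchanged. The product j u has weight 1/e on u^2 everywhere. *)
have [iV3 EV3] := integrable_comb3 (e + e^-1) e (e^-1) mV (iV _ ij) (iV _ ig) (iV _ iu).
have [iE3 EE3] := integrable_comb3 (2 * e) (e^-1) (e^-1) mE (iE _ ij) (iE _ ig) (iE _ iu).
have hV := le_Rintegral mV (iV _ ih) iV3 _.
have hE := le_Rintegral mE (iE _ ih) iE3 _.
have h1 : \int[mu]_(x in V) h x <= (e + e^-1) * \int[mu]_(x in V) j x ^+ 2 +
    (e * \int[mu]_(x in V) g x ^+ 2 + e^-1 * \int[mu]_(x in V) u x ^+ 2).
  rewrite -EV3; apply: hV; move=> x Vx; have [j0 g0 u0 /le_trans] := hle x (VD x Vx).
  apply; have := amgm_mul e0 j0 u0; have := amgm_mul k0 j0 g0.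
  by rewrite invrK; lra.
have h2 : \int[mu]_(x in D `\` V) h x <= 2 * e * \int[mu]_(x in D `\` V) j x ^+ 2 +
    (e^-1 * \int[mu]_(x in D `\` V) g x ^+ 2 + e^-1 * \int[mu]_(x in D `\` V) u x ^+ 2).
  rewrite -EE3; apply: hE => x Ex; have [j0 g0 u0 /le_trans] := hle x (ED x Ex).
  apply; have := amgm_mul e0 j0 u0; have := amgm_mul e0 j0 g0; lra.
have ge0 A p : 0 <= \int[mu]_(x in A) p x ^+ 2.
  by apply: Rintegral_ge0 => x _; exact: sqr_ge0.
move: h1 h2 (mulr_ge0 (ltW e0) (ge0 V j)) (mulr_ge0 (ltW e0) (ge0 (D `\` V) g)).
move: (e^-1) k0 => k k0 h1 h2 h3 h4; lra.
Qed.

(** Monotone convergence of the integrals over [F k], with a finite limit by integrability. *)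
Lemma Rintegral_exhaustion (D : set T) (F : (set T)^nat) p (e : R) :
  measurable D -> (forall k, measurable (F k)) ->
  {homo F : k l / (k <= l)%N >-> k `<=` l} -> \bigcup_k F k = D ->
  (forall x, D x -> 0 <= p x) -> mu.-integrable D (EFin \o p) -> 0 < e ->
  exists N, forall k, (N <= k)%N -> \int[mu]_(x in D `\` F k) p x < e.
Proof.
move=> mD mF ndF FD p0 ip e0.
have FkD k : F k `<=` D by rewrite -FD => x Fx; exists k.
have iF k := integrableS mD (mF k) (FkD k) ip.
have ndF' : {homo F : k l / (k <= l)%N >-> (k <= l)%O}.
  by move=> k l kl; apply/subsetPset; exact: ndF.
have mp k : measurable_fun (F k) (EFin \o p) by have /integrableP[] := iF k.
have p0' k x : F k x -> (0 <= (EFin \o p) x)%E by move=> /FkD Dx; rewrite lee_fin p0.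
have h := ge0_nondecreasing_set_cvg_integral (mu := mu) ndF' mF mp p0'.
rewrite FD in h.
have fD : (\int[mu]_(x in D) (p x)%:E)%E \is a fin_num by exact: integrable_fin_num.
rewrite -(fineK fD) in h; move/fine_cvg: h => /cvgrPdist_lt/(_ _ e0)[N _ NP].
exists N => k /NP /=; rewrite -/(Rintegral mu D p) -/(Rintegral mu (F k) p).
rewrite (Rintegral_setD mD (mF k) (FkD k) ip) addrAC subrr add0r ger0_norm//.
by apply: Rintegral_ge0 => x [Dx _]; exact: p0.
Qed.

End weak_estimate.

(** * Exhaustion of a bounded open set by compact sets *)

Section exhaustion.
Context {R : realType} {n : nat}.
Local Notation C := R[i].
Local Notation Cn := 'rV[C]_n.
Variable Omega : set Cn.

(** These sets are compact when Omega is bounded; their interiors still exhaust Omega and are open,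
    as the volume estimates require. *)
Definition inner_set (k : nat) : set Cn :=
  [set z | nball z ((2 ^+ k)^-1) `<=` Omega].

Let s_gt0 k : 0 < (2 ^+ k)^-1 :> R.
Proof. by rewrite invr_gt0 exprn_gt0. Qed.

Lemma inner_set_sub k : inner_set k `<=` Omega.
Proof. by move=> z; apply; rewrite /nball /= subrr nrm0. Qed.

Lemma inner_set_compact (M : R) k : (forall z, Omega z -> nrm z <= M) ->
  compact (inner_set k).
Proof.
move=> OM; apply: (subclosed_compact _ (@compact_nrm_le R n 0 M)); last first.
  by move=> z /inner_set_sub/OM; rewrite /= subr0.
rewrite -[inner_set k]setCK; apply: open_closedC; rewrite openE => z /= nz.
have [w zw Ow] : exists2 w, nball z ((2 ^+ k)^-1) w & ~ Omega w.
  apply: contrapT => h; apply: nz => w zw; apply: contrapT => Ow.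
  by apply: h; exists w.
apply/nbhs_nrmP; exists ((2 ^+ k)^-1 - nrm (w - z)); first by rewrite subr_gt0.
move=> x xz /(_ w) h; apply: Ow; apply: h; rewrite /nball /=.
apply: (le_lt_trans (nrm_triangle _ z _)); rewrite (nrmC z).
by move: xz; rewrite ltrBrDl.
Qed.

Lemma interior_inner_set_mono k l : (k <= l)%N ->
  (inner_set k)^° `<=` (inner_set l)^°.
Proof.
move=> kl; apply: interiorS => z zO w wz; apply: zO; rewrite /nball /=.
by apply: lt_le_trans wz _; rewrite lef_pV2 ?posrE ?exprn_gt0// ler_eXn2l ?ltr1n.
Qed.

Lemma bigcup_interior_inner_set : open Omega -> \bigcup_k (inner_set k)^° = Omega.
Proof.
move=> oO; apply/seteqP; split => [z [k _ /interior_subset]|z Oz].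
  exact: inner_set_sub.
have /nbhs_nrmP[r r0 rO] : nbhs z Omega by exact: open_nbhs_nbhs.
have r20 : 0 < r / 2 by rewrite divr_gt0.
have [N NP] := dyadic_small r20; exists N => //.
apply/nbhs_nrmP; exists (r / 2) => // w wz x xw; apply: rO => /=.
apply: (le_lt_trans (nrm_triangle _ w _)); have := NP N (leqnn N).
by move: xw wz; rewrite /nball /=; move: (_^-1) (nrm _) (nrm _) => a b c; lra.
Qed.

End exhaustion.

Section bergman_jacobian.
Context {R : realType} {n : nat}.
Local Notation C := R[i].
Local Notation Cn := 'rV[C]_n.
Local Notation m := (@mCn R n).

Lemma mCn_bounded (A : set Cn) (M : R) : measurable A -> 0 < M ->
  (forall z, A z -> nrm z <= M) -> (m A < +oo)%E.
Proof.
move=> mA M0 AM; apply: (@le_lt_trans _ _ (m (nball 0 (2 * M)))).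
  apply: le_measure; rewrite ?inE//; first exact: measurable_nball.
  by move=> z /AM zM; rewrite /nball /= subr0; apply: le_lt_trans zM _; lra.
by rewrite -ge0_fin_numE//; apply: mCn_nball_fin; rewrite mulr_gt0.
Qed.

Lemma integral_mCn (W : set Cn) (g : Cn -> R) : measurable W ->
  measurable_fun W g -> (forall z, W z -> 0 <= g z) ->
  (\int[m]_(z in W) (g z)%:E =
   \int[lebesgueR2n R n]_(t in @toCn R n @^-1` W) (g (toCn t))%:E)%E.
Proof.
move=> mW mg g0.
have mg' : measurable_fun W (fun z => (g z)%:E) by exact/measurable_EFinP.
have g0' : {in W, forall z, (0 <= (g z)%:E)%E} by move=> z /set_mem/g0; rewrite lee_fin.
exact: (ge0_integral_pushforward (@measurable_toCn R n) (lebesgueR2n R n) mW mg' g0').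
Qed.

Variable Omega : set Cn.
Hypothesis oO : open Omega.

Lemma Jac_continuous (f : Aut Omega) z : Omega z -> {for z, continuous (Jac f)}.
Proof.
by move=> Oz; apply: differentiable_continuous; exact: (Jac_holomorphic oO (aut_hol f)).
Qed.

Lemma measurable_Jac_sqr (f : Aut Omega) : measurable_fun Omega (fun z => nrm (Jac f z) ^+ 2).
Proof.
apply: measurable_funX; apply: measurable_nrm_holomorphic => // z Oz.
exact: Jac_continuous.
Qed.

Variable M : R.
Hypothesis M0 : 0 < M.
Hypothesis OM : forall z, Omega z -> nrm z <= M.

Lemma mCn_Omega_fin (A : set Cn) : measurable A -> A `<=` Omega -> m A \is a fin_num.
Proof.
by move=> mA AO; rewrite ge0_fin_numE//; apply: (mCn_bounded mA M0) => z /AO/OM.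
Qed.

Lemma aut_preim_open (f : Aut Omega) (A : set Cn) : open A -> A `<=` Omega ->
  measurable (aut_inv f @^-1` A).
Proof.
move=> oA AO; rewrite -[X in measurable X]setTI.
apply: (measurable_aut oO (aut_inv_hol f)) => //; first exact: aut_inv_out.
exact: measurable_open_Cn.
Qed.

Lemma aut_preim_sub (f : Aut Omega) (A : set Cn) : A `<=` Omega ->
  aut_inv f @^-1` A `<=` Omega.
Proof. by move=> AO z /AO/(@aut_maps _ _ _ f); rewrite aut_invK. Qed.

(** J is the Jacobian determinant, set to 0 off Omega. It is square integrable because the integral
    of its square is controlled by the volume of f(Omega), contained in the bounded set Omega. *)
Lemma bergman_Jac : exists2 K : R, 0 < K & forall f : Aut Omega,
  exists J : Bergman Omega, forall A : set Cn, open A -> A `<=` Omega ->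
    fine (m (aut_inv f @^-1` A)) <= K * Cn_integral A (fun z => Normc.normc (J z) ^+ 2) /\
    Cn_integral A (fun z => Normc.normc (J z) ^+ 2) <= K * fine (m (aut_inv f @^-1` A)).
Proof.
have [K K0 KP] := @aut_volume R n; exists K => // f.
pose j := patch (fun=> 0) Omega (Jac f).
have jE z : Omega z -> j z = Jac f z by move=> Oz; rewrite /j patchT// mem_set.
have fin A : open A -> A `<=` Omega -> (\int[m]_(z in A) (nrm (Jac f z) ^+ 2)%:E < +oo)%E.
  move=> oA AO; have [_ h] := KP Omega oO f A oA AO; apply: (le_lt_trans h).
  have := mCn_Omega_fin (aut_preim_open f oA AO) (aut_preim_sub AO).
  by move=> /fineK <-; rewrite -EFinM ltry.
have mJ A : open A -> A `<=` Omega -> measurable_fun A (fun z => nrm (Jac f z) ^+ 2).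
  move=> oA AO; apply: measurable_funS (measurable_Jac_sqr f) => //.
  exact: measurable_open_Cn.
have E A : open A -> A `<=` Omega ->
    (\int[lebesgueR2n R n]_(t in @toCn R n @^-1` A) (Normc.normc (j (toCn t)) ^+ 2)%:E =
     \int[m]_(z in A) (nrm (Jac f z) ^+ 2)%:E)%E.
  move=> oA AO; rewrite integral_mCn.
  - by apply: eq_integral => t /set_mem At; rewrite jE ?nrm_normc//; exact: AO.
  - exact: measurable_open_Cn.
  - exact: mJ.
  - by move=> z _; exact: sqr_ge0.
have jh : holomorphic Omega j.
  move=> z Oz; apply: (@near_eq_differentiable _ _ _ (Jac f)).
    have : nbhs z Omega by exact: open_nbhs_nbhs.
    by apply: filterS => x /jE ->.
  exact: (Jac_holomorphic oO (aut_hol f)).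
have ji : Cn_integrable Omega (fun z => Normc.normc (j z) ^+ 2).
  apply/integrableP; split.
    have h : measurable_fun (@toCn R n @^-1` Omega) (fun t => nrm (Jac f (toCn t)) ^+ 2).
      apply: (measurable_comp (F := Omega) _ _ (measurable_Jac_sqr f)).
      - exact: measurable_open_Cn.
      - by move=> _ [t Ot <-].
      - by apply: measurable_funS (@measurable_toCn R n).
    apply/measurable_EFinP; apply: eq_measurable_fun h => t /set_mem Ot.
    by rewrite jE ?nrm_normc.
  rewrite (eq_integral (fun t => (Normc.normc (j (toCn t)) ^+ 2)%:E)); last first.
    by move=> t _ /=; rewrite ger0_norm ?sqr_ge0.
  by rewrite E//; exact: fin.
have jo z : ~ Omega z -> j z = 0 by move=> Oz; rewrite /j patchN// notin_setE.
exists (MkBergman jh ji jo) => A oA AO /=.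
have pf := mCn_Omega_fin (aut_preim_open f oA AO) (aut_preim_sub AO).
have If : (\int[m]_(z in A) (nrm (Jac f z) ^+ 2)%:E)%E \is a fin_num.
  rewrite ge0_fin_numE; first exact: fin.
  by apply: integral_ge0 => z _; rewrite lee_fin sqr_ge0.
rewrite /Cn_integral /Rintegral E//.
have [h1 h2] := KP Omega oO f A oA AO.
have {}h1 : (m (aut_inv f @^-1` A) <= K%:E * \int[m]_(z in A) (nrm (Jac f z) ^+ 2)%:E)%E.
  apply: (le_trans h1); rewrite -ge0_integralZl ?lee_fin ?(ltW K0)//.
  - exact: measurable_open_Cn.
  - by apply/measurable_EFinP; exact: mJ.
  - by move=> z _; rewrite lee_fin sqr_ge0.
move: h1 h2; rewrite -(fineK If) -(fineK pf) -!EFinM !lee_fin /= => h1 h2.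
by split.
Qed.

End bergman_jacobian.

Section bergman_pairing.
Context {R : realType} {n : nat}.
Local Notation C := R[i].
Local Notation Cn := 'rV[C]_n.
Local Notation lam := (lebesgueR2n R n).
Local Notation pre W := (@toCn R n @^-1` W).
Implicit Types (a b : C) (W V : set Cn) (f g : Cn -> C).

(** Polarization reduces the measurability of a pairing to that of norms of holomorphic
    functions. *)
Lemma Re_mul_conj a b : complex.Re (a * b^*) = (nrm (a + b) ^+ 2 - nrm (a - b) ^+ 2) / 4.
Proof. by rewrite !sqr_nrm; case: a b => [x y] [u v] /=; field. Qed.

Lemma nrm_conj b : nrm b^* = nrm b.
Proof. by rewrite !nrm_normc; case: b => x y /=; rewrite sqrrN. Qed.

Lemma Re_mul_conj_le a b c : complex.Re (a * b^*) <= nrm a * (nrm (b - c) + nrm c).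
Proof.
apply: (le_trans (ler_norm _)); apply: (le_trans (Re_le_nrm _)).
rewrite nrmM nrm_conj ler_wpM2l ?nrm_ge0//.
by have := nrmD (b - c) c; rewrite subrK.
Qed.

Lemma measurable_nrm_toCn W f : open W -> holomorphic W f ->
  measurable_fun (pre W) (fun t => nrm (f (toCn t))).
Proof.
move=> oW hf; have mf : measurable_fun W (fun z => nrm (f z)).
  by apply: measurable_nrm_holomorphic => // z Wz; apply: differentiable_continuous; exact: hf.
apply: (measurable_comp (F := W) _ _ mf).
- exact: measurable_open_Cn.
- by move=> _ [t Ot <-].
- by apply: measurable_funS (@measurable_toCn R n).
Qed.

Lemma integrable_le_sqr W (h : _ -> R) f g (c : R) : open W -> holomorphic W f -> holomorphic W g ->
  Cn_integrable W (fun z => Normc.normc (f z) ^+ 2) ->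
  Cn_integrable W (fun z => Normc.normc (g z) ^+ 2) ->
  measurable_fun (pre W) h ->
  (forall t, pre W t -> `|h t| <= c * (nrm (f (toCn t)) ^+ 2 + nrm (g (toCn t)) ^+ 2)) ->
  lam.-integrable (pre W) (EFin \o h).
Proof.
move=> oW hf hg iF iG mh hle; have mW := measurable_toCn_open oW.
apply: (@le_integrable _ _ _ _ _ mW _
    (EFin \o (fun t => c * Normc.normc (f (toCn t)) ^+ 2 +
      (c * Normc.normc (g (toCn t)) ^+ 2 + 0 * Normc.normc (g (toCn t)) ^+ 2)))).
- exact/measurable_EFinP.
- move=> t Wt; rewrite lee_fin mul0r addr0 -mulrDr -!nrm_normc.
  by apply: (le_trans (hle t Wt)); exact: ler_norm.
- by have [] := @integrable_comb3 _ _ R lam (pre W) c c 0 _ _ _ mW iF iG iG.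
Qed.

Lemma L2inner_Re_le W (J T g : Bergman W) V (e : R) : open W -> open V -> V `<=` W -> 0 < e ->
  complex.Re (L2inner W J T) <=
    2 * e * Cn_integral W (fun z => Normc.normc (J z) ^+ 2) +
    e * Cn_integral W (fun z => Normc.normc (g z) ^+ 2) +
    e^-1 * (Cn_integral W (fun z => Normc.normc (T z - g z) ^+ 2) +
            Cn_integral V (fun z => Normc.normc (J z) ^+ 2) +
            \int[lam]_(t in pre W `\` pre V) (Normc.normc (g (toCn t)) ^+ 2)).
Proof.
move=> oW oV VW e0; have mW := measurable_toCn_open oW; have mV := measurable_toCn_open oV.
have hJ := berg_hol J; have hT := berg_hol T; have hg := berg_hol g.
have hB f f' : holomorphic W f -> holomorphic W f' -> holomorphic W (fun z => f z - f' z).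
  by move=> hf hf' z Wz; apply: differentiableB; [exact: hf|exact: hf'].
have hD f f' : holomorphic W f -> holomorphic W f' -> holomorphic W (fun z => f z + f' z).
  by move=> hf hf' z Wz; apply: differentiableD; [exact: hf|exact: hf'].
have ineq (a b : C) : nrm (a - b) ^+ 2 <= 2 * (nrm a ^+ 2 + nrm b ^+ 2).
  rewrite !sqr_nrm; case: a b => [x y] [u v] /=; rewrite -subr_ge0.
  have := sqr_ge0 (x + u); have := sqr_ge0 (y + v); nra.
have ineq2 (a b : C) : `|complex.Re (a * b^*)| <= 2 * (nrm a ^+ 2 + nrm b ^+ 2).
  have := Re_le_nrm (a * b^*); rewrite nrmM nrm_conj => /le_trans; apply.
  have := sqr_ge0 (nrm a - nrm b); have := sqr_ge0 (nrm a); have := sqr_ge0 (nrm b); nra.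
have iu : lam.-integrable (pre W) (EFin \o (fun t => Normc.normc (T (toCn t) - g (toCn t)) ^+ 2)).
  apply: (integrable_le_sqr oW hT hg (berg_sqint T) (berg_sqint g) (c := 2)).
    apply: measurable_funX.
    apply: eq_measurable_fun (measurable_nrm_toCn oW (hB _ _ hT hg)) => t _.
    by rewrite nrm_normc.
  by move=> t _; rewrite ger0_norm ?sqr_ge0// -nrm_normc.
have ih : lam.-integrable (pre W)
    (EFin \o (fun t => complex.Re (J (toCn t) * (T (toCn t))^*))).
  apply: (integrable_le_sqr oW hJ hT (berg_sqint J) (berg_sqint T) (c := 2)) => //.
  have mS := measurable_funX 2 (measurable_nrm_toCn oW (hD _ _ hJ hT)).
  have mB := measurable_funX 2 (measurable_nrm_toCn oW (hB _ _ hJ hT)).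
  have mZ : measurable_fun (pre W) (cst (4^-1) : _ -> R) by exact: measurable_cst.
  apply: eq_measurable_fun (measurable_funM (measurable_funB mS mB) mZ) => t _.
  by rewrite Re_mul_conj.
have iJ := berg_sqint J; have ig := berg_sqint g.
apply: (Rintegral_split_le mW mV _ e0 ih iJ ig iu); first by move=> t; exact: VW.
by move=> t _; rewrite -!nrm_normc !nrm_ge0; split => //; exact: Re_mul_conj_le.
Qed.

End bergman_pairing.

(** * Non-compactness of the operator *)

Section noncompactness.
Context {R : realType} {n : nat}.
Local Notation C := R[i].
Local Notation Cn := 'rV[C]_n.
Local Notation m := (@mCn R n).
Local Notation lam := (lebesgueR2n R n).
Local Notation pre W := (@toCn R n @^-1` W).
Variables (Omega U : set Cn).
Hypotheses (oO : open Omega) (oU : open U) (UO : U `<=` Omega).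

(** The reverse inclusion is the hypothesis on U for the inverse of f, which is again in G. *)
Lemma subgroup_preim (G : set (Aut Omega)) (f : Aut Omega) : subgroup G ->
  (forall f : Aut Omega, G f -> f @` U `<=` U) -> G f -> aut_inv f @^-1` U = U.
Proof.
move=> [_ _ GV] GU Gf; apply/seteqP; split => z /= Uz.
  by rewrite -[z](aut_invK f); apply: (GU f Gf); exists (aut_inv f z).
by apply: (GU _ (GV _ Gf)); exists z.
Qed.

Lemma fine_mCn_le (A B : set Cn) : measurable A -> measurable B -> A `<=` B ->
  m B \is a fin_num -> fine (m A) <= fine (m B).
Proof.
move=> mA mB AB fB; have AB' : (m A <= m B)%E by apply: le_measure; rewrite ?inE.
rewrite fine_le// ge0_fin_numE//; apply: (le_lt_trans AB').
by rewrite -ge0_fin_numE.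
Qed.

Lemma L2inner_restr (J : Bergman Omega) :
  complex.Re (L2inner U (berg_restr oO oU UO J) (berg_restr oO oU UO J)) =
  Cn_integral U (fun z => Normc.normc (J z) ^+ 2).
Proof.
rewrite /L2inner /=; apply: eq_Rintegral => t /set_mem Ut.
rewrite patchT ?mem_set//= Re_mul_conj subrr nrm0 expr0n subr0 -nrm_normc.
by rewrite !sqr_nrm; case: (J (toCn t)) => x y /=; field.
Qed.

Lemma Cn_integral_sqr_ge0 (W : set Cn) (f : Cn -> C) :
  0 <= Cn_integral W (fun z => Normc.normc (f z) ^+ 2).
Proof. by apply: Rintegral_ge0 => t _; exact: sqr_ge0. Qed.

Lemma L2norm_sqr (W : set Cn) (f : Cn -> C) :
  L2norm W f ^+ 2 = Cn_integral W (fun z => Normc.normc (f z) ^+ 2).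
Proof. by rewrite /L2norm sqr_sqrtr// Cn_integral_sqr_ge0. Qed.

End noncompactness.

Theorem theorem5 (R : realType) (n : nat) (Omega U : set 'rV[R[i]]_n)
    (Omega_open : open Omega) (Omega_connected : connected Omega)
    (Omega_bounded : bounded_set Omega)
    (Omega_smooth : smooth_boundary Omega)
    (Omega_psc : pseudoconvex Omega)
    (U_neq0 : U !=set0) (U_open : open U) (U_sub : U `<=` Omega)
    (G : set (Aut Omega))
    (G_subgroup : subgroup G) (G_closed : closed G) (G_noncompact : ~ compact G)
    (G_U : forall f : Aut Omega, G f -> f @` U `<=` U)
    (RU_adj : Bergman U -> Bergman Omega)
    (RU_adjP : is_adjoint (berg_restr Omega_open U_open U_sub) RU_adj) :
  ~ compact_operator (RU_adj \o berg_restr Omega_open U_open U_sub).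
Proof.
pose m := @mCn R n; pose lam := lebesgueR2n R n.
have mO := measurable_open_Cn Omega_open.
have mD := measurable_toCn_open Omega_open.
have [M M0 OM] := bounded_nrm Omega_bounded.
have mfin := mCn_Omega_fin M0 OM.
pose V k := (inner_set Omega k)^°.
have oV k : open (V k) by exact: open_interior.
have VE k : V k `<=` inner_set Omega k by exact: interior_subset.
have VO k : V k `<=` Omega by move=> z /VE/inner_set_sub.
have /choice[F FP] : forall k, exists f : Aut Omega,
    G f /\ forall z, inner_set Omega k z -> ~ inner_set Omega k (f z).
  move=> k; apply: contrapT => nF; apply: G_noncompact.
  apply: (compact_aut_subset Omega_open M0 OM Omega_connected G_closed
    (inner_set_compact OM) (@inner_set_sub _ _ _ k)) => f Gf.
  apply: contrapT => nz; apply: nF; exists f; split => // z Ez Efz.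
  by apply: nz; exists z.
have [K K0 KP] := bergman_Jac Omega_open M0 OM.
have /choice[J JP] := fun k => KP (F k).
have mU0 : 0 < fine (m U).
  have [z Uz] := U_neq0.
  have /nbhs_nrmP[r r0 rU] : nbhs z U by exact: open_nbhs_nbhs.
  have := fine_mCn_le (measurable_nball z r) (measurable_open_Cn U_open) rU
    (mfin _ (measurable_open_Cn U_open) U_sub).
  apply: lt_le_trans; have := mCn_nball_ge z r0.
  rewrite -(fineK (mCn_nball_fin z r0)) lee_fin; apply: lt_le_trans.
  by rewrite exprn_gt0.
pose c := fine (m U) / K; have c0 : 0 < c by rewrite divr_gt0.
pose I W (f : 'rV[R[i]]_n -> R[i]) := Cn_integral W (fun z => Normc.normc (f z) ^+ 2).
have I0 W f : 0 <= I W f by exact: Cn_integral_sqr_ge0.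
have JU k : c <= I U (J k).
  have [+ _] := JP k U U_open U_sub.
  by rewrite (subgroup_preim G_subgroup G_U (FP k).1) /c ler_pdivrMr// mulrC.
pose B := K * fine (m Omega).
have JO k : I Omega (J k) <= B.
  have [_ /le_trans] := JP k Omega Omega_open (fun z => id); apply.
  rewrite ler_pM2l//; apply: fine_mCn_le => //.
  - exact: (aut_preim_open Omega_open).
  - exact: aut_preim_sub.
  - exact: mfin.
have B0 : 0 <= B by apply: le_trans (JO 0).
(* [F k] maps [V N], a subset of [inner_set Omega k], off that set, so the image lies in Omega minus
   [V k]. *)
have JV N k : (N <= k)%N -> I (V N) (J k) <= K * fine (m (Omega `\` V k)).
  move=> Nk; have [_ /le_trans] := JP k (V N) (oV N) (VO N); apply.
  have mOV : measurable (Omega `\` V k).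
    by apply: measurableD => //; exact: measurable_open_Cn.
  rewrite ler_pM2l//; apply: fine_mCn_le => //.
  - exact: (aut_preim_open Omega_open).
  - move=> z /= Vz; split; first exact: (aut_preim_sub (VO N) Vz).
    move=> /VE; rewrite -[z](aut_invK (F k)); apply: (FP k).2; apply: VE.
    exact: interior_inner_set_mono Vz.
  - by apply: mfin => // z [].
move=> cT; have [|phi [g [phi_mono Tg]]] := cT J.
  exists (Num.sqrt B) => k; rewrite /L2norm ler_wsqrtr//; exact: JO.
have phi_ge k : (k <= phi k)%N.
  elim: k => // k IH; apply: leq_ltn_trans IH _; exact: phi_mono.
(* The terms of [L2inner_Re_le] will add up to at most e times 2B + |g|^2 + 3, that is c/2, against
   the lower bound c. The 3 collects the three terms divided by e, each below e^2. *)
pose e := c / (2 * (2 * B + I Omega g + 3)).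
have den0 : 0 < 2 * B + I Omega g + 3.
  by rewrite ltr_wpDl// addr_ge0// mulr_ge0.
have e0 : 0 < e by rewrite divr_gt0// mulr_gt0.
have e20 : 0 < e ^+ 2 by rewrite exprn_gt0.
have pV k : measurable (@toCn R n @^-1` V k) by exact: measurable_toCn_open.
have pVmono : {homo (fun k => @toCn R n @^-1` V k) : k l / (k <= l)%N >-> k `<=` l}.
  by move=> k l kl t; exact: interior_inner_set_mono.
have pVU : \bigcup_k (@toCn R n @^-1` V k) = @toCn R n @^-1` Omega.
  by rewrite -preimage_bigcup bigcup_interior_inner_set.
have [N gN] := Rintegral_exhaustion (mu := lam) mD pV pVmono pVU
  (fun t _ => sqr_ge0 (Normc.normc (g (toCn t)))) (berg_sqint g) e20.
(* With integrand 1 the exhaustion lemma makes the volume of Omega minus [V k] small; the bound e^2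
   / K compensates the factor of [JV]. *)
have int1 : lam.-integrable (@toCn R n @^-1` Omega) (EFin \o cst (1 : R)).
  apply/integrableP; split; first by apply/measurable_EFinP; exact: measurable_cst.
  rewrite (eq_integral (cst 1%:E)); last by move=> t _; rewrite /= normr1.
  rewrite integral_cst// mul1e -ge0_fin_numE//; exact: (mfin Omega).
have eK : 0 < e ^+ 2 / K by rewrite divr_gt0.
have [N' mN'] := Rintegral_exhaustion (mu := lam) mD pV pVmono pVU
  (fun _ _ => ler01) int1 eK.
have [N'' _ TN] := (@cvgrPdist_lt _ _ _ _ _ _ _).1 Tg e e0.
(* [k] indexes the subsequence: [N] and [N'] are thresholds for [phi k], and [N''] is one for
   [k]. *)
pose k := maxn N (maxn N' N'').
have kN : (N <= phi k)%N by apply: leq_trans (phi_ge k); exact: leq_maxl.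
have kN' : (N' <= phi k)%N.
  by apply: leq_trans (phi_ge k); rewrite /k !leq_max leqnn orbT.
have kN'' : (N'' <= k)%N by rewrite /k !leq_max leqnn !orbT.
pose TJ := RU_adj (berg_restr Omega_open U_open U_sub (J (phi k))).
(* Pairing the restriction with itself gives the integral of |J|^2 over U on one side and the
   pairing of J with its image on the other. *)
have := RU_adjP (J (phi k)) (berg_restr Omega_open U_open U_sub (J (phi k))).
move=> /(congr1 (@complex.Re R)); rewrite L2inner_restr => adj.
have := L2inner_Re_le (J (phi k)) TJ g Omega_open (oV N) (VO N) e0.
rewrite -adj => up.
have t1 : I Omega (fun z => TJ z - g z) < e ^+ 2.
  rewrite /I -L2norm_sqr ltr_pXn2r ?nnegrE ?sqrtr_ge0 ?(ltW e0)//.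
  have := TN k kN''; rewrite /= sub0r normrN ger0_norm ?sqrtr_ge0//.
have t2 : I (V N) (J (phi k)) < e ^+ 2.
  apply: (le_lt_trans (JV N (phi k) kN)); have := mN' (phi k) kN'.
  rewrite Rintegral_cst ?mul1r; last exact: measurableD.
  by rewrite ltr_pdivlMr// mulrC.
have t3 := gN N (leqnn N).
have s3 : e^-1 * (I Omega (fun z => TJ z - g z) +
    I (V N) (J (phi k)) + \int[lam]_(t in @toCn R n @^-1` Omega `\` @toCn R n @^-1` V N)
      (Normc.normc (g (toCn t)) ^+ 2)) <= 3 * e.
  rewrite mulrC ler_pdivrMr// -mulrA -expr2.
  by move: t1 t2 t3; move: (I _ _) (I _ _) (Rintegral _ _ _) => x y z; lra.
have s1 : 2 * e * I Omega (J (phi k)) <= 2 * e * B.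
  by apply: ler_wpM2l (JO _); rewrite mulr_ge0// ltW.
have s2 : e * (2 * B + I Omega g + 3) = c / 2.
  by rewrite /e; field; rewrite gt_eqF.
have := JU (phi k); move/le_trans/(_ up); move: s1 s2 s3 c0; rewrite -/(I _ _).
rewrite /I; move: (Cn_integral _ _) (Cn_integral _ _) (e^-1 * _) => x y z; lra.
Qed.
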